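(* Assume that $p=k/l$, where $k,l$ are integers with $1\le l<k$, and put $c(p)=p^p(p-1)^{1-p}$. If $-1<r\le p-1$ then the probability measure $\nu(p,r)$ is absolutely continuous and $V_{p,r}$ is its density function, i.e. \[ \nu(p,r)=V_{p,r}(x)\,dx,\qquad x\in(0,c(p)). \] For $r=-1$ we have \[ \nu(p,-1)=\frac1p\,\delta_0+V_{p,-1}(x)\,dx,\qquad x\in(0,c(p)). \]
   Context: For $a\in\mathbb{R}$ and $n\in\{0,1,2,\ldots\}$, $\binom{a}{n}:=a(a-1)\cdots(a-n+1)/n!$ (with $\binom a0=1$). For $p\ge1$, $-1\le r\le p-1$, $\nu(p,r)$ denotes the unique probability measure with moments $\int x^n\,d\nu(p,r)(x)=\binom{np+r}{n}$, $n=0,1,2,\ldots$; its support is contained in $[0,c(p)]$. $\delta_0$ is the unit point mass at $0$. For $p>1$ and $r\in\mathbb{R}$, \[ \psi_{p,r}(\sigma)=\frac{\Gamma\big((\sigma-1)p+r+1\big)}{\Gamma(\sigma)\,\Gamma\big((\sigma-1)(p-1)+r+1\big)}, \] where $1/\Gamma$ is taken to be $0$ at the poles of $\Gamma$ and at removable singularities the value is the limit. $V_{p,r}$ is the inverse Mellin transform of $\psi_{p,r}$: \[ V_{p,r}(x)=\frac{1}{2\pi\mathrm{i}}\int_{d-\mathrm{i}\infty}^{d+\mathrm{i}\infty}x^{-\sigma}\psi_{p,r}(\sigma)\,d\sigma,\qquad x\in(0,c(p)), \] where $d$ is any real number with $d>1-\frac{1+r}{p}$ and the integral is understood as $\lim_{T\to\infty}\int_{d-\mathrm{i}T}^{d+\mathrm{i}T}$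 (it exists for rational $p>1$). *)

(* Defs.v *)
From HB Require Import structures.
From mathcomp Require Import all_boot all_order all_algebra.
From mathcomp Require Import complex.
From mathcomp Require Import all_classical all_reals all_analysis.
Import Order.TTheory GRing.Theory Num.Theory.
Import numFieldNormedType.Exports.

Set Implicit Arguments.
Unset Strict Implicit.
Unset Printing Implicit Defensive.

Local Open Scope classical_set_scope.
Local Open Scope complex_scope.
Local Open Scope ring_scope.

Section Definitions.
Context {R : realType}.

Definition gbinom (a : R) (n : nat) : R :=
  (\prod_(i < n) (a - i%:R)) / n`!%:R.

Definition cp (p : R) : R := p `^ p * (p - 1) `^ (1 - p).

(* [nu] is the measure nu(p,r). Only the moments are required: they determine
   [nu], and the location of the support is a consequence. *)
Definition is_nu (p r : R) (nu : probability (measurableTypeR R) R) : Prop :=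
  forall n : nat,
    nu.-integrable setT (fun x => (x ^+ n)%:E) /\
    (\int[nu]_x (x ^+ n)%:E = (gbinom (n%:R * p + r) n)%:E)%E.

Definition cexp (z : R[i]) : R[i] :=
  (expR (complex.Re z))%:C * (cos (complex.Im z) +i* sin (complex.Im z)).

(* b ^ z for a base b > 0 *)
Definition cpow (b : R) (z : R[i]) : R[i] := cexp (z * (ln b)%:C).

Definition Gamma_pole (z : R[i]) : Prop := exists n : nat, z = - n%:R.

(* Gauss's form of Euler's limit, valid on the whole complex plane minus the
   poles. The annotation [R[i]^o] selects the topology given by the modulus. *)
Definition cGamma (z : R[i]) : R[i] :=
  lim ((fun n : nat =>
    cpow n%:R z * n`!%:R / \prod_(i < n.+1) (z + i%:R) : R[i]^o) @ \oo).

Definition cGammaV (z : R[i]) : R[i] :=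
  if `[< Gamma_pole z >] then 0 else (cGamma z)^-1.

Definition psi_quotient (p r : R) (s : R[i]) : R[i] :=
  cGamma ((s - 1) * p%:C + r%:C + 1) *
  (cGammaV s * cGammaV ((s - 1) * (p - 1)%:C + r%:C + 1)).

(* At a pole of the numerator the value is the limit, when it exists
   (removable singularity); at a genuine pole of psi the value is irrelevant. *)
Definition psi (p r : R) (s : R[i]) : R[i] :=
  if `[< Gamma_pole ((s - 1) * p%:C + r%:C + 1) >]
  then lim ((psi_quotient p r w : R[i]^o) @[w --> (s : R[i]^o)^'])
  else psi_quotient p r s.

Definition cintegral (a b : R) (f : R -> R[i]) : R[i] :=
  (\int[lebesgue_measure]_(t in `[a, b]) complex.Re (f t)) +i*
  (\int[lebesgue_measure]_(t in `[a, b]) complex.Im (f t)).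

(* Integral over the segment from d - iT to d + iT, parametrized by
   t |-> d + it for t in [-T, T], whence the factor 'i. *)
Definition vertical_integral (d T : R) (f : R[i] -> R[i]) : R[i] :=
  cintegral (- T) T (fun t => f (d +i* t) * 'i%C).

(* V_{p,r}(x), computed on the vertical line Re s = d *)
Definition V (p r d x : R) : R[i] :=
  (2 * pi%:C * 'i%C)^-1 *
  lim ((vertical_integral d T (fun s => cpow x (- s) * psi p r s) : R[i]^o)
         @[T --> +oo]).

(* nu = m delta_0 + f(x) dx on ]0, c[: f is real-valued and measurable on
   ]0, c[, and both sides agree on every Borel set (so nu has no other mass). *)
Definition atom_plus_density (nu : probability (measurableTypeR R) R)
    (m c : R) (f : R -> R[i]) : Prop :=
  [/\ forall x, x \in `]0, c[ -> complex.Im (f x) = 0,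
      measurable_fun (`]0, c[ : set R) (fun x => complex.Re (f x)) &
      forall A : set R, measurable A ->
        (nu A = m%:E * \d_(0%R : R) A +
                \int[lebesgue_measure]_(x in A `&` `]0%R, c[) (complex.Re (f x))%:E)%E].

Definition has_density (nu : probability (measurableTypeR R) R)
    (c : R) (f : R -> R[i]) : Prop :=
  [/\ forall x, x \in `]0, c[ -> complex.Im (f x) = 0,
      measurable_fun (`]0, c[ : set R) (fun x => complex.Re (f x)) &
      forall A : set R, measurable A ->
        (nu A =
           \int[lebesgue_measure]_(x in A `&` `]0%R, c[) (complex.Re (f x))%:E)%E].

End Definitions.

(* Main.v *)
(* Idea. Put q = p - 1. On ]0, pi/p[ let X(a) = sin(pa)^p / (sin(qa)^q sin a)
   and rho(a) = sin(pa) / sin(qa); X decreases from c(p) to 0. With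
     B_r(a) = sin((r+1)a)/sin a + q sin((q-r)a)/sin(qa)
   the function K(s, r) = (1/pi) int X^s rho^r B_r satisfies, by integrating the
   derivative of X^s rho^r sin(ra), two first order recursions which are those of
   psi_{p,r}(s+1). For rational p they can be iterated so that Gauss' product
   gives 1/Gamma in the limit, while the powers of X concentrate at a = 0; hence
   K(s, r) = psi_{p,r}(s+1). At s = n this identifies the moments of nu(p, r)
   with those of the image under X of (1/pi) rho^r B_r da (plus an atom at 0 of
   mass 1/p when r = -1), and the moment problem is determinate because the
   moments grow at most geometrically. On a vertical line, Fubini turns the
   inverse Mellin integral into a Dirichlet integral in log X, whose limit is the
   density of that image. *)
From HB Require Import structures.
Require Import Defs.
From mathcomp Require Import all_boot all_order all_algebra.
From mathcomp Require Import complex.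
From mathcomp Require Import all_classical all_reals all_analysis.
From mathcomp Require Import measurable_realfun.
From mathcomp Require Import ring lra.
Import Order.TTheory GRing.Theory Num.Theory.
Import numFieldNormedType.Exports.
Import ComplexField.Normc.

Set Implicit Arguments.
Unset Strict Implicit.
Unset Printing Implicit Defensive.

Local Open Scope classical_set_scope.
Local Open Scope complex_scope.
Local Open Scope ring_scope.

(** * Complex limits and the Gamma product *)

(** On the loop [1 + z = rho e^(ia)], [z = |z| e^(ipa)] with [|z| = sin a / sin(qa)], the function
    [(1 + z)^p / z] is real and equals [X(a)]. The Cauchy integral for the coefficient of [z^n] in
    [(1 + z)^(np+r)] over this loop is the n-th moment of the image of [(1/pi) rho^r B_r da]; this
    is the origin of [X], [rho] and [B_r]. The loop has a corner at [z = -1], of interior angle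
    [2 pi/p]. For [r = -1], [n = 0] the pole of [1/(1 + z)] sits in that corner and takes away the
    fraction 1/p of the total mass: this is the atom. Recursions alone determine a function of
    complex [s] only up to periodic factors; the asymptotics at [a = 0] removes that freedom. One
    recursion lowers [r] by 1, the other lowers [s] by 1 and raises [r] by [p - 1]. Combining them
    so that [r] returns to its value requires an integer multiple of [p - 1] to be an integer, hence
    the rationality of [p]. The inverse Mellin integral is only a limit over symmetric segments, so
    the inversion is pointwise, by a Dini type estimate in the variable [log X]. *)

Section complex_convergence.
Context {R : realType}.
Implicit Types z w : R[i].

Lemma cReD z w : complex.Re (z + w) = complex.Re z + complex.Re w.
Proof. by case: z w => [? ?] [? ?]. Qed.
Lemma cImD z w : complex.Im (z + w) = complex.Im z + complex.Im w.
Proof. by case: z w => [? ?] [? ?]. Qed.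
Lemma cReN z : complex.Re (- z) = - complex.Re z. Proof. by case: z. Qed.
Lemma cImN z : complex.Im (- z) = - complex.Im z. Proof. by case: z. Qed.
Lemma cReM z w : complex.Re (z * w) =
  complex.Re z * complex.Re w - complex.Im z * complex.Im w.
Proof. by case: z w => [? ?] [? ?]. Qed.
Lemma cImM z w : complex.Im (z * w) =
  complex.Re z * complex.Im w + complex.Im z * complex.Re w.
Proof. by case: z w => [? ?] [? ?]. Qed.
Lemma complex_ext z w :
  complex.Re z = complex.Re w -> complex.Im z = complex.Im w -> z = w.
Proof. by case: z w => [a b] [c d] /= -> ->. Qed.
Lemma natrC n : (n%:R : R[i]) = (n%:R : R)%:C.
Proof. by rewrite rmorph_nat. Qed.
Lemma cRe_nat n : complex.Re (n%:R : R[i]) = n%:R. Proof. by rewrite natrC. Qed.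
Lemma cIm_nat n : complex.Im (n%:R : R[i]) = 0. Proof. by rewrite natrC. Qed.

Lemma normC_def z : `|z| = (normc z)%:C. Proof. by []. Qed.
Lemma normc_ge0 z : 0 <= normc z. Proof. by case: z => a b; exact: sqrtr_ge0. Qed.
Lemma normcD z w : normc (z + w) <= normc z + normc w.
Proof. by rewrite -lecR rmorphD -!normC_def ler_normD. Qed.
Lemma normcN z : normc (- z) = normc z.
Proof. by apply: complexI; rewrite -!normC_def normrN. Qed.
Lemma normc_Re z : `|complex.Re z| <= normc z.
Proof. by rewrite -lecR -normC_def normc_ge_Re. Qed.
Lemma normc_Im z : `|complex.Im z| <= normc z.
Proof.
have -> : complex.Im z = complex.Re (- (z * 'i%C)) by rewrite cReN ReiNIm opprK.
apply: le_trans (normc_Re _) _; rewrite normcN normcM.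
have -> : normc ('i%C : R[i]) = 1 by rewrite /= expr0n expr1n add0r sqrtr1.
by rewrite mulr1.
Qed.
Lemma normc_real (x : R) : normc x%:C = `|x|.
Proof. by rewrite /= expr0n addr0 sqrtr_sqr. Qed.
Lemma normc_le_ReIm z : normc z <= `|complex.Re z| + `|complex.Im z|.
Proof.
case: z => a b /=; rewrite -[leRHS]ger0_norm ?addr_ge0// -sqrtr_sqr.
rewrite ler_wsqrtr// sqrrD !real_normK ?num_real//.
by rewrite -addrA [_ *+ 2 + _]addrC addrA lerDl mulrn_wge0// mulr_ge0.
Qed.
Lemma normc_gt0 z : (0 < normc z) = (z != 0).
Proof.
rewrite lt_def normc_ge0 andbT; apply/idP/idP; apply: contra => /eqP.
  by move=> ->; rewrite normc0.
by move/eq0_normc => ->.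
Qed.

(** Limits are taken on real and imaginary parts, where the real theorems apply; [ccvgP] carries
    them to the topology of the modulus, in which [cGamma] and [V] take their [lim]. *)
Definition ccvg {T : Type} (F : set_system T) (u : T -> R[i]) z :=
  (complex.Re (u x) @[x --> F] --> complex.Re z) /\
  (complex.Im (u x) @[x --> F] --> complex.Im z).

Section ccvg.
Context {T : Type} {F : set_system T} {FF : ProperFilter F}.
Implicit Types u v : T -> R[i].

Lemma ccvgP u z : ccvg F u z -> (u x : R[i]^o) @[x --> F] --> (z : R[i]^o).
Proof.
move=> [/cvgrPdist_lt rc /cvgrPdist_lt ic]; apply/cvgrPdist_lt => e e0.
(* In the order of [R[i]] a positive element is real, so the radius may be replaced by its real
   part. *)
have [e' ee' e'0] : exists2 e', e = e'%:C & 0 < e'.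
  exists (complex.Re e); last by move: e0; rewrite ltcE => /andP[].
  by apply: complex_ext => //; move: e0; rewrite ltcE => /andP[/eqP].
have e20 : 0 < e' / 2 by rewrite divr_gt0.
have := rc _ e20; have := ic _ e20.
apply: filterS2 => x i r; rewrite ee' normC_def ltcR.
apply: le_lt_trans (normc_le_ReIm _) _.
by rewrite (splitr e') ltrD// (cReD, cImD) (cReN, cImN).
Qed.

Lemma ccvg_lim u z : ccvg F u z -> lim ((u x : R[i]^o) @[x --> F]) = z.
Proof. by move=> /ccvgP; apply/cvg_lim/norm_hausdorff. Qed.

Lemma ccvg_cst z : ccvg F (fun=> z) z.
Proof. by split; exact: cvg_cst. Qed.

Lemma ccvgM u v z w : ccvg F u z -> ccvg F v w -> ccvg F (fun x => u x * v x) (z * w).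
Proof.
move=> [ur ui] [vr vi]; split.
  rewrite cReM; under eq_fun do rewrite cReM.
  by apply: cvgB; apply: cvgM.
rewrite cImM; under eq_fun do rewrite cImM.
by apply: cvgD; apply: cvgM.
Qed.

Lemma ccvg_unique u z w : ccvg F u z -> ccvg F u w -> z = w.
Proof.
move=> [ur ui] [vr vi]; apply: complex_ext.
  exact: (cvg_unique _ ur vr).
exact: (cvg_unique _ ui vi).
Qed.

Lemma ccvg_near u v z : (\forall x \near F, u x = v x) -> ccvg F u z -> ccvg F v z.
Proof.
move=> uv [ur ui]; split.
  by apply: cvg_trans ur; apply: near_eq_cvg; apply: filterS uv => x ->.
by apply: cvg_trans ui; apply: near_eq_cvg; apply: filterS uv => x ->.
Qed.

Lemma ccvg_real (f : T -> R) (a : R) : f x @[x --> F] --> a -> ccvg F (fun x => (f x)%:C) a%:C.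
Proof. by move=> fa; split => //=; exact: cvg_cst. Qed.

Lemma ccvgV u z : z != 0 -> ccvg F u z -> ccvg F (fun x => (u x)^-1) z^-1.
Proof.
move=> z0 [ur ui].
have E w : w^-1 = (complex.Re w / (complex.Re w ^+ 2 + complex.Im w ^+ 2))
   -i* (complex.Im w / (complex.Re w ^+ 2 + complex.Im w ^+ 2)) by case: w.
have N0 : complex.Re z ^+ 2 + complex.Im z ^+ 2 != 0.
  rewrite paddr_eq0 ?sqr_ge0// !sqrf_eq0; apply: contra z0 => /andP[/eqP a /eqP b].
  by apply/eqP/complex_ext.
split.
  rewrite E /=; under eq_fun do rewrite E /=.
  apply: cvgM => //; apply: cvgV => //.
  by apply: cvgD; apply: cvgM.
rewrite E /=; under eq_fun do rewrite E /=.
apply: cvgN; apply: cvgM => //; apply: cvgV => //.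
by apply: cvgD; apply: cvgM.
Qed.

End ccvg.

End complex_convergence.

Section complex_exponential.
Context {R : realType}.
Implicit Types z w : R[i].

Lemma cexpD z w : cexp (z + w) = cexp z * cexp w.
Proof.
rewrite /cexp cReD cImD expRD cosD sinD; apply: complex_ext => /=; ring.
Qed.

Lemma cexp0 : cexp (0 : R[i]) = 1.
Proof. by rewrite /cexp /= expR0 cos0 sin0; apply: complex_ext => /=; ring. Qed.

Lemma cexp_neq0 z : cexp z != 0.
Proof.
apply/eqP => z0; have := cexpD z (- z); rewrite subrr cexp0 z0 mul0r => /eqP.
by rewrite oner_eq0.
Qed.

Lemma cexpN z : cexp (- z) = (cexp z)^-1.
Proof.
apply: (mulfI (cexp_neq0 z)); rewrite -cexpD subrr cexp0 mulfV// cexp_neq0//.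
Qed.

Lemma cexp_real (x : R) : cexp x%:C = (expR x)%:C.
Proof. by rewrite /cexp /= cos0 sin0; apply: complex_ext => /=; ring. Qed.

Lemma Re_cexp z : complex.Re (cexp z) = expR (complex.Re z) * cos (complex.Im z).
Proof. by rewrite /cexp cReM /=; ring. Qed.
Lemma Im_cexp z : complex.Im (cexp z) = expR (complex.Re z) * sin (complex.Im z).
Proof. by rewrite /cexp cImM /=; ring. Qed.

Lemma ccvg_cexp {T : Type} (F : set_system T) {FF : ProperFilter F} u z :
  ccvg F u z -> ccvg F (fun x => cexp (u x)) (cexp z).
Proof.
move=> [ur ui]; split.
  rewrite Re_cexp; under eq_fun do rewrite Re_cexp.
  apply: cvgM; first by apply: continuous_cvg => //; exact: continuous_expR.
  by apply: continuous_cvg => //; exact: continuous_cos.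
rewrite Im_cexp; under eq_fun do rewrite Im_cexp.
apply: cvgM; first by apply: continuous_cvg => //; exact: continuous_expR.
by apply: continuous_cvg => //; exact: continuous_sin.
Qed.

End complex_exponential.

(** * Convergence of infinite products to a nonzero limit *)

Section infinite_product.
Context {R : realType}.

(* The bound on [u] telescopes, so that [normc (Q n - Q m)] is at most
   [2 C normc (Q m) / m] for [n >= m >= 4 C]. *)
Lemma ccvg_product (Q u : nat -> R[i]) (C : R) (n0 : nat) :
  (forall n, (n0 <= n)%N -> Q n.+1 = Q n * (1 + u n)) ->
  (forall n, (n0 <= n)%N -> normc (u n) <= C * (n%:R^-1 - n.+1%:R^-1)) ->
  (0 < n0)%N ->
  (forall n, (n0 <= n)%N -> Q n != 0) ->
  exists2 z, z != 0 & ccvg \oo Q z.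
Proof.
move=> HQ Hu n00 Q0.
have C0 : 0 <= C.
  have := le_trans (normc_ge0 _) (Hu _ (leqnn n0)).
  rewrite pmulr_lge0// subr_gt0 ltf_pV2 ?posrE ?ltr0n// ltr_nat//.
(* From [m0] on, [C / m <= 1/4], so the total relative change of [Q] after [m] is at most one
   half. *)
pose m0 := maxn n0 (Num.truncn (4 * C)).+1.
have m0n0 : (n0 <= m0)%N by rewrite leq_max leqnn.
have m0C m : (m0 <= m)%N -> C / m%:R <= 4^-1.
  move=> mm; have m_gt0 : (0 < m)%N by apply: leq_trans mm; exact: leq_trans m0n0.
  rewrite ler_pdivrMr ?ltr0n//.
  have : 4 * C <= m%:R.
    apply: le_trans (ltW (truncnS_gt (4 * C))) _.
    by rewrite ler_nat; apply: leq_trans mm; rewrite leq_max leqnn orbT.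
  lra.
have key m : (m0 <= m)%N -> forall k,
    normc (Q (m + k)%N - Q m) <= 2 * C * normc (Q m) * (m%:R^-1 - (m + k)%:R^-1).
  move=> mm; elim => [|k IH].
    by rewrite addn0 !subrr normc0 mulr0.
  have m_gt0 : (0 < m)%N by apply: leq_trans mm; exact: leq_trans m0n0.
  have n0mk : (n0 <= m + k)%N by rewrite (leq_trans m0n0)// (leq_trans mm) ?leq_addr.
  have Qm := normc_ge0 (Q m).
  have mk : 0 <= (m + k)%:R^-1 :> R by rewrite invr_ge0.
  (* The induction hypothesis already keeps [Q (m + k)] comparable to [Q m]; this bounds the next
     increment by one more term of the telescoping sum. *)
  have Qmk : normc (Q (m + k)%N) <= 2 * normc (Q m).
    have -> : Q (m + k)%N = Q m + (Q (m + k)%N - Q m) by rewrite addrC subrK.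
    apply: le_trans (normcD _ _) _.
    apply: (@le_trans _ _ (normc (Q m) + 2 * normc (Q m) * (C / m%:R))).
      rewrite lerD2l; apply: le_trans IH _.
      rewrite (_ : 2 * C * _ * _ = 2 * normc (Q m) * (C / m%:R) - 2 * C * normc (Q m) * (m + k)%:R^-1); last by ring.
      by rewrite gerBl !mulr_ge0.
    have := m0C _ mm; nra.
  rewrite addnS HQ//.
  have -> : Q (m + k)%N * (1 + u (m + k)%N) - Q m =
    (Q (m + k)%N - Q m) + Q (m + k)%N * u (m + k)%N by ring.
  apply: le_trans (normcD _ _) _; rewrite normcM.
  have Huk := Hu _ n0mk.
  have un := normc_ge0 (u (m + k)%N).
  have H : normc (Q (m + k)%N) * normc (u (m + k)%N) <=
     2 * normc (Q m) * (C * ((m + k)%:R^-1 - (m + k).+1%:R^-1)).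
    by apply: ler_pM => //; exact: normc_ge0.
  apply: le_trans (lerD IH H) _; rewrite le_eqVlt; apply/orP; left; apply/eqP; ring.
have key1 m n : (m0 <= m)%N -> (m <= n)%N -> normc (Q n - Q m) <= 2 * normc (Q m) * (C / m%:R).
  move=> mm mn; rewrite -(subnKC mn); apply: le_trans (key _ mm _) _.
  rewrite mulrBr -[leRHS]subr0 lerB//; first by rewrite le_eqVlt; apply/orP; left; apply/eqP; ring.
  by rewrite !mulr_ge0 ?invr_ge0// normc_ge0.
have Qb m : (m0 <= m)%N -> normc (Q m) <= 2 * normc (Q m0).
  move=> mm; have -> : Q m = Q m0 + (Q m - Q m0) by rewrite addrC subrK.
  apply: le_trans (normcD _ _) _.
  have := key1 _ _ (leqnn _) mm; have := m0C _ (leqnn m0); have := normc_ge0 (Q m0); nra.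
(* This reverse comparison keeps the sequence away from 0, so that the limit is nonzero. *)
have lowb m : (m0 <= m)%N -> normc (Q m0) <= 2 * normc (Q m).
  move=> mm; have E : Q m0 = Q m - (Q m - Q m0) by ring.
  have := normcD (Q m) (- (Q m - Q m0)); rewrite normcN -E.
  have := key1 _ _ (leqnn _) mm; have := m0C _ (leqnn m0); have := normc_ge0 (Q m0); nra.
have cauchy (f : R[i] -> R) : (forall z w, f z - f w = f (z - w)) ->
    (forall z, `|f z| <= normc z) -> cvgn (f \o Q).
  move=> fB fn; apply: cauchy_cvg; apply/cauchyP => e e0.
  near \oo => m.
  have mm : (m0 <= m)%N by near: m; exact: nbhs_infty_ge.
  exists (f (Q m)); rewrite /fmapE /=.
  near=> n.
  have mn : (m <= n)%N by near: n; exact: nbhs_infty_ge.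
  rewrite /ball /= -normrN opprB fB.
  apply: le_lt_trans (fn _) _; apply: le_lt_trans (key1 _ _ mm mn) _.
  have m_gt0 : (0 < m)%N by apply: leq_trans mm; exact: leq_trans m0n0.
  apply: (@le_lt_trans _ _ (4 * normc (Q m0) * C / m%:R)).
    have := Qb _ mm; have : 0 <= C / m%:R by rewrite divr_ge0.
    rewrite -!mulrA; nra.
  rewrite ltr_pdivrMr ?ltr0n// [e * _]mulrC -ltr_pdivrMr//.
  apply: lt_le_trans (truncnS_gt _) _.
  rewrite ler_nat; near: m; exact: nbhs_infty_ge.
have /cvg_ex[a ha] : cvgn ((@complex.Re R) \o Q).
  apply: cauchy => [z w|z]; [by rewrite cReD cReN|exact: normc_Re].
have /cvg_ex[b hb] : cvgn ((@complex.Im R) \o Q).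
  apply: cauchy => [z w|z]; [by rewrite cImD cImN|exact: normc_Im].
exists (a +i* b); last by split.
apply/eqP => -[a0 b0].
have nQ0 : 0 < normc (Q m0) by rewrite normc_gt0 Q0.
have : normc (Q m0) / 2 <= 0.
  have cc : (fun n => `|complex.Re (Q n)| + `|complex.Im (Q n)|) @ \oo --> `|a| + `|b|.
    by apply: cvgD; apply: cvg_norm.
  have <- : `|a| + `|b| = 0 by rewrite a0 b0 normr0 addr0.
  rewrite -(cvg_lim _ cc)//; apply: limr_ge; first by apply/cvg_ex; exists (`|a| + `|b|).
  near=> n; rewrite ler_pdivrMr// mulrC; apply: le_trans (lowb n _) _.
    by near: n; exact: nbhs_infty_ge.
  by rewrite ler_pM2l// normc_le_ReIm.
lra.
Unshelve. all: by end_near. Qed.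
End infinite_product.

(** * Second order estimates for the exponential and the logarithm *)

Section exponential_estimates.
Context {R : realType}.
Implicit Types x y : R.

(** Both sides come from [1 + x <= exp x]: directly from below, and at [- x] from above, in the form
    [exp x (1 - x) <= 1]. *)
Lemma expR_quad x : `|x| <= 2^-1 -> `|expR x - 1 - x| <= 2 * x ^+ 2.
Proof.
rewrite ler_norml => /andP[x1 x2].
have e1 := expR_ge1Dx x; have e2 := expR_ge1Dx (- x).
have e3 : expR x * expR (- x) = 1 by rewrite -expRD subrr expR0.
have e0 := expR_gt0 x.
rewrite ger0_norm; last lra.
have : expR x * (1 - x) <= expR x * expR (- x) by rewrite ler_pM2l.
rewrite e3.
nra.
Qed.

Lemma sin_le_norm y : `|sin y| <= `|y|.
Proof.
have [y0|y0|->] := ltgtP y 0; last by rewrite sin0.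
  have [x _ E] := @MVT_segment R sin cos _ _ (ltW y0) (fun x _ => is_derive_sin x) (continuous_subspaceT (@continuous_sin R)).
  move: E; rewrite sin0 !sub0r -normrN => ->; rewrite normrM normrN.
  by rewrite ler_piMl// ler_norml cos_geN1 cos_le1.
have [x _ E] := @MVT_segment R sin cos _ _ (ltW y0) (fun x _ => is_derive_sin x) (continuous_subspaceT (@continuous_sin R)).
move: E; rewrite sin0 !subr0 => ->; rewrite normrM.
by rewrite ler_piMl// ler_norml cos_geN1 cos_le1.
Qed.

(** Half-angle form [1 - cos y = 2 sin(y/2)^2]. *)
Lemma cos_quad y : `|cos y - 1| <= y ^+ 2 / 2.
Proof.
have -> : y = y / 2 + y / 2 by rewrite -splitr.
rewrite cosD -splitr.
have := cos2Dsin2 (y / 2).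
set c := cos _; set s := sin _ => cs.
have -> : c * c - s * s - 1 = - (2 * s ^+ 2) by rewrite -[X in _ - X]cs; ring.
rewrite normrN ger0_norm; last by have := sqr_ge0 s; lra.
have : s ^+ 2 <= (y / 2) ^+ 2.
  rewrite -[s ^+ 2]real_normK ?num_real// -[(y / 2) ^+ 2]real_normK ?num_real//.
  by rewrite ler_pXn2r ?nnegrE ?normr_ge0// /s; exact: sin_le_norm.
lra.
Qed.

Lemma sin_quad y : `|y| <= 1 -> `|sin y - y| <= y ^+ 2.
Proof.
wlog y0 : y / 0 <= y.
  move=> H; have [/H//|y0 y1] := leP 0 y.
  have -> : sin y - y = - (sin (- y) - - y) by rewrite sinN; ring.
  rewrite normrN -sqrrN.
  by apply: H; rewrite ?normrN// oppr_ge0 ltW.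
rewrite ger0_norm// => y1.
have := y0; rewrite le_eqVlt => /predU1P[<-|y_gt0]; first by rewrite sin0 subrr normr0 expr0n.
have [x xy E] := @MVT_segment R sin cos _ _ y0 (fun x _ => is_derive_sin x) (continuous_subspaceT (@continuous_sin R)).
move: E; rewrite sin0 !subr0 => ->.
have -> : cos x * y - y = (cos x - 1) * y by ring.
rewrite normrM (ger0_norm y0) expr2 ler_wpM2r//.
apply: le_trans (cos_quad x) _.
move: xy; rewrite in_itv /= => /andP[]; nra.
Qed.

Lemma normc_sqr (z : R[i]) : normc z ^+ 2 = complex.Re z ^+ 2 + complex.Im z ^+ 2.
Proof. by case: z => a b /=; rewrite sqr_sqrtr// addr_ge0// sqr_ge0. Qed.

(** With [w = x + iy], the two parts split as [(e^x - 1 - x) + e^x (cos y - 1)] and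
    [(e^x - 1) sin y + (sin y - y)], where every term is of second order. *)
Lemma cexp_quad (w : R[i]) : normc w <= 2^-1 ->
  normc (cexp w - 1 - w) <= 4 * normc w ^+ 2.
Proof.
move=> w1; have xb := le_trans (normc_Re w) w1; have yb := le_trans (normc_Im w) w1.
rewrite normc_sqr; apply: le_trans (normc_le_ReIm _) _.
rewrite !(cReD, cImD, cReN, cImN) Re_cexp Im_cexp /=.
set x := complex.Re w in xb *; set y := complex.Im w in yb *.
have H1 := expR_quad xb; have H2 := cos_quad y.
have H3 : `|sin y - y| <= y ^+ 2 by apply: sin_quad; apply: le_trans yb _; lra.
have ex : `|expR x - 1| <= 2 * `|x|.
  have -> : expR x - 1 = (expR x - 1 - x) + x by ring.
  apply: le_trans (ler_normD _ _) _; move: H1; rewrite -(real_normK (num_real x)).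
  have := normr_ge0 x; nra.
have ex2 : expR x <= 2.
  by move: ex xb; rewrite !ler_norml => /andP[_ ?]; move=> xb; have : `|x| <= 2^-1; [rewrite ler_norml|]; lra.
have R1 : `|expR x * cos y - 1 - x| <= 2 * x ^+ 2 + y ^+ 2.
  have -> : expR x * cos y - 1 - x = (expR x - 1 - x) + expR x * (cos y - 1) by ring.
  apply: le_trans (ler_normD _ _) _; rewrite normrM (ger0_norm (expR_ge0 x)).
  have := expR_ge0 x; have := normr_ge0 (cos y - 1); nra.
have I1 : `|expR x * sin y - 0 - y| <= 2 * `|x| * `|y| + 2 * `|x| * y ^+ 2 + y ^+ 2.
  have -> : expR x * sin y - 0 - y = (expR x - 1) * ((sin y - y) + y) + (sin y - y) by ring.
  apply: le_trans (ler_normD _ _) _; rewrite normrM lerD//.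
  rewrite -mulrDr ler_pM// [leRHS]addrC.
  by apply: le_trans (ler_normD _ _) _; rewrite lerD.
apply: le_trans (lerD R1 I1) _.
move: xb yb; rewrite -(real_normK (num_real x)) -(real_normK (num_real y)).
have := normr_ge0 x; have := normr_ge0 y.
move: `|x| `|y| => a b b0 a0 a1 b1.
have := sqr_ge0 (a - b); have : a * b ^+ 2 <= 2^-1 * b ^+ 2 by rewrite ler_wpM2r ?sqr_ge0.
nra.
Qed.

Lemma lnS_bounds n : (0 < n)%N ->
  n.+1%:R^-1 <= ln (n.+1%:R : R) - ln n%:R <= n%:R^-1.
Proof.
move=> n0; have n0R : 0 < n%:R :> R by rewrite ltr0n.
have S0 : 0 < n.+1%:R :> R by rewrite ltr0n.
rewrite -ln_div ?posrE//; apply/andP; split.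
  rewrite -[leRHS]opprK -lnV ?posrE ?divr_gt0// invf_div lerNr.
  have -> : n%:R / n.+1%:R = 1 + (- n.+1%:R^-1) :> R.
    by rewrite -natr1; field; rewrite natr1 lt0r_neq0.
  apply: le_ln1Dx; rewrite ltrN2 invf_lt1// ltr1n ltnS//.
have -> : n.+1%:R / n%:R = 1 + n%:R^-1 :> R by rewrite -natr1; field; exact: lt0r_neq0.
by apply: le_ln1Dx; apply: lt_trans (ltrN10 _) _; rewrite invr_gt0.
Qed.

End exponential_estimates.

(** * Gauss's product for the reciprocal Gamma function *)

Section gauss_product.
Context {R : realType}.
Implicit Types z : R[i].

Definition rising z (n : nat) : R[i] := \prod_(i < n) (z + i%:R).

(* [gauss z n --> 1 / Gamma (z + 1)] *)
Definition gauss z (n : nat) : R[i] :=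
  rising (z + 1) n / n`!%:R * cexp (- z * (ln n%:R)%:C).

Lemma risingS z n : rising z n.+1 = rising z n * (z + n%:R).
Proof. by rewrite /rising big_ord_recr. Qed.

Lemma rising0 z : rising z 0 = 1. Proof. by rewrite /rising big_ord0. Qed.

Lemma rising_neq0 z n : ~ Gamma_pole z -> rising z n != 0.
Proof.
move=> zp; elim: n => [|n IH]; first by rewrite rising0 oner_eq0.
rewrite risingS mulf_neq0//; apply/eqP => zn; apply: zp.
by exists n; apply/eqP; rewrite -addr_eq0 zn.
Qed.

Lemma natrC_neq0 n : (0 < n)%N -> (n%:R : R[i]) != 0.
Proof. by move=> n0; rewrite pnatr_eq0 -lt0n. Qed.

Lemma factC_neq0 n : (n`!%:R : R[i]) != 0.
Proof. by rewrite natrC_neq0// fact_gt0. Qed.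

Lemma gaussS z n : (0 < n)%N ->
  gauss z n.+1 = gauss z n * ((1 + z / n.+1%:R) * cexp (- z * (ln n.+1%:R - ln n%:R)%:C)).
Proof.
move=> n0; rewrite /gauss risingS factS natrM.
rewrite (_ : - z * (ln n.+1%:R)%:C = - z * (ln n%:R)%:C + - z * (ln n.+1%:R - ln n%:R)%:C); last first.
  by rewrite -mulrDr -rmorphD addrC subrK.
rewrite cexpD (_ : z + 1 + n%:R = n.+1%:R * (1 + z / n.+1%:R)); last first.
  by rewrite mulrDr mulr1 mulrCA mulfV ?natrC_neq0// mulr1 -natr1; ring.
have := natrC_neq0 (ltn0Sn n); have := factC_neq0 n.
move: (cexp _) (cexp _) n.+1%:R n`!%:R => a b c e e0 c0.
by field; rewrite e0 c0.
Qed.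

(** Consecutive terms have ratio [1 + O(1/n^2)], because [ln (n+1) - ln n] agrees with [1/(n+1)] to
    first order; the error is measured by [1/n - 1/(n+1)], which telescopes. *)
Lemma gauss_cvg z : ~ Gamma_pole (z + 1) -> exists2 g, g != 0 & ccvg \oo (gauss z) g.
Proof.
move=> zp.
(* For [n >= 2 |z|] the exponent [w] below has modulus at most 1/2, as [cexp_quad] requires. *)
pose n0 := (Num.truncn (2 * normc z)).+1.
(* [|z|] bounds [e + w]; of the 17, one bounds [e w] and 16 = 2 * 4 * 2 the remainder: 2 for
   [1 + e], 4 from [cexp_quad], 2 for replacing [1/n^2] by [1/(n(n+1))]. *)
pose C := normc z + 17 * normc z ^+ 2.
apply: (@ccvg_product R _ (fun n => (1 + z / n.+1%:R) * cexp (- z * (ln n.+1%:R - ln n%:R)%:C) - 1) C n0) => // n nn0.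
- by rewrite (gaussS _ (leq_trans _ nn0))//; congr (_ * _); ring.
- have n_gt0 : (0 < n)%N by apply: leq_trans nn0.
  have nR0 : 0 < n%:R :> R by rewrite ltr0n.
  have SR0 : 0 < n.+1%:R :> R by rewrite ltr0n.
  have zn : 2 * normc z <= n%:R.
    by apply: le_trans (ltW (truncnS_gt _)) _; rewrite ler_nat.
  have /andP[d1 d2] := @lnS_bounds R n n_gt0.
  set d := ln n.+1%:R - ln n%:R in d1 d2 *.
  have SS : n%:R^-1 - n.+1%:R^-1 = n%:R^-1 * n.+1%:R^-1 :> R.
    rewrite -natr1; have S1 : n%:R + 1 != 0 :> R by rewrite natr1 lt0r_neq0.
    have := lt0r_neq0 nR0; move: n%:R S1 => x x1 x0.
    by field; rewrite x1 x0.
  have a1 : n.+1%:R^-1 <= n%:R^-1 :> R by rewrite lef_pV2 ?posrE// ler_nat.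
  have a2 : n%:R^-1 <= 2 * n.+1%:R^-1 :> R.
    rewrite ler_pdivlMr// mulrC ler_pdivrMr// -natrM ler_nat.
    by rewrite mul2n -addnn -addn1 leq_add2l.
  have a0 : 0 <= n.+1%:R^-1 :> R by rewrite invr_ge0 ltW.
  have zn2 : normc z * n%:R^-1 <= 2^-1 by rewrite ler_pdivrMr//; lra.
  have iC : (n.+1%:R : R[i])^-1 = (n.+1%:R^-1 : R)%:C by rewrite natrC -fmorphV.
  rewrite iC; move: SS a1 a2 a0 zn2 d1 d2 => {iC SR0 zn}.
  move: (n%:R^-1) (n.+1%:R^-1) => i0 i1 SS a1 a2 a0 zn2 d1 d2.
  clearbody d.
  have d0 : 0 <= d by exact: le_trans d1.
  set e := z * i1%:C; set w := - z * d%:C.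
  have z0 := normc_ge0 z; have z2 := sqr_ge0 (normc z).
  have ne : normc e = normc z * i1 by rewrite /e normcM normc_real ger0_norm.
  have nw : normc w = normc z * d by rewrite /w normcM normcN normc_real ger0_norm.
  have w1 : normc w <= normc z * i0 by rewrite nw ler_wpM2l.
  have q1 := cexp_quad (le_trans w1 zn2).
  (* The first order terms [e] and [w] nearly cancel; each of the other two terms is quadratic. *)
  have -> : (1 + e) * cexp w - 1 = (e + w) + e * w + (1 + e) * (cexp w - 1 - w) by ring.
  have new : normc (e + w) <= normc z * (i0 - i1).
    have -> : e + w = z * (i1 - d)%:C by rewrite rmorphB mulrBr /e /w mulNr.
    rewrite normcM normc_real ler_wpM2l// ler_norml; apply/andP; split; lra.
  have e1 : normc (1 + e) <= 2.
    apply: le_trans (normcD _ _) _; rewrite ne normc1; nra.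
  apply: le_trans (normcD _ _) _; apply: (le_trans (lerD (normcD _ _) (lexx _))).
  rewrite (normcM e w) (normcM (1 + e)).
  have ew : normc e * normc w <= normc z ^+ 2 * (i0 - i1).
    rewrite SS ne expr2 -mulrA [i0 * i1]mulrC mulrACA mulrA ler_wpM2l ?mulr_ge0//.
  have er : normc (1 + e) * normc (cexp w - 1 - w) <= 16 * normc z ^+ 2 * (i0 - i1).
    apply: (@le_trans _ _ (2 * (4 * normc w ^+ 2))).
      by apply: ler_pM => //; exact: normc_ge0.
    have : normc w ^+ 2 <= (normc z * i0) ^+ 2.
      by rewrite ler_pXn2r ?nnegrE ?normc_ge0// mulr_ge0// (le_trans a0).
    rewrite SS exprMn => ww.
    have : i0 ^+ 2 <= 2 * (i0 * i1).
      by rewrite expr2 mulrCA ler_wpM2l// (le_trans a0).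
    nra.
  rewrite /C; lra.
- rewrite /gauss; apply: mulf_neq0; last exact: cexp_neq0.
  by rewrite mulf_neq0 ?invr_eq0 ?factC_neq0 ?rising_neq0.
Qed.

Lemma ccvg_divn z : ccvg \oo (fun n : nat => z / n%:R) 0.
Proof.
rewrite -(mulr0 z); apply: ccvgM; first exact: ccvg_cst.
have -> : (0 : R[i]) = (0 : R)%:C by [].
apply: (@ccvg_near _ _ _ _ (fun n : nat => (n%:R^-1 : R)%:C)).
  by near=> n; rewrite natrC fmorphV.
apply: ccvg_real.
apply/gtr0_cvgV0; last exact: cvgr_idn.
by near=> n; rewrite ltr0n; near: n; exact: nbhs_infty_gt.
Unshelve. all: by end_near. Qed.

Lemma gauss_cGamma z g : ~ Gamma_pole (z + 1) -> g != 0 -> ccvg \oo (gauss z) g ->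
  cGamma (z + 1) = g^-1.
Proof.
move=> zp g0 gg; rewrite /cGamma; apply: ccvg_lim.
(* The product in [cGamma] has [n.+1] factors against [n] in [gauss], and its power of [n] is
   [z + 1] instead of [z]; the discrepancy is [1 + (z + 1) / n], which tends to 1. *)
apply: (@ccvg_near _ _ _ _ (fun n => (gauss z n * (1 + (z + 1) / n%:R))^-1)).
  near=> n.
  have n0 : (0 < n)%N by near: n; exact: nbhs_infty_gt.
  have rn0 := @rising_neq0 (z + 1) n zp; have := @rising_neq0 (z + 1) n.+1 zp.
  rewrite -/(rising (z + 1) n.+1) risingS => Sn0.
  have zn : z + 1 + n%:R != 0 by apply: contra Sn0 => /eqP ->; rewrite mulr0.
  have -> : cpow n%:R (z + 1) = cexp (z * (ln n%:R)%:C) * n%:R.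
    by rewrite /cpow mulrDl mul1r cexpD cexp_real lnK ?posrE ?ltr0n// natrC.
  rewrite /gauss mulNr cexpN.
  have -> : 1 + (z + 1) / n%:R = (z + 1 + n%:R) / n%:R.
    by field; rewrite natrC_neq0.
  set E := cexp _; have E0 : E != 0 by rewrite cexp_neq0.
  field; rewrite rn0 E0 zn natrC_neq0// factC_neq0//.
apply: ccvgV; rewrite ?mulr1//.
rewrite -[X in ccvg _ _ X]mulr1; apply: ccvgM => //.
rewrite -[X in ccvg _ _ X]addr0.
have [h1 h2] := ccvg_divn (z + 1); split.
  by under eq_fun do rewrite cReD; rewrite cReD; apply: cvgD => //; exact: cvg_cst.
by under eq_fun do rewrite cImD; rewrite cImD; apply: cvgD => //; exact: cvg_cst.
Unshelve. all: by end_near. Qed.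

(** This includes the poles, where the product eventually contains a zero factor, so later limits
    need no case distinction. *)
Lemma gauss_cGammaV z : ccvg \oo (gauss z) (cGammaV (z + 1)).
Proof.
rewrite /cGammaV; case: asboolP => [[n zn]|zp].
  apply: (@ccvg_near _ _ _ _ (fun=> 0)); last exact: ccvg_cst.
  near=> m.
  have nm : (n < m)%N by near: m; exact: nbhs_infty_gt.
  by rewrite /gauss /rising (bigD1 (Ordinal nm))//= zn addNr !mul0r.
by have [g g0 gg] := gauss_cvg zp; rewrite (gauss_cGamma zp g0 gg) invrK.
Unshelve. all: by end_near. Qed.

Lemma cGammaV_neq0 z : ~ Gamma_pole (z + 1) -> cGammaV (z + 1) != 0.
Proof.
move=> zp; rewrite /cGammaV; case: asboolP => // _.
by have [g g0 gg] := gauss_cvg zp; rewrite (gauss_cGamma zp g0 gg) invrK.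
Qed.

End gauss_product.

(** * Integrals over open intervals *)

Section real_integrable.
Context {d} {T : measurableType d} {R : realType} (mu : {measure set T -> \bar R}).
Variables (D : set T) (mD : measurable D).
Implicit Types f g : T -> R.

Lemma integrable_realZ k f : mu.-integrable D (EFin \o f) ->
  mu.-integrable D (EFin \o (fun x => k * f x)).
Proof. exact: integrableZl. Qed.

Lemma integrable_realD f g : mu.-integrable D (EFin \o f) -> mu.-integrable D (EFin \o g) ->
  mu.-integrable D (EFin \o (fun x => f x + g x)).
Proof. exact: integrableD. Qed.

Lemma integrable_realB f g : mu.-integrable D (EFin \o f) -> mu.-integrable D (EFin \o g) ->
  mu.-integrable D (EFin \o (fun x => f x - g x)).
Proof. exact: integrableB. Qed.

End real_integrable.

Section exhaustion.
Context {R : realType}.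
Notation mu := (@lebesgue_measure R).
Implicit Types (a b : R) (f g F : R -> R).

(** Dividing by [n + 3] makes each gap at most a third of the length, so even the first segment is
    nondegenerate. *)
Definition exhaust_gap a b (n : nat) : R := (b - a) / n.+3%:R.
Definition exhaust a b n : set R := `[a + exhaust_gap a b n, b - exhaust_gap a b n].

Lemma exhaust_gap_gt0 a b n : a < b -> 0 < exhaust_gap a b n.
Proof. by move=> ab; rewrite divr_gt0// subr_gt0. Qed.

Lemma exhaust_gap_lt a b n : a < b -> a + exhaust_gap a b n < b - exhaust_gap a b n.
Proof.
move=> ab; have : exhaust_gap a b n <= (b - a) / 3.
  by rewrite ler_wpM2l ?subr_ge0 ?(ltW ab)// lef_pV2 ?posrE// ler_nat.
by have : 0 < b - a; [rewrite subr_gt0|lra].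
Qed.

Lemma cvg_exhaust_gap a b : exhaust_gap a b n @[n --> \oo] --> 0.
Proof.
rewrite -(mulr0 (b - a)); apply: cvgM; first exact: cvg_cst.
have := @cvg_harmonic R; rewrite -(cvg_shiftn 2) /harmonic /=.
by under eq_fun do rewrite addn2.
Qed.

Lemma exhaust_sub a b n : a < b -> exhaust a b n `<=` `]a, b[.
Proof.
move=> ab x; rewrite /exhaust /= !in_itv /=; have := exhaust_gap_gt0 n ab => e0 /andP[x1 x2].
by apply/andP; split; lra.
Qed.

Lemma exhaust_nondecreasing a b : a < b -> nondecreasing_seq (exhaust a b).
Proof.
move=> ab m n mn; rewrite subsetEset => x; rewrite /exhaust /= !in_itv /= => /andP[x1 x2].
have : exhaust_gap a b n <= exhaust_gap a b m.
  by rewrite ler_wpM2l ?subr_ge0 ?(ltW ab)// lef_pV2 ?posrE// ler_nat.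
by move=> e; apply/andP; split; lra.
Qed.

Lemma near_exhaust a b x : x \in `]a, b[ -> \forall n \near \oo, exhaust a b n x.
Proof.
rewrite in_itv /= => /andP[ax xb].
have := cvg_exhaust_gap a b => /cvgrPdist_lt /(_ (Num.min (x - a) (b - x))).
rewrite lt_min !subr_gt0 ax xb => /(_ isT); apply: filterS => n.
rewrite sub0r normrN ger0_norm; last by rewrite ltW// exhaust_gap_gt0// (lt_trans ax).
rewrite lt_min => /andP[h1 h2]; rewrite /exhaust /= in_itv /=; apply/andP; split; lra.
Qed.

Lemma bigcup_exhaust a b : a < b -> \bigcup_n exhaust a b n = `]a, b[%classic.
Proof.
move=> ab; apply/seteqP; split => [x [n _]|x xab]; first exact: exhaust_sub.
by have [n _ /(_ n (leqnn n)) ?] := near_exhaust xab; exists n.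
Qed.

Lemma oo_continuous_measurable a b f : {in `]a, b[, continuous f} ->
  measurable_fun `]a, b[ f.
Proof.
move=> cf; apply: open_continuous_measurable_fun => // x; rewrite inE /= => xab.
exact: cf.
Qed.

Lemma in_continuous_within a b c d f : {in `]a, b[, continuous f} ->
  `[c, d] `<=` `]a, b[ -> {within `[c, d], continuous f}.
Proof.
move=> cf cd; apply: continuous_in_subspaceT => x; rewrite inE => xcd.
by apply: cf; exact: cd.
Qed.

Lemma FTC_cc a b c d f F : c < d -> `[c, d] `<=` `]a, b[ ->
  {in `]a, b[, continuous f} ->
  {in `]a, b[, forall x : R, is_derive x (1 : R) F (f x)} ->
  (\int[mu]_(x in `[c, d]) (f x)%:E = (F d - F c)%:E)%E.
Proof.
move=> cd sub cf dF; rewrite EFinB.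
have cF x : x \in `[c, d] -> {for x, continuous F}.
  move=> xcd; apply: differentiable_continuous; apply/derivable1_diffP.
  by have [] : is_derive x (1 : R) F (f x) by apply: dF; exact: sub.
have oc x : x \in `]c, d[ -> x \in `[c, d] by exact: subset_itv_oo_cc.
apply: continuous_FTC2 => //; first exact: in_continuous_within sub.
  split.
  - by move=> x /oc xcd; have [] : is_derive x (1 : R) F (f x) by apply: dF; exact: sub.
  - apply: cvg_at_right_filter; apply: cF; rewrite in_itv /= lexx ltW//.
  - apply: cvg_at_left_filter; apply: cF; rewrite in_itv /= lexx ltW//.
move=> x /oc xcd; rewrite derive1E; apply: derive_val.
  by apply: dF; exact: sub.
Qed.

Section FTC_oo.
Variables (a b : R) (f F : R -> R) (la lb : R).
Hypothesis ab : a < b.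
Hypothesis cf : {in `]a, b[, continuous f}.
Hypothesis dF : {in `]a, b[, forall x : R, is_derive x (1 : R) F (f x)}.
Hypothesis Fa : F x @[x --> a^'+] --> la.
Hypothesis Fb : F x @[x --> b^'-] --> lb.

Let cvg_exhaust_ends :
  F (b - exhaust_gap a b n) - F (a + exhaust_gap a b n) @[n --> \oo] --> lb - la.
Proof.
have g0 := cvg_exhaust_gap a b.
apply: cvgB.
  move/cvg_at_leftP : Fb; apply; split; first by move=> n; rewrite gtrBl exhaust_gap_gt0.
  by rewrite -[X in _ --> X]subr0; apply: cvgB => //; exact: cvg_cst.
move/cvg_at_rightP : Fa; apply; split; first by move=> n; rewrite ltrDl exhaust_gap_gt0.
by rewrite -[X in _ --> X]addr0; apply: cvgD => //; exact: cvg_cst.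
Qed.

Let int_exhaust n : (\int[mu]_(x in exhaust a b n) (f x)%:E =
  (F (b - exhaust_gap a b n) - F (a + exhaust_gap a b n))%:E)%E.
Proof.
by apply: FTC_cc cf dF; [exact: exhaust_gap_lt|exact: exhaust_sub].
Qed.

(** Monotone convergence along the exhausting segments. Integrability is not assumed:
    [ge0_integrable_FTC_oo] deduces it from the finite value found here. *)
Lemma ge0_FTC_oo : {in `]a, b[, forall x, 0 <= f x} ->
  (\int[mu]_(x in `]a, b[) (f x)%:E = (lb - la)%:E)%E.
Proof.
move=> f0; rewrite -bigcup_exhaust//.
have := @ge0_nondecreasing_set_cvg_integral _ (measurableTypeR R) R (exhaust a b) (EFin \o f) mu.
have -> : (fun i => \int[mu]_(x in exhaust a b i) (EFin \o f) x)%E =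
   (fun n => (F (b - exhaust_gap a b n) - F (a + exhaust_gap a b n))%:E).
  by apply/funext => n; exact: int_exhaust.
move=> H; have H0 : (fun n => (F (b - exhaust_gap a b n) - F (a + exhaust_gap a b n))%:E) @ \oo
    --> (\int[mu]_(x in \bigcup_i exhaust a b i) (f x)%:E)%E.
  apply: H.
  - exact: exhaust_nondecreasing.
  - by move=> n; exact: measurable_itv.
  - move=> n; apply/measurable_EFinP; apply: measurable_funS (oo_continuous_measurable cf) => //.
    exact: exhaust_sub.
  - by move=> n x /(exhaust_sub ab) xab; rewrite lee_fin f0.
apply: (cvg_unique _ H0) => //.
by apply: cvg_EFin; [exact: nearW|exact: cvg_exhaust_ends].
Qed.

Lemma ge0_integrable_FTC_oo : {in `]a, b[, forall x, 0 <= f x} ->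
  mu.-integrable `]a, b[ (EFin \o f).
Proof.
move=> f0; apply/integrableP; split; first by apply/measurable_EFinP; exact: oo_continuous_measurable.
under eq_integral => x xab.
  rewrite /= ger0_norm; last by apply: f0; move: xab; rewrite inE.
  over.
by rewrite ge0_FTC_oo// ltry.
Qed.

(** For integrands of variable sign, [|f|] dominates the restrictions to the segments. *)
Lemma FTC_oo : mu.-integrable `]a, b[ (EFin \o f) ->
  \int[mu]_(x in `]a, b[) f x = lb - la.
Proof.
move=> fi.
have mf := oo_continuous_measurable cf.
have [] := @dominated_convergence _ _ R mu `]a, b[ (measurable_itv _)
  (fun n => (EFin \o f) \_ (exhaust a b n)) (EFin \o f) (abse \o (EFin \o f)).
- move=> n; apply/measurable_restrict => //; first exact: measurable_itv.
  by apply/measurable_EFinP; apply: measurable_funS mf => // x [].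
- exact/measurable_EFinP.
- apply: aeW => x xab; apply: cvg_near_cst.
  by apply: filterS (near_exhaust xab) => n nx; rewrite patchE mem_set.
- exact: integrable_abse.
- by apply: aeW => x n xab /=; rewrite patchE; case: ifPn => // _; rewrite abse0.
move=> _ _ /=.
under eq_fun do rewrite -integral_mkcondr setIC (setIidl (@exhaust_sub _ _ _ ab)) int_exhaust.
move=> H; rewrite /Rintegral.
have -> : lb - la = fine (lb - la)%:E by [].
congr fine; apply: (cvg_unique _ H) => //.
by apply: cvg_EFin; [exact: nearW|exact: cvg_exhaust_ends].
Qed.
End FTC_oo.

Lemma integrable_le_oo a b f g : {in `]a, b[, continuous f} ->
  {in `]a, b[, forall x, `|f x| <= g x} -> mu.-integrable `]a, b[ (EFin \o g) ->
  mu.-integrable `]a, b[ (EFin \o f).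
Proof.
move=> cf fg; apply: le_integrable => //.
  by apply/measurable_EFinP; exact: oo_continuous_measurable.
by move=> x xab /=; rewrite lee_fin; apply: le_trans (fg _ xab) (ler_norm _).
Qed.

Lemma integrable_cst_oo a b (c : R) : mu.-integrable `]a, b[ (EFin \o cst c).
Proof.
apply: (@integrableS _ _ R mu `[a, b]) => //; first exact: subset_itv_oo_cc.
apply: continuous_compact_integrable; first exact: segment_compact.
by apply: continuous_subspaceT => x; exact: cvg_cst.
Qed.

End exhaustion.

Section derivative_composition.
Context {R : realType}.
Implicit Types (x : R) (g : R -> R) (dg : R).

Lemma is_derive_expR_comp x g dg : is_derive x (1 : R) g dg ->
  is_derive x (1 : R) (fun y => expR (g y)) (expR (g x) * dg).
Proof. by move=> H; exact: is_derive1_comp. Qed.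

Lemma is_derive_ln_comp x g dg : 0 < g x -> is_derive x (1 : R) g dg ->
  is_derive x (1 : R) (fun y => ln (g y)) (dg / g x).
Proof. by move=> gx H; rewrite mulrC; apply: is_derive1_comp; exact: is_derive1_ln. Qed.

Lemma is_derive_sin_comp x g dg : is_derive x (1 : R) g dg ->
  is_derive x (1 : R) (fun y => sin (g y)) (cos (g x) * dg).
Proof. by move=> H; exact: is_derive1_comp. Qed.

Lemma is_derive_cos_comp x g dg : is_derive x (1 : R) g dg ->
  is_derive x (1 : R) (fun y => cos (g y)) (- sin (g x) * dg).
Proof. by move=> H; exact: is_derive1_comp. Qed.

Lemma is_derive_continuous x g dg : is_derive x (1 : R) g dg -> {for x, continuous g}.
Proof. by move=> [d _]; apply: differentiable_continuous; apply/derivable1_diffP. Qed.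

End derivative_composition.

Section end_singularity.
Context {R : realType}.
Notation mu := (@lebesgue_measure R).

(** The primitive [- (b - x)^(c+1) / (c+1)] tends to 0 at [b] because [c > -1]. This models the
    behaviour of the kernel at [tip]. *)
Lemma integrable_power_end (a b c : R) : a < b -> -1 < c ->
  mu.-integrable `]a, b[ (EFin \o (fun x => expR (c * ln (b - x)))).
Proof.
move=> ab c1; have c0 : 0 < c + 1 by lra.
pose F x : R := - (c + 1)^-1 * expR ((c + 1) * ln (b - x)).
have dg (k : R) x : x \in `]a, b[ -> is_derive x (1 : R) (fun x => expR (k * ln (b - x)))
    (expR (k * ln (b - x)) * (k * (- 1 / (b - x)))).
  rewrite in_itv /= => /andP[_ xb].
  apply: is_derive_expR_comp; apply: is_deriveZ; apply: is_derive_ln_comp; first by rewrite subr_gt0.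
  by rewrite -[X in is_derive _ _ _ X]sub0r; exact: is_deriveB.
apply: (@ge0_integrable_FTC_oo _ _ _ (fun x => expR (c * ln (b - x))) F (F a) 0).
- exact: ab.
- by move=> x xab; apply: is_derive_continuous (dg c _ xab).
- move=> x xab; have bx : 0 < b - x by move: xab; rewrite in_itv /= => /andP[_ ?]; rewrite subr_gt0.
  have := dg (c + 1) _ xab => H; apply: is_derive_eq.
  rewrite mulrDl mul1r expRD lnK ?posrE// /GRing.scale /=.
  by move: (expR _) => e; field; rewrite !lt0r_neq0.
- apply: cvg_at_right_filter; apply: cvgM; first exact: cvg_cst.
  apply: continuous_cvg; first exact: continuous_expR.
  apply: cvgM; first exact: cvg_cst.
  apply: continuous_cvg; first by apply: continuous_ln; rewrite subr_gt0.
  by apply: cvgB; [exact: cvg_cst|exact: cvg_id].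
- rewrite -[X in _ --> X](mulr0 (- (c + 1)^-1)); apply: cvgM; first exact: cvg_cst.
  apply/cvg_at_leftP => u [ub uc].
  have /cvg_at_rightP/(_ (fun n => b - u n)) := powR_cvg0 c0.
  have -> : (fun n => (b - u n) `^ (c + 1)) = (fun n => expR ((c + 1) * ln (b - u n))).
    by apply/funext => n; rewrite /powR gt_eqF ?subr_gt0.
  apply; split; first by move=> n; rewrite subr_gt0.
  by rewrite -(subrr b); apply: cvgB => //; exact: cvg_cst.
- by move=> x _; exact: expR_ge0.
Qed.

End end_singularity.

(** * Concentration of powers of a decreasing function *)

Section approximate_identity.
Context {R : realType}.
Notation mu := (@lebesgue_measure R).

(** Beyond a point [t] the integrand is of order [X(t)^n], whereas the normalizing integral is at
    least [X(t2)^n] times a length, for a [t2] closer to [a]; the ratio decays geometrically. Left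
    of [t], [h] is within [e/2] of [h0]. *)
Lemma approximate_identity (a b c h0 : R) (X h : R -> R) : a < b ->
  {in `]a, b[, continuous X} -> {in `]a, b[, forall x, 0 < X x <= c} ->
  {in `]a, b[ &, {homo X : x y /~ x < y}} ->
  mu.-integrable `]a, b[ (EFin \o h) -> h x @[x --> a^'+] --> h0 ->
  (\int[mu]_(x in `]a, b[) (X x ^+ n * h x)) / (\int[mu]_(x in `]a, b[) (X x ^+ n))
    @[n --> \oo] --> h0.
Proof.
move=> ab cX X0 dX ih /cvgrPdist_le hh0.
pose D := `]a, b[%classic.
have mD : measurable D by exact: measurable_itv.
have cXn n : {in `]a, b[, continuous (fun x => X x ^+ n)}.
  by move=> x xab; exact: (continuous_comp (cX _ xab) (@exprn_continuous _ n _)).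
have Xn0 n x : x \in `]a, b[ -> 0 < X x ^+ n.
  by move=> xab; rewrite exprn_gt0//; case/andP : (X0 _ xab).
have iXn n : mu.-integrable D (EFin \o (fun x => X x ^+ n)).
  apply: integrable_le_oo (integrable_cst_oo _ _ (c ^+ n)) => // x xab.
  rewrite ger0_norm ?(ltW (Xn0 _ _ xab))//.
  by case/andP : (X0 _ xab) => x0 xc; rewrite lerXn2r// nnegrE ltW// (lt_le_trans x0).
have iXnh n : mu.-integrable D (EFin \o (fun x => X x ^+ n * h x)).
  apply: (@le_integrable _ _ R mu D mD _ (EFin \o (fun x => c ^+ n * h x))).
  - apply/measurable_EFinP; apply: measurable_funM.
      exact: oo_continuous_measurable.
    by case/integrableP : ih => /measurable_EFinP.
  - move=> x xab /=; rewrite lee_fin !normrM ler_wpM2r// ger0_norm ?(ltW (Xn0 _ _ xab))//.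
    case/andP : (X0 _ xab) => x0 xc; rewrite ger0_norm ?exprn_ge0 ?(ltW (lt_le_trans x0 xc))//.
    by rewrite lerXn2r// nnegrE ltW// (lt_le_trans x0).
  - exact: integrableZl ih.
pose J n := \int[mu]_(x in D) X x ^+ n.
pose M := \int[mu]_(x in D) `|h x - h0|.
have ihh : mu.-integrable D (EFin \o (fun x => h x - h0)).
  by apply: integrable_realB => //; exact: integrable_cst_oo.
have iXnhh n : mu.-integrable D (EFin \o (fun x => X x ^+ n * (h x - h0))).
  under eq_fun do rewrite mulrBr [_ * h0]mulrC.
  by apply: integrable_realB => //; exact: integrable_realZ.
apply/cvgrPdist_le => e e0.
have e20 : 0 < e / 2 by rewrite divr_gt0.
have [d /= d0 Hd] := hh0 _ e20.
(* Halving [d] keeps []a, t[] inside the open ball where [h] is close to [h0]; the second bound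
   keeps [t] inside []a, b[]. *)
pose del := Num.min (d / 2) ((b - a) / 2).
have ba0 : 0 < b - a by rewrite subr_gt0.
have del0 : 0 < del by rewrite lt_min !divr_gt0.
have deld : del <= d / 2 by rewrite ge_min lexx.
have delb : del <= (b - a) / 2 by rewrite ge_min lexx orbT.
pose t := a + del; pose t2 := a + del / 2.
have tD : t \in `]a, b[ by rewrite in_itv /=; apply/andP; split; rewrite /t; lra.
have t2D : t2 \in `]a, b[ by rewrite in_itv /=; apply/andP; split; rewrite /t2; lra.
have Xtt2 : X t < X t2 by apply: dX => //; rewrite /t /t2; lra.
have Xt0 : 0 < X t by case/andP : (X0 _ tD).
have Xt20 : 0 < X t2 by case/andP : (X0 _ t2D).
have key n : `|\int[mu]_(x in D) (X x ^+ n * (h x - h0))| <= e / 2 * J n + X t ^+ n * M.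
  apply: le_trans (le_normr_Rintegral _ _) _ => //.
  rewrite -RintegralZl// -RintegralZl//; last exact: integrable_norm.
  rewrite -RintegralD//; last 2 first.
    exact: integrable_realZ.
    by apply: integrable_realZ => //; exact: integrable_norm.
  apply: le_Rintegral => //.
  - exact: integrable_norm.
  - rewrite (_ : EFin \o _ = (fun x => (e / 2)%:E * (X x ^+ n)%:E + (X t ^+ n)%:E * `|h x - h0|%:E)%E)//.
    apply: integrableD => //; first exact: integrableZl (iXn n).
    by apply: integrableZl => //; exact: (integrable_norm ihh).
  - move=> x xab; have xD : x \in `]a, b[ by [].
    have X_gt0 := Xn0 n _ xD.
    rewrite normrM (ger0_norm (ltW X_gt0)).
    have [xt|tx] := ltP x t.
      rewrite -[leLHS]addr0 lerD// ?mulr_ge0 ?exprn_ge0 ?(ltW Xt0)//.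
      rewrite mulrC ler_wpM2r ?(ltW X_gt0)// distrC; apply: Hd => /=.
        move: xD; rewrite in_itv /= => /andP[ax _].
        by rewrite /ball /= distrC ger0_norm; rewrite /t in xt; lra.
      by move: xD; rewrite in_itv /= => /andP[].
    rewrite -[leLHS]add0r lerD//; first exact: (mulr_ge0 (ltW e20) (ltW X_gt0)).
    rewrite ler_wpM2r// lerXn2r ?nnegrE ?(ltW Xt0)//; first by case/andP : (X0 _ xD) => /ltW.
    by move: tx; rewrite le_eqVlt => /predU1P[->//|tx]; apply/ltW/dX.
have Jlow n : X t2 ^+ n * (del / 2) <= J n.
  have sub : `]a, t2] `<=` D.
    move=> x; rewrite /D /= !in_itv /= => /andP[-> xt] /=; apply: le_lt_trans xt _.
    by move: t2D; rewrite in_itv /= => /andP[].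
  have -> : X t2 ^+ n * (del / 2) = \int[mu]_(x in `]a, t2]) (cst (X t2 ^+ n) x).
    rewrite Rintegral_cst//; congr (_ * _).
    have E : lebesgue_measure (`]a, t2]%classic : set R) = (del / 2)%:E.
      by rewrite lebesgue_measure_itv /= lte_fin /t2 ltrDl divr_gt0//= -EFinB addrAC subrr add0r.
    exact: (esym (congr1 fine E)).
  apply: (@le_trans _ _ (\int[mu]_(x in `]a, t2]) (X x ^+ n))).
    apply: le_Rintegral => //.
    - by apply: integrableS (integrable_cst_oo a b _) => //.
    - by apply: integrableS (iXn n).
    - move=> x xt; have xD : x \in `]a, b[ by exact: sub.
      rewrite lerXn2r ?nnegrE ?(ltW Xt20)//; first by case/andP : (X0 _ xD) => /ltW.
      move: xt; rewrite /= in_itv /= => /andP[_]; rewrite le_eqVlt => /predU1P[->//|xt].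
      by apply/ltW/dX.
  rewrite /J /Rintegral fine_le//; try by apply: integrable_fin_num => //; apply: integrableS (iXn n).
  apply: ge0_subset_integral => //; first by case/integrableP : (iXn n).
  by move=> x xD; rewrite lee_fin ltW// Xn0.
have J0 n : 0 < J n.
  by apply: lt_le_trans (Jlow n); rewrite mulr_gt0 ?exprn_gt0 ?divr_gt0.
have M0 : 0 <= M by apply: Rintegral_ge0.
have q1 : `|X t / X t2| < 1.
  by rewrite ger0_norm ?divr_ge0 ?(ltW Xt0) ?(ltW Xt20)// ltr_pdivrMr// mul1r.
have : (X t / X t2) ^+ n * (M / (del / 2)) @[n --> \oo] --> 0.
  rewrite -[X in _ --> X](mul0r (M / (del / 2))).
  by apply: cvgM; [exact: cvg_expr|exact: cvg_cst].
move/cvgrPdist_le => /(_ _ e20); apply: filterS => n.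
rewrite sub0r normrN => Hn.
have E : h0 - (\int[mu]_(x in D) (X x ^+ n * h x)) / J n =
    - (\int[mu]_(x in D) (X x ^+ n * (h x - h0)) / J n).
  under [in RHS]eq_Rintegral do rewrite mulrBr [_ * h0]mulrC.
  rewrite RintegralB//; last exact: integrable_realZ.
  rewrite RintegralZl// -/(J n) mulrBl.
  rewrite mulfK ?lt0r_neq0//.
  by rewrite opprB.
rewrite E normrN normrM normfV (gtr0_norm (J0 n)) ler_pdivrMr//.
apply: le_trans (key n) _; rewrite [in leRHS](splitr e) mulrDl lerD2l.
rewrite -ler_pdivrMr//; apply: le_trans (le_trans (ler_norm _) Hn).
have -> : (X t / X t2) ^+ n * (M / (del / 2)) = X t ^+ n * M * (X t2 ^+ n * (del / 2))^-1.
  by rewrite expr_div_n mulf_div.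
rewrite ler_wpM2l ?(mulr_ge0 (exprn_ge0 _ (ltW Xt0)))//.
by rewrite lef_pV2 ?posrE// mulr_gt0 ?exprn_gt0 ?divr_gt0.
Qed.

End approximate_identity.

(** * The Riemann-Lebesgue lemma along a decreasing phase *)

Section riemann_lebesgue.
Context {R : realType}.
Notation mu := (@lebesgue_measure R).
Implicit Types (f g L m : R -> R).

Lemma Rintegral_cc_split f (c t d : R) : c <= t -> t <= d ->
  mu.-integrable `[c, d] (EFin \o f) ->
  \int[mu]_(x in `[c, d]) f x =
  \int[mu]_(x in `[c, t]) f x + \int[mu]_(x in `[t, d]) f x.
Proof.
move=> ct td fi; have := @Rintegral_itvB _ f (BLeft c) (BRight d) t fi.
rewrite !bnd_simp => /(_ ct td) E.
rewrite -(@Rintegral_itv_obnd_cbnd _ t (BRight d)).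
  by rewrite -E addrC subrK.
by apply: integrableS fi => // x /=; rewrite !in_itv /= => /andP[tx ->]; rewrite (le_trans ct (ltW tx)).
Qed.

Lemma continuous_integrable_cc f (c d : R) : {within `[c, d], continuous f} ->
  mu.-integrable `[c, d] (EFin \o f).
Proof. by move=> cf; apply: continuous_compact_integrable => //; exact: segment_compact. Qed.

Variables (a b : R) (L m : R -> R).
Hypothesis ab : a < b.
Hypothesis dL : {in `]a, b[, forall x : R, is_derive x (1 : R) L (- m x)}.
Hypothesis cm : {in `]a, b[, continuous m}.
Hypothesis m0 : {in `]a, b[, forall x, 0 < m x}.

Let cL : {in `]a, b[, continuous L}.
Proof. by move=> x xab; exact: is_derive_continuous (dL xab). Qed.

Lemma phase_decreasing (x y : R) : x \in `]a, b[ -> y \in `]a, b[ -> x < y -> L y < L x.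
Proof.
move=> xD yD xy.
have sub : `[x, y] `<=` `]a, b[.
  move=> z; move: xD yD; rewrite /= !in_itv /= => /andP[ax _] /andP[_ yb] /andP[xz zy].
  by rewrite (lt_le_trans ax)// (le_lt_trans zy).
have [||z zxy E] := @MVT R L (fun z => - m z) x y xy.
- by move=> z zxy; apply: dL; apply: sub; exact: subset_itv_oo_cc zxy.
- exact: in_continuous_within cL sub.
rewrite -subr_lt0 E pmulr_llt0 ?subr_gt0// oppr_lt0; apply: m0.
by apply: sub; exact: subset_itv_oo_cc zxy.
Qed.

(** As [L' = - m], the integrand is the derivative of [cos (T L) / T]; the bound does not depend on
    the segment. *)
Lemma oscillatory_cst (c d T : R) : c <= d -> `[c, d] `<=` `]a, b[ -> 0 < T ->
  `|\int[mu]_(x in `[c, d]) (m x * sin (T * L x))| <= 2 / T.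
Proof.
move=> cd sub T0; move: cd; rewrite le_eqVlt => /predU1P[->|cd].
  by rewrite set_itv1 Rintegral_set1 normr0 divr_ge0// ltW.
pose F x := T^-1 * cos (T * L x).
have dF : {in `]a, b[, forall x : R, is_derive x (1 : R) F (m x * sin (T * L x))}.
  move=> x xab; have dTL : is_derive x (1 : R) (fun y => T * L y) (T * - m x).
    by apply: is_deriveZ; exact: dL.
  have dc := is_derive_cos_comp dTL.
  have -> : m x * sin (T * L x) = T^-1 * (- sin (T * L x) * (T * - m x)).
    by field; rewrite lt0r_neq0.
  exact: is_deriveZ.
have cf : {in `]a, b[, continuous (fun x => m x * sin (T * L x))}.
  move=> x xab; apply: cvgM; first exact: cm.
  apply: continuous_cvg; first exact: continuous_sin.
  by apply: cvgM; [exact: cvg_cst|exact: cL].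
rewrite /Rintegral (FTC_cc cd sub cf dF) /= /F -mulrBr normrM gtr0_norm ?invr_gt0//.
rewrite mulrC ler_wpM2r ?invr_ge0 ?(ltW T0)//.
apply: le_trans (ler_normB _ _) _.
by rewrite (_ : 2 = 1 + 1)// lerD// ler_norml cos_geN1 cos_le1.
Qed.

Lemma phase_integral (c d : R) : c <= d -> `[c, d] `<=` `]a, b[ ->
  \int[mu]_(x in `[c, d]) m x = L c - L d.
Proof.
move=> cd sub; move: cd; rewrite le_eqVlt => /predU1P[->|cd].
  by rewrite set_itv1 Rintegral_set1 subrr.
rewrite /Rintegral (@FTC_cc R a b c d m (fun x => - L x))//=; first by rewrite opprK addrC.
move=> x xab; have := dL xab => dLx.
by rewrite -[X in is_derive _ _ _ X]opprK; exact: is_deriveN.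
Qed.

(** Freezing [f] at the value [y] costs [e] times the integral of [m], which is [L s - L t]. This
    cost is additive over adjacent cells. *)
Lemma oscillatory_cell f (s t y e T : R) : s <= t -> `[s, t] `<=` `]a, b[ -> 0 < T ->
  {in `[s, t], forall x, `|f x - y| <= e} -> {in `]a, b[, continuous f} ->
  `|\int[mu]_(x in `[s, t]) (f x * m x * sin (T * L x))| <=
  e * (L s - L t) + 2 * `|y| / T.
Proof.
move=> st sub T0 fy cf.
have csin : {in `]a, b[, continuous (fun x => sin (T * L x))}.
  move=> x xab; apply: (@continuous_comp _ _ _ (fun x => T * L x) sin); last exact: continuous_sin.
  by apply: cvgM; [exact: cvg_cst|exact: cL].
have i1 : mu.-integrable `[s, t] (EFin \o (fun x => (f x - y) * m x * sin (T * L x))).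
  apply: continuous_integrable_cc; apply: in_continuous_within sub.
  move=> x xab; apply: cvgM; last exact: csin.
  apply: cvgM; last exact: cm.
  by apply: cvgB; [exact: cf|exact: cvg_cst].
have i2 : mu.-integrable `[s, t] (EFin \o (fun x => m x * sin (T * L x))).
  apply: continuous_integrable_cc; apply: in_continuous_within sub.
  by move=> x xab; apply: cvgM; [exact: cm|exact: csin].
have im : mu.-integrable `[s, t] (EFin \o m).
  by apply: continuous_integrable_cc; exact: in_continuous_within sub.
have -> : \int[mu]_(x in `[s, t]) (f x * m x * sin (T * L x)) =
  \int[mu]_(x in `[s, t]) ((f x - y) * m x * sin (T * L x)) +
  y * \int[mu]_(x in `[s, t]) (m x * sin (T * L x)).
  rewrite -RintegralZl// -RintegralD//; last exact: integrable_realZ.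
  by apply: eq_Rintegral => x _; ring.
apply: le_trans (ler_normD _ _) _; apply: lerD.
  apply: le_trans (le_normr_Rintegral _ _) _ => //.
  rewrite -phase_integral// -RintegralZl//; apply: le_Rintegral => //.
  - exact: integrable_norm.
  - exact: integrable_realZ.
  - move=> x xst; have xD := sub _ xst; have mx := m0 xD; rewrite !normrM (gtr0_norm mx).
    rewrite -mulrA ler_pM ?mulr_ge0 ?(ltW mx)//; first exact: fy.
    by rewrite ler_piMr ?(ltW mx)// sin_max.
rewrite normrM (_ : 2 * `|y| / T = `|y| * (2 / T)); last by ring.
by rewrite ler_wpM2l//; exact: oscillatory_cst.
Qed.

(* Bounds uniform in the frequency, obtained by extending the cells on which
   [f] is nearly constant up to the supremum of the reachable end points. *)
Lemma oscillatory_bound f (c d e : R) : c < d -> `[c, d] `<=` `]a, b[ ->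
  {in `]a, b[, continuous f} -> 0 < e ->
  exists K, forall T, 0 < T ->
  `|\int[mu]_(x in `[c, d]) (f x * m x * sin (T * L x))| <= e * (L c - L d) + K / T.
Proof.
move=> cd sub cf e0.
pose I t T := \int[mu]_(x in `[c, t]) (f x * m x * sin (T * L x)).
pose A := [set t | c <= t <= d /\ exists K, forall T, 0 < T ->
  `|I t T| <= e * (L c - L t) + K / T].
have Ac : A c.
  split; first by rewrite lexx ltW.
  exists 0 => T T0; rewrite /I set_itv1 Rintegral_set1 normr0 subrr !mulr0 mul0r addr0//.
have Aub : ubound A d by move=> t [/andP[]].
have hsA : has_sup A by split; [exists c|exists d].
pose s := sup A.
have cs : c <= s by exact: sup_upper_bound.
have sd : s <= d by apply: sup_le_ub => //; exists c.
have sD : s \in `]a, b[ by apply: sub; rewrite /= in_itv /= cs.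
have := cf _ sD => /cvgrPdist_le /(_ _ e0) [del /= del0 Hdel].
have [t At st] := sup_adherent del0 hsA.
have tsup : t <= s by exact: sup_upper_bound.
pose t' := Num.min d (s + del / 2).
have st' : s <= t' by rewrite le_min sd lerDl divr_ge0// ltW.
have t'd : t' <= d by rewrite ge_min lexx.
(* One cell around the supremum [s] carries the estimate from a reachable [t] near [s] to [t'].
   Reachability forces [t' <= s], so the minimum defining [t'] must be [d]. *)
have At' : A t'.
  case: At => /andP[ct td] [K HK]; split; first by rewrite t'd (le_trans cs).
  exists (K + 2 * `|f s|) => T T0.
  have tt' : t <= t' by exact: le_trans st'.
  have sub2 : `[t, t'] `<=` `]a, b[.
    by move=> x /= xt; apply: sub; move: xt; rewrite /= !in_itv /= => /andP[h1 h2]; rewrite (le_trans ct)//= (le_trans h2).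
  have sub3 : `[c, t'] `<=` `]a, b[.
    by move=> x /= xt; apply: sub; move: xt; rewrite /= !in_itv /= => /andP[h1 h2]; rewrite h1 (le_trans h2).
  rewrite /I (@Rintegral_cc_split _ c t t')//; last first.
    apply: continuous_integrable_cc; apply: in_continuous_within sub3.
    move=> x xab; apply: cvgM.
      by apply: cvgM; [exact: cf|exact: cm].
    apply: continuous_cvg; first exact: continuous_sin.
    by apply: cvgM; [exact: cvg_cst|exact: cL].
  apply: le_trans (ler_normD _ _) _.
  have H2 : `|\int[mu]_(x in `[t, t']) (f x * m x * sin (T * L x))| <=
      e * (L t - L t') + 2 * `|f s| / T.
    apply: oscillatory_cell => // x; rewrite in_itv /= => /andP[tx xt'].
    rewrite distrC; apply: Hdel; rewrite /ball /=.
    have : x <= s + del / 2 by apply: le_trans xt' _; rewrite ge_min lexx orbT.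
    move=> xs; rewrite ltr_norml; apply/andP; split; rewrite /s in st xs *; lra.
  apply: le_trans (lerD (HK _ T0) H2) _; rewrite le_eqVlt; apply/orP; left; apply/eqP; ring.
have t's : t' <= s by exact: sup_upper_bound.
have t'E : t' = d.
  move: t's; rewrite ge_min => /orP[ds|]; first by apply/eqP; rewrite eq_le t'd le_min lexx /= (le_trans ds)// lerDl divr_ge0// ltW.
  by have : 0 < del / 2 by [rewrite divr_gt0|]; lra.
by rewrite t'E in At'; case: At' => _.
Qed.

Lemma riemann_lebesgue_cc f (c d : R) : c < d -> `[c, d] `<=` `]a, b[ -> {in `]a, b[, continuous f} ->
  \int[mu]_(x in `[c, d]) (f x * sin (T * L x)) @[T --> +oo] --> 0.
Proof.
move=> cd sub cf.
have cfm : {in `]a, b[, continuous (fun x => f x / m x)}.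
  move=> x xab; apply: cvgM; first exact: cf.
  by apply: cvgV; [rewrite lt0r_neq0// m0|exact: cm].
apply/cvgrPdist_le => e e0.
have Lcd : 0 < L c - L d.
  by rewrite subr_gt0; apply: phase_decreasing => //; apply: sub; rewrite /= in_itv /= lexx ltW.
have e1 : 0 < e / 2 / (L c - L d) by rewrite !divr_gt0.
have [K HK] := oscillatory_bound cd sub cfm e1.
near=> T.
have T0 : 0 < T by near: T; exact: nbhs_pinfty_gt.
rewrite sub0r normrN.
rewrite (_ : \int[mu]_(x in `[c, d]) _ = \int[mu]_(x in `[c, d]) (f x / m x * m x * sin (T * L x))); last first.
  apply: eq_Rintegral => x; rewrite inE => /sub xab; rewrite divfK// lt0r_neq0//.
  exact: m0.
apply: le_trans (HK _ T0) _; rewrite divfK ?lt0r_neq0// [leRHS](splitr e) lerD2l.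
rewrite ler_pdivrMr// mulrC -ler_pdivrMr ?divr_gt0//.
Unshelve. all: by end_near. Qed.

(** Three errors of size [e/3]: the part of [f] outside a compact segment, its L^1 distance on the
    segment to a continuous [g], and the oscillatory integral of [g]. The first two do not depend on
    [T]. *)
Lemma riemann_lebesgue f : mu.-integrable `]a, b[ (EFin \o f) ->
  \int[mu]_(x in `]a, b[) (f x * sin (T * L x)) @[T --> +oo] --> 0.
Proof.
move=> fi; have fie n : mu.-integrable (exhaust a b n) (EFin \o f).
  by apply: integrableS fi => //; [exact: measurable_itv|exact: exhaust_sub].
have mf : measurable_fun `]a, b[ f by case/integrableP : fi => /measurable_EFinP.
have msin T : measurable_fun `]a, b[ (fun x => sin (T * L x)).
  apply: oo_continuous_measurable => x xab.
  apply: (@continuous_comp _ _ _ (fun x => T * L x) sin); last exact: continuous_sin.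
  by apply: cvgM; [exact: cvg_cst|exact: cL].
have ifs (A : set R) T g : measurable A -> A `<=` `]a, b[ -> mu.-integrable A (EFin \o g) ->
    mu.-integrable A (EFin \o (fun x => g x * sin (T * L x))).
  move=> mA sA gi; have gi' := gi; apply: le_integrable gi' => //.
    apply/measurable_EFinP; apply: measurable_funM.
      by case/integrableP : gi => /measurable_EFinP.
    exact: measurable_funS (msin T).
  by move=> x _ /=; rewrite lee_fin normrM ler_piMr// sin_max.
have lesin (A : set R) T g : measurable A -> A `<=` `]a, b[ -> mu.-integrable A (EFin \o g) ->
    `|\int[mu]_(x in A) (g x * sin (T * L x))| <= \int[mu]_(x in A) `|g x|.
  move=> mA sA gi; apply: le_trans (le_normr_Rintegral _ _) _ => //; first exact: ifs.
  apply: le_Rintegral => //.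
  - by apply: integrable_norm => //; exact: ifs.
  - exact: integrable_norm.
  - by move=> x _; rewrite normrM ler_piMr// sin_max.
apply/cvgrPdist_le => e e0; have e3 : 0 < e / 3 by rewrite divr_gt0.
have [n Hn] : exists n, \int[mu]_(x in `]a, b[ `\` exhaust a b n) `|f x| <= e / 3.
  have ni : mu.-integrable `]a, b[ (EFin \o (fun x => `|f x|)) by exact: integrable_norm.
  have H := @ge0_nondecreasing_set_cvg_integral _ (measurableTypeR R) R (exhaust a b) (EFin \o (fun x => `|f x|)) mu.
  have {}H : (\int[mu]_(x in exhaust a b n) (`|f x|)%:E)%E @[n --> \oo] --> (\int[mu]_(x in `]a, b[) (`|f x|)%:E)%E.
    rewrite -bigcup_exhaust//; apply: H.
    - exact: exhaust_nondecreasing.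
    - by move=> n; exact: measurable_itv.
    - move=> n; apply/measurable_EFinP; apply: measurableT_comp => //.
      by apply: measurable_funS mf => //; exact: exhaust_sub.
    - by move=> n x _; rewrite lee_fin.
  have Hf : \int[mu]_(x in exhaust a b n) `|f x| @[n --> \oo] --> \int[mu]_(x in `]a, b[) `|f x|.
    apply: (fine_cvg (a := \int[mu]_(x in `]a, b[) `|f x|)).
    rewrite fineK//; exact: integrable_fin_num.
  have /cvgrPdist_le/(_ _ e3) [n _ /(_ n (leqnn n)) Hn] := Hf.
  exists n; apply: le_trans (le_trans (ler_norm _) Hn).
  rewrite -[X in _ <= (Rintegral _ X _) - _](setDUK (@exhaust_sub R a b n ab)).
  rewrite Rintegral_setU//.
  - by rewrite addrAC subrr add0r.
  - exact: measurable_itv.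
  - by apply: measurableD => //; exact: measurable_itv.
  - by rewrite setDUK//; exact: exhaust_sub.
  - by apply/disj_setPS => x [h1 [_ h2]].
have [g [cg gi gf]] : exists g : R -> R, [/\ continuous g,
   mu.-integrable (exhaust a b n) (EFin \o g) &
   \int[mu]_(x in exhaust a b n) `|f x - g x| <= e / 3].
  have [|||g_ [cg gi gf]] := @approximation_continuous_integrable R (exhaust a b n) f.
  - exact: measurable_itv.
  - by apply: compact_finite_measure; exact: segment_compact.
  - exact: fie.
  have [k _ /(_ k (leqnn k)) Hk] : \forall k \near \oo, \int[mu]_(x in exhaust a b n) `|f x - g_ k x| <= e / 3.
    have : \int[mu]_(x in exhaust a b n) `|f x - g_ k x| @[k --> \oo] --> 0 by exact: (fine_cvg gf).
    move/cvgrPdist_le => /(_ _ e3); apply: filterS => k; rewrite sub0r normrN.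
    exact/le_trans/ler_norm.
  by exists (g_ k).
have gL := @riemann_lebesgue_cc g _ _ (exhaust_gap_lt n ab) (@exhaust_sub R a b n ab) (fun x _ => cg x).
move/cvgrPdist_le : gL => /(_ _ e3); apply: filterS => T; rewrite !sub0r !normrN => HT.
have mE : measurable (exhaust a b n) by exact: measurable_itv.
have sE := @exhaust_sub R a b n ab.
rewrite -(setDUK sE) Rintegral_setU//.
- rewrite (_ : \int[mu]_(x in exhaust a b n) _ = \int[mu]_(x in exhaust a b n) ((f x - g x) * sin (T * L x)) + \int[mu]_(x in exhaust a b n) (g x * sin (T * L x))).
    apply: le_trans (ler_normD _ _) _.
    have D1 := ler_normD (\int[mu]_(x in exhaust a b n) ((f x - g x) * sin (T * L x))) (\int[mu]_(x in exhaust a b n) (g x * sin (T * L x))).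
    have D2 : `|\int[mu]_(x in exhaust a b n) ((f x - g x) * sin (T * L x))| <= e / 3.
      by apply: le_trans (lesin _ _ _ _ _ _) _ => //; exact: integrable_realB.
    have D3 : `|\int[mu]_(x in `]a, b[ `\` exhaust a b n) (f x * sin (T * L x))| <= e / 3.
      apply: le_trans (lesin _ _ _ _ _ _) _ => //; first exact: measurableD.
      by apply: integrableS fi => //; exact: measurableD.
    have -> : e = e / 3 + e / 3 + e / 3 by field.
    by apply: lerD => //; apply: le_trans D1 _; exact: lerD.
  rewrite -RintegralD//; last 2 first.
  - by apply: ifs => //; exact: integrable_realB.
  - exact: ifs.
  by apply: eq_Rintegral => x _; ring.
- exact: measurableD.
- by rewrite setDUK//; exact: ifs.
- by apply/disj_setPS => x [h1 [_ h2]].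
Qed.

End riemann_lebesgue.

(** * Fourier inversion *)

Section sinc.
Context {R : realType}.
Notation mu := (@lebesgue_measure R).
Implicit Types (x y : R).

Lemma measurable_invr : measurable_fun [set: R] (fun x => x^-1).
Proof.
rewrite -(setUv [set (0 : R)]); apply/measurable_funU => //.
  by apply: measurableC; exact: measurable_set1.
split; first exact: measurable_fun_set1.
apply: open_continuous_measurable_fun.
  by rewrite openC; exact: accessible_closed_set1 (@hausdorff_accessible _ (@norm_hausdorff R R^o)) _.
move=> x; rewrite inE /= => /eqP x0; apply: cvgV => //; exact: cvg_id.
Qed.

Definition sinc x : R := if x == 0 then 1 else sin x / x.

Lemma sincN x : sinc (- x) = sinc x.
Proof. by rewrite /sinc oppr_eq0 sinN invrN mulrNN. Qed.

Lemma sincM x : x * sinc x = sin x.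
Proof. by rewrite /sinc; case: eqP => [->|/eqP x0]; rewrite ?sin0 ?mul0r// mulrC divfK. Qed.

Lemma sinc_le x : 0 < x -> `|sinc x| <= x^-1.
Proof.
move=> x0; rewrite /sinc gt_eqF// normrM (gtr0_norm (_ : 0 < x^-1)) ?invr_gt0//.
rewrite ler_piMl ?invr_ge0 ?(ltW x0)//.
exact: sin_max.
Qed.

Lemma sinc_continuous : continuous sinc.
Proof.
move=> x; have [->|x0] := eqVneq x 0.
  apply/cvgrPdist_le => e e0; near=> y.
  rewrite {1}/sinc eqxx /sinc; case: eqVneq => [_|y0]; first by rewrite subrr normr0 ltW.
  have y1 : `|y| <= 1.
    by near: y; apply: (@cvgr0_norm_le _ _ _ (nbhs (0:R))); [exact: cvg_id|].
  have ye : `|y| <= e.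
    by near: y; apply: (@cvgr0_norm_le _ _ _ (nbhs (0:R))); [exact: cvg_id|].
  have yn : 0 < `|y| by rewrite normr_gt0.
  rewrite -(ler_pM2r yn) -normrM mulrBl mul1r divfK// distrC.
  apply: le_trans (sin_quad y1) _.
  by rewrite -[y ^+ 2]real_normK ?num_real// expr2 ler_wpM2r.
rewrite /continuous_at; have -> : sinc x = sin x / x by rewrite /sinc (negbTE x0).
have H : sin y / y @[y --> x] --> sin x / x.
  by apply: cvgM; [exact: continuous_sin|apply: cvgV => //; exact: cvg_id].
apply: cvg_trans H; apply: near_eq_cvg; near=> y; rewrite /sinc ifF//; apply/negbTE.
by near: y; apply: (@cvgr_neq0 _ _ _ (nbhs x)); [exact: cvg_id|].
Unshelve. all: by end_near. Qed.

Definition Si y : R := \int[mu]_(x in `[0, y]) sinc x.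

Lemma sinc_integrable x y : mu.-integrable `[x, y] (EFin \o sinc).
Proof.
by apply: continuous_integrable_cc; apply: continuous_subspaceT; exact: sinc_continuous.
Qed.

(** The integrand is at most [1/(n pi)] over a length at most [pi]. It transfers the limit from the
    points [(n + 1/2) pi] to all [y]. *)
Lemma Si_increment n x y : (0 < n)%N -> n%:R * pi <= x -> x <= y -> y <= n.+1%:R * pi ->
  `|Si y - Si x| <= n%:R^-1.
Proof.
move=> n0 nx xy yn; have n0R : 0 < n%:R :> R by rewrite ltr0n.
have x0 : 0 < x by apply: lt_le_trans nx; rewrite mulr_gt0// pi_gt0.
rewrite /Si (@Rintegral_cc_split _ _ 0 x y) ?(ltW x0)//; last exact: sinc_integrable.
rewrite addrC addKr; apply: le_trans (le_normr_Rintegral _ (sinc_integrable _ _)) _ => //.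
apply: (@le_trans _ _ (\int[mu]_(z in `[x, y]) (cst x^-1 z))).
  apply: le_Rintegral => //.
  - by apply: integrable_norm => //; exact: sinc_integrable.
  - by apply: continuous_integrable_cc; apply: continuous_subspaceT => z; exact: cvg_cst.
  - move=> z /=; rewrite in_itv /= => /andP[xz _]; apply: le_trans (sinc_le (lt_le_trans x0 xz)) _.
    by rewrite lef_pV2 ?posrE// (lt_le_trans x0).
rewrite Rintegral_cst//.
have -> : fine (mu `[x, y]) = y - x.
  have E : lebesgue_measure (`[x, y]%classic : set R) = (y - x)%:E.
    rewrite lebesgue_measure_itv /= lte_fin; case: ltP => //; rewrite -?EFinB// => yx.
    by rewrite (_ : x = y) ?subrr//; apply/eqP; rewrite eq_le xy.
  exact: (congr1 fine E).
rewrite mulrC ler_pdivrMr//.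
apply: (@le_trans _ _ pi); first by move: yn; rewrite -natr1 mulrDl mul1r; lra.
by rewrite mulrC ler_pdivlMr// mulrC.
Qed.

Definition dirichlet_kernel n x : R := 2^-1 + \sum_(k < n) cos (k.+1%:R * x).

(** The products [2 cos(kx) sin(x/2)] are differences of sines and telescope. *)
Lemma dirichlet_kernelM n x :
  dirichlet_kernel n x * (2 * sin (x / 2)) = sin ((n%:R + 2^-1) * x).
Proof.
rewrite /dirichlet_kernel; elim: n => [|n IH].
  by rewrite big_ord0 addr0 add0r mulrA mulVf// mul1r mulrC.
rewrite big_ord_recr /= addrA mulrDl IH.
have -> : (n.+1%:R + 2^-1) * x = n.+1%:R * x + x / 2 by ring.
have -> : (n%:R + 2^-1) * x = n.+1%:R * x - x / 2.
  by rewrite -natr1; field.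
rewrite sinB sinD; ring.
Qed.

Lemma dirichlet_kernel_continuous n : continuous (dirichlet_kernel n).
Proof.
elim: n => [|n IH] x.
  by rewrite /dirichlet_kernel; under eq_fun do rewrite big_ord0; exact: cvg_cst.
rewrite /continuous_at /dirichlet_kernel; under eq_fun do rewrite big_ord_recr addrA.
rewrite big_ord_recr addrA; apply: cvgD; first exact: IH.
apply: (@continuous_comp _ _ _ (fun x => n.+1%:R * x) cos); last exact: continuous_cos.
by apply: cvgM; [exact: cvg_cst|exact: cvg_id].
Qed.

Lemma Rintegral_oo_cc (c d : R) f : mu.-integrable `[c, d] (EFin \o f) ->
  \int[mu]_(x in `]c, d[) f x = \int[mu]_(x in `[c, d]) f x.
Proof.
move=> fi; rewrite (@Rintegral_itv_bndo_bndc _ (BRight c) d).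
  rewrite (@Rintegral_itv_obnd_cbnd _ c (BRight d))//.
  by apply: integrableS fi => // x /=; rewrite !in_itv /= => /andP[/ltW -> ->].
by apply: integrableS fi => // x /=; rewrite !in_itv /= => /andP[/ltW -> /ltW ->].
Qed.

Lemma dirichlet_kernel_integral n :
  \int[mu]_(x in `[0, pi]) dirichlet_kernel n x = pi / 2.
Proof.
pose F x : R := x / 2 + \sum_(k < n) sin (k.+1%:R * x) / k.+1%:R.
have dF x : is_derive x (1 : R) F (dirichlet_kernel n x).
  apply: is_deriveD.
    rewrite -[X in is_derive _ _ _ X]mulr1 [X in is_derive _ _ X _](_ : _ = (fun y => 2^-1 * y)); last by apply/funext => y; rewrite mulrC.
    exact: is_deriveZ.
  elim: n {F} => [|n IH].
    under eq_fun do rewrite big_ord0.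
    by rewrite big_ord0; exact: is_derive_cst.
  under eq_fun do rewrite big_ord_recr.
  rewrite big_ord_recr /=; apply: is_deriveD.
  have d1 : is_derive x (1 : R) (fun y => n.+1%:R * y) (n.+1%:R * 1) by exact: is_deriveZ.
  have d2 := is_derive_sin_comp d1.
  have -> : cos (n.+1%:R * x) = n.+1%:R^-1 * (cos (n.+1%:R * x) * (n.+1%:R * 1)).
    by rewrite mulr1 mulrCA mulVf ?mulr1// pnatr_eq0.
  under eq_fun do rewrite mulrC.
  exact: is_deriveZ.
have sinpi_nat k : sin (k%:R * pi) = 0 :> R.
  elim: k => [|k IH]; first by rewrite mul0r sin0.
  by rewrite -natr1 mulrDl mul1r sinDpi IH oppr0.
rewrite /Rintegral (@FTC_cc R (-1) (pi + 1) 0 pi _ F) ?pi_gt0//=.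
- have S1 : \sum_(k < n) sin (k.+1%:R * pi) / k.+1%:R = 0 :> R.
    by apply: big1 => k _; rewrite sinpi_nat mul0r.
  have S2 : \sum_(k < n) sin (k.+1%:R * 0) / k.+1%:R = 0 :> R.
    by apply: big1 => k _; rewrite mulr0 sin0 mul0r.
  by rewrite /F S1 S2 mul0r !addr0 subr0.
- move=> x; rewrite /= !in_itv /= => /andP[h1 h2]; apply/andP; split; lra.
- by move=> x _; exact: dirichlet_kernel_continuous.
Qed.

(** By the mean value theorem [sin(x/2) = cos(z) x/2] with [cos z >= cos(x/2)], so
    [sin x >= x cos(x/2)^2 = x (1 + cos x)/2], and [cos x >= 0] on this range. *)
Lemma sin_ge_half x : 0 <= x <= pi / 2 -> x / 2 <= sin x.
Proof.
move=> /andP[x0 xpi]; have x20 : 0 <= x / 2 by rewrite divr_ge0.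
have p0 := @pi_gt0 R.
have [z z4 E] := @MVT_segment R sin cos 0 (x / 2) x20 (fun x _ => is_derive_sin x) (continuous_subspaceT (@continuous_sin R)).
move: E; rewrite sin0 !subr0 => E.
have cz : cos (x / 2) <= cos z.
  move: z4; rewrite in_itv /= => /andP[z0]; rewrite le_eqVlt => /predU1P[->//|zx].
  by rewrite ltW// ltr_cos// in_itv /=; apply/andP; split; lra.
have c0 : 0 <= cos (x / 2) by apply: cos_ge0_pihalf; apply/andP; split; lra.
have cx : 0 <= cos x by apply: cos_ge0_pihalf; apply/andP; split; lra.
have -> : sin x = 2 * cos (x / 2) * sin (x / 2).
  by rewrite [in LHS](splitr x) sinD; ring.
have : cos x = 2 * cos (x / 2) ^+ 2 - 1.
  rewrite [in LHS](splitr x) cosD; have := cos2Dsin2 (x / 2); rewrite !expr2; lra.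
rewrite E => cE; have h1 : cos (x / 2) * cos (x / 2) <= cos (x / 2) * cos z by rewrite ler_wpM2l.
have : 1 <= 2 * (cos (x / 2) * cos z) by move: cE; rewrite expr2; lra.
move: (cos (x / 2)) (cos z) => u v; nra.
Qed.

(** Apply [sin_ge_half] to the factors of [2 sin(x/2) sin((pi - x)/2)]. The constant is crude; what
    matters is first order vanishing at both ends. *)
Lemma sin_ge_quadratic x : 0 <= x <= pi -> x * (pi - x) / 8 <= sin x.
Proof.
move=> /andP[x0 xpi].
have -> : sin x = 2 * sin (x / 2) * sin ((pi - x) / 2).
  rewrite [in LHS](splitr x) sinD mulrBl sinB sin_pihalf cos_pihalf; ring.
have h1 : x / 2 / 2 <= sin (x / 2) by apply: sin_ge_half; apply/andP; split; lra.
have h2 : (pi - x) / 2 / 2 <= sin ((pi - x) / 2) by apply: sin_ge_half; apply/andP; split; lra.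
have : x / 2 / 2 * ((pi - x) / 2 / 2) <= sin (x / 2) * sin ((pi - x) / 2).
  by apply: ler_pM => //; rewrite !divr_ge0// subr_ge0.
lra.
Qed.

(** The two poles at 0 cancel: the difference of the denominators is quadratic, as is their product,
    so the function is bounded by 1. *)
Lemma dirichlet_remainder_integrable :
  mu.-integrable `]0, pi[ (EFin \o (fun x => x^-1 - (2 * sin (x / 2))^-1)).
Proof.
have s0 x : x \in `]0, pi[ -> 0 < x /\ x / 4 <= sin (x / 2).
  rewrite in_itv /= => /andP[x0 xpi]; split => //.
  have -> : x / 4 = x / 2 / 2 by field.
  by apply: sin_ge_half; apply/andP; split; lra.
apply: integrable_le_oo (integrable_cst_oo _ _ 1) => x xab; have [x0 sx] := s0 _ xab.
  have sx0 : sin (x / 2) != 0 by rewrite lt0r_neq0//; apply: lt_le_trans sx; rewrite divr_gt0.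
  apply: cvgB; first by apply: cvgV; [rewrite lt0r_neq0|exact: cvg_id].
  apply: cvgV; first by rewrite mulf_neq0.
  apply: cvgM; first exact: cvg_cst.
  apply: (@continuous_comp _ _ _ (fun x => x / 2) sin); last exact: continuous_sin.
  by apply: cvgM; [exact: cvg_id|exact: cvg_cst].
have sx0 : 0 < sin (x / 2) by apply: lt_le_trans sx; rewrite divr_gt0.
have -> : x^-1 - (2 * sin (x / 2))^-1 = - (x / 2 - sin (x / 2)) / (x * sin (x / 2)).
  by field; rewrite !lt0r_neq0.
rewrite normrM normfV normrN (gtr0_norm (mulr_gt0 x0 sx0)) ler_pdivrMr ?mulr_gt0// mul1r.
have xx : 0 < x / 2 by rewrite divr_gt0.
have : `|x / 2 - sin (x / 2)| <= (x / 2) ^+ 2.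
  have [x1|x1] := leP (x / 2) 1.
    by rewrite distrC; apply: sin_quad; rewrite gtr0_norm.
  rewrite ler_norml; apply/andP; split; last by rewrite expr2; nra.
  have := sin_le1 (x / 2); rewrite expr2; nra.
move/le_trans; apply; rewrite expr2; nra.
Qed.

Section phase.
Variables (a b : R) (L m : R -> R).
Hypothesis ab : a < b.
Hypothesis dL : {in `]a, b[, forall x : R, is_derive x (1 : R) L (- m x)}.
Hypothesis cm : {in `]a, b[, continuous m}.
Hypothesis m0 : {in `]a, b[, forall x, 0 < m x}.

Lemma phase_substitution (c d y T : R) : c < d -> `[c, d] `<=` `]a, b[ -> 0 < T ->
  \int[mu]_(x in `[c, d]) (m x * (T * sinc (T * (L x - y)))) =
  \int[mu]_(x in `[T * (L d - y), T * (L c - y)]) sinc x.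
Proof.
move=> cd sub T0; pose F x := T * (L x - y).
have dF x : x \in `]a, b[ -> is_derive x (1 : R) F (- (T * m x)).
  move=> xab; have dx := dL xab.
  have -> : - (T * m x) = T * (- m x - 0) by ring.
  by apply: is_deriveZ; apply: is_deriveB.
have F'E x : x \in `]a, b[ -> derive1 F x = - (T * m x).
  by move=> xab; rewrite derive1E; apply: derive_val; exact: dF.
have cF' x : x \in `]a, b[ -> derive1 F z @[z --> x] --> derive1 F x.
  move=> xab; rewrite F'E//.
  have H : - (T * m z) @[z --> x] --> - (T * m x).
    by apply: cvgN; apply: cvgM; [exact: cvg_cst|exact: cm].
  apply: cvg_trans H.
  by apply: near_eq_cvg; near=> z; rewrite F'E//; near: z; exact: near_in_itvoo.
have cF x : x \in `]a, b[ -> {for x, continuous F}.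
  by move=> xab; exact: is_derive_continuous (dF _ xab).
have cD : c \in `]a, b[ by apply: sub; rewrite /= in_itv /= lexx ltW.
have dD : d \in `]a, b[ by apply: sub; rewrite /= in_itv /= lexx ltW.
have oc x : x \in `]c, d[ -> x \in `]a, b[ by move=> h; apply: sub; exact: subset_itv_oo_cc h.
have := @integration_by_substitution_decreasing R F sinc c d (ltW cd).
rewrite -[T * (L d - y)]/(F d) -[T * (L c - y)]/(F c) /Rintegral => ->.
- congr fine; apply: eq_integral => x; rewrite inE => /sub xab /=.
  by congr EFin; rewrite !fctE /= F'E// opprK /F; ring.
- move=> u v ucd vcd uv; rewrite /F ltr_pM2l// ltrD2r.
  by apply: (phase_decreasing dL) => //; [apply: sub|apply: sub].
- by move=> x /oc; exact: cF'.
- by apply/cvg_ex; exists (derive1 F c); apply: cvg_at_right_filter; exact: cF'.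
- by apply/cvg_ex; exists (derive1 F d); apply: cvg_at_left_filter; exact: cF'.
- split; first by move=> x /oc xab; have [] := dF _ xab.
  + by apply: cvg_at_right_filter; exact: cF.
  + by apply: cvg_at_left_filter; exact: cF.
- by apply: continuous_subspaceT; exact: sinc_continuous.
Unshelve. all: by end_near. Qed.

Lemma Si_symmetric (u v : R) : 0 <= u -> 0 <= v ->
  \int[mu]_(x in `[- u, v]) sinc x = Si u + Si v.
Proof.
move=> u0 v0; rewrite (@Rintegral_cc_split _ _ (- u) 0 v) ?oppr_le0//; last exact: sinc_integrable.
congr (_ + _); rewrite /Si /Rintegral -[X in `[- u, X]]oppr0 integration_by_substitution_oppr//.
  by congr fine; apply: eq_integral => x _ /=; rewrite sincN.
by apply: continuous_subspaceT; exact: sinc_continuous.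
Qed.

End phase.

(** Replacing [1/x] by [1/(2 sin(x/2))] turns the sine integral into the integral [pi/2] of the
    Dirichlet kernel, and the difference is a Riemann-Lebesgue integral. The phase is [- x] since
    phases are taken decreasing. *)
Lemma Si_half_integer : Si ((n%:R + 2^-1) * pi) @[n --> \oo] --> pi / 2.
Proof.
have RL : \int[mu]_(x in `]0, pi[) ((x^-1 - (2 * sin (x / 2))^-1) * sin (T * - x)) @[T --> +oo] --> 0.
  apply: (@riemann_lebesgue R 0 pi (fun x => - x) (fun=> 1)); rewrite ?pi_gt0//.
  - by move=> x _; exact: is_deriveN.
  - by move=> x _; exact: cvg_cst.
  - exact: dirichlet_remainder_integrable.
have p0 := @pi_gt0 R.
have E n : Si ((n%:R + 2^-1) * pi) = pi / 2 -
   \int[mu]_(x in `]0, pi[) ((x^-1 - (2 * sin (x / 2))^-1) * sin ((n%:R + 2^-1) * - x)).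
  set T := n%:R + 2^-1.
  have T0 : 0 < T by rewrite /T ltr_wpDl.
  have := @phase_substitution (-1) (pi + 1) (fun x => - x) (fun=> 1) _ _ _ 0 pi 0 T p0 _ T0.
  rewrite !subr0 oppr0 mulr0 mulrN => H.
  have -> : Si (T * pi) = \int[mu]_(x in `[(- (T * pi)), 0]) sinc x.
    rewrite Si_symmetric// ?mulr_ge0 ?(ltW T0) ?(ltW p0)//.
    by rewrite /Si set_itv1 Rintegral_set1 addr0.
  rewrite -H; last 4 first.
  - by move=> x _; exact: is_deriveN.
  - by move=> x _; exact: cvg_cst.
  - by [].
  - move=> x; rewrite /= !in_itv /= => /andP[h1 h2]; apply/andP; split; lra.
  have irem : mu.-integrable `]0, pi[ (EFin \o (fun x => (x^-1 - (2 * sin (x / 2))^-1) * sin (T * - x))).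
    have ir := dirichlet_remainder_integrable.
    apply: le_integrable dirichlet_remainder_integrable => //.
      apply/measurable_EFinP; apply: measurable_funM.
        by case/integrableP : ir => /measurable_EFinP.
      apply: oo_continuous_measurable => x _.
      apply: (@continuous_comp _ _ _ (fun x => T * - x) sin); last exact: continuous_sin.
      by apply: cvgM; [exact: cvg_cst|apply: cvgN; exact: cvg_id].
    by move=> x _ /=; rewrite lee_fin normrM ler_piMr// sin_max.
  have iK : mu.-integrable `[0, pi] (EFin \o dirichlet_kernel n).
    by apply: continuous_integrable_cc; apply: continuous_subspaceT; exact: dirichlet_kernel_continuous.
  rewrite -(dirichlet_kernel_integral n) -Rintegral_oo_cc; last first.
    apply: continuous_integrable_cc; apply: continuous_subspaceT => x.
    apply: cvgM; first exact: cvg_cst.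
    apply: cvgM; first exact: cvg_cst.
    apply: (@continuous_comp _ _ _ (fun x => T * (- x + 0)) sinc); last exact: sinc_continuous.
    by apply: cvgM; [exact: cvg_cst|apply: cvgD; [apply: cvgN; exact: cvg_id|exact: cvg_cst]].
  rewrite -Rintegral_oo_cc// -RintegralB//; last first.
    by apply: integrableS iK => //; exact: subset_itv_oo_cc.
  apply: eq_Rintegral => x; rewrite inE => xab.
  have x0 : 0 < x by move: xab; rewrite /= in_itv /= => /andP[].
  have sx0 : 0 < sin (x / 2).
    apply: lt_le_trans (_ : x / 2 / 2 <= _); first by rewrite !divr_gt0.
    by apply: sin_ge_half; move: xab; rewrite /= in_itv /= => /andP[h1 h2]; apply/andP; split; lra.
  have KE := dirichlet_kernelM n x; rewrite -/T in KE.
  rewrite addr0 mul1r mulrN sincN sinN -KE.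
  have -> : T * sinc (T * x) = sin (T * x) / x.
    by rewrite -sincM; field; rewrite lt0r_neq0.
  by rewrite -KE; move: (dirichlet_kernel n x) => K; field; rewrite !lt0r_neq0.
rewrite (funext E).
rewrite -[X in _ --> X]subr0; apply: cvgB; first exact: cvg_cst.
have H : (n%:R + 2^-1 : R) @[n --> \oo] --> +oo; last exact: (cvg_comp _ _ H RL).
apply/cvgryPge => A; near=> n; apply: (@le_trans _ _ n%:R); last by rewrite lerDl.
by near: n; exact: nbhs_infty_ger.
Unshelve. all: by end_near. Qed.

Lemma Si_cvg : Si y @[y --> +oo] --> pi / 2.
Proof.
apply/cvgrPdist_le => e e0; have e20 : 0 < e / 2 by rewrite divr_gt0.
have /cvgrPdist_le /(_ _ e20) [n0 _ H] := Si_half_integer.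
near=> y.
have p0 := @pi_gt0 R.
have y0 : 0 <= y / pi by rewrite divr_ge0 ?(ltW p0)//; near: y; exact: nbhs_pinfty_ge.
pose n := Num.truncn (y / pi).
have /andP[n1 n2] := truncn_itv y0.
rewrite ler_pdivlMr// in n1; rewrite ltr_pdivrMr// in n2.
have nn0 : (n0 <= n)%N.
  by rewrite /n truncn_ge_nat// ler_pdivlMr//; near: y; exact: nbhs_pinfty_ge.
have ngt0 : (0 < n)%N.
  by rewrite /n truncn_ge_nat// ler_pdivlMr//; near: y; exact: nbhs_pinfty_ge.
have ne : n%:R^-1 <= e / 2.
  rewrite -[leRHS]invrK lef_pV2 ?posrE ?invr_gt0// ?ltr0n//.
  apply: le_trans (_ : (Num.truncn (e / 2)^-1).+1%:R <= _); first exact: ltW (truncnS_gt _).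
  rewrite ler_nat /n truncn_ge_nat// ler_pdivlMr//; near: y; exact: nbhs_pinfty_ge.
have {}H := H _ nn0.
have D : `|Si y - Si ((n%:R + 2^-1) * pi)| <= n%:R^-1.
  have [yn|yn] := leP y ((n%:R + 2^-1) * pi).
    rewrite distrC; apply: Si_increment => //.
    by rewrite ler_pM2r// -[n.+1%:R]natr1 lerD2l invf_le1// ler1n.
  apply: Si_increment => //; last 2 first.
  - exact: ltW.
  - exact: ltW n2.
  by rewrite ler_pM2r// lerDl.
rewrite (splitr e).
have -> : pi / 2 - Si y = (pi / 2 - Si ((n%:R + 2^-1) * pi)) - (Si y - Si ((n%:R + 2^-1) * pi)) by ring.
apply: le_trans (ler_normB _ _) _; apply: lerD => //; exact: le_trans ne.
Unshelve. all: by end_near. Qed.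

Lemma is_derive_lipschitz (g : R -> R) (x dg e : R) : 0 < e -> is_derive x (1 : R) g dg ->
  \forall y \near x, `|g y - g x - dg * (y - x)| <= e * `|y - x|.
Proof.
move=> e0 [dgx gE].
have H : h^-1 *: (g (h *: (1 : R) + x) - g x) @[h --> 0^'] --> dg by rewrite -gE; exact: dgx.
have /cvgrPdist_le /(_ _ e0) [d /= d0 Hd] := H.
exists d => //= y yd; have [->|yx] := eqVneq y x; first by rewrite !subrr mulr0 subr0 normr0 mulr0.
have yx0 : y - x != 0 by rewrite subr_eq0.
have Hy : ball_ Num.Def.normr 0 d (y - x) by rewrite /ball_ /= sub0r normrN distrC.
have := Hd _ Hy yx0; rewrite /GRing.scale /= mulr1 subrK => Hq.
 rewrite -(ler_pM2r (_ : 0 < `|y - x|^-1)) ?invr_gt0 ?normr_gt0//.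
rewrite mulfK ?normr_eq0// -normfV -normrM.
rewrite (_ : (g y - g x - dg * (y - x)) / (y - x) = - (dg - (y - x)^-1 * (g y - g x))); last by field.
by rewrite normrN.
Qed.

(* Pointwise Fourier inversion in the variable [L x]: [T * sinc (T * u)] is
   half the integral of [cos (t * u)] over [-T <= t <= T]. *)
Lemma fourier_inversion (a b x0 dphi : R) (L m h : R -> R) : a < b ->
  {in `]a, b[, forall x : R, is_derive x (1 : R) L (- m x)} ->
  {in `]a, b[, continuous m} -> {in `]a, b[, forall x, 0 < m x} ->
  mu.-integrable `]a, b[ (EFin \o h) -> x0 \in `]a, b[ ->
  is_derive x0 (1 : R) (fun x => h x / m x) dphi ->
  \int[mu]_(x in `]a, b[) (h x * (T * sinc (T * (L x - L x0)))) @[T --> +oo]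
    --> pi * (h x0 / m x0).
Proof.
move=> ab dL cm m0 ih x0D dphix.
have cL : {in `]a, b[, continuous L}.
  by move=> x xab; exact: is_derive_continuous (dL _ xab).
pose phi x := h x / m x; pose L0 := L x0; pose mx := m x0.
have mx0 : 0 < mx by exact: m0.
(* First order control around [x0]: [m] stays below twice its value, [L] separates points at least
   at half its slope, and [h / m] is Lipschitz at [x0]. *)
have [del del0 Hdel] : exists2 del, 0 < del & forall x, `|x - x0| <= del ->
    [/\ x \in `]a, b[, m x <= 2 * mx, mx / 2 * `|x - x0| <= `|L x - L0| &
        `|phi x - phi x0| <= (`|dphi| + 1) * `|x - x0|].
  have N1 : \forall x \near x0, x \in `]a, b[ by exact: near_in_itvoo.
  have N2 : \forall x \near x0, m x <= 2 * mx.
    have /cvgrPdist_le /(_ _ mx0) := cm _ x0D; apply: filterS => x.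
    rewrite -/mx ler_norml => /andP[h1 _]; lra.
  have mx2 : 0 < mx / 2 by rewrite divr_gt0.
  have N3 : \forall x \near x0, mx / 2 * `|x - x0| <= `|L x - L0|.
    have := is_derive_lipschitz mx2 (dL _ x0D); apply: filterS => x.
    rewrite -/mx -/L0 => Hx.
    have E : mx * (x - x0) = (L x - L0 - - mx * (x - x0)) - (L x - L0) by ring.
    have := ler_normB (L x - L0 - - mx * (x - x0)) (L x - L0); rewrite -E normrM (gtr0_norm mx0).
    by move: Hx; lra.
  have N4 : \forall x \near x0, `|phi x - phi x0| <= (`|dphi| + 1) * `|x - x0|.
    have := is_derive_lipschitz (@ltr01 R) dphix; apply: filterS => x; rewrite -/(phi x) -/(phi x0) => Hx.
    have E : phi x - phi x0 = (phi x - phi x0 - dphi * (x - x0)) + dphi * (x - x0) by ring.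
    rewrite E; apply: le_trans (ler_normD _ _) _; rewrite normrM; lra.
  have [d /= d0 Hd] : \forall x \near x0, [/\ x \in `]a, b[, m x <= 2 * mx, mx / 2 * `|x - x0| <= `|L x - L0| &
        `|phi x - phi x0| <= (`|dphi| + 1) * `|x - x0|].
    by near=> x; split; near: x.
  exists (d / 2); first by rewrite divr_gt0.
  move=> x xd; apply: Hd; rewrite /ball /= distrC; apply: le_lt_trans xd _.
  by rewrite ltr_pdivrMr// ltr_pMr// ltr1n.
pose c := x0 - del; pose d := x0 + del.
have cd : c < d by rewrite /c /d; lra.
have inE' x : x \in `[c, d] = (`|x - x0| <= del).
  by rewrite in_itv /= ler_norml /c /d; apply/andP/andP => -[h1 h2]; split; lra.
have sub : `[c, d] `<=` `]a, b[.
  by move=> x; rewrite /= inE' => /Hdel[].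
have cD : c \in `]a, b[ by apply: sub; rewrite /= in_itv /= lexx ltW.
have dD : d \in `]a, b[ by apply: sub; rewrite /= in_itv /= lexx ltW.
have Lc : L0 < L c by apply: (phase_decreasing dL m0) => //; rewrite /c; lra.
have Ld : L d < L0 by apply: (phase_decreasing dL m0) => //; rewrite /d; lra.
(* Subtracting [phi x0 * m] near [x0] makes the quotient [f] integrable (Dini's condition). The
   cutoff [chi] is there because [m] may fail to be integrable up to the ends, where [L] can be
   unbounded. *)
pose chi x : R := \1_(`[c, d]) x.
pose f x := (h x - phi x0 * (m x * chi x)) / (L x - L0).
(* Since [L] is monotone, [|L x - L0| >= eta] off [[c, d]], so there the quotient is bounded by
   [|h| / eta]. *)
pose eta := Num.min (L c - L0) (L0 - L d).
have eta0 : 0 < eta by rewrite lt_min !subr_gt0 Lc.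
have mh : measurable_fun `]a, b[ h by case/integrableP : ih => /measurable_EFinP.
have mf : measurable_fun `]a, b[ f.
  apply: measurable_funM.
    apply: measurable_funB => //; apply: measurable_funM => //.
    apply: measurable_funM; first exact: oo_continuous_measurable.
    by apply: measurable_funTS; apply: measurable_indic; exact: measurable_itv.
  apply: (measurable_comp measurableT) => //; first exact: measurable_invr.
  by apply: measurable_funB => //; exact: oo_continuous_measurable.
(* Twice [m x0] in the numerator over half [m x0] in the denominator gives the factor 4. *)
pose C := 4 * (`|dphi| + 1).
have C0 : 0 <= C by rewrite mulr_ge0// addr_ge0.
have fle x : x \in `]a, b[ -> `|f x| <= `|h x| / eta + C.
  move=> xab; have [xcd|xcd] := boolP (x \in `[c, d]).
    rewrite -[leLHS]add0r lerD ?divr_ge0 ?(ltW eta0)// /f /chi indicE mem_set//.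
    have := xcd; rewrite inE' => /Hdel[_ hm hL hphi].
    rewrite mulr1; have mxx := m0 _ xab.
    have -> : h x - phi x0 * m x = m x * (phi x - phi x0).
      by rewrite /phi; field; rewrite !lt0r_neq0.
    have [->|xx0] := eqVneq x x0; first by rewrite subrr mulr0 mul0r normr0.
    have ax : 0 < `|x - x0| by rewrite normr_gt0 subr_eq0.
    have aL : 0 < `|L x - L0| by apply: lt_le_trans hL; rewrite mulr_gt0 ?divr_gt0.
    rewrite normrM normfV ler_pdivrMr// normrM (gtr0_norm mxx).
    apply: (@le_trans _ _ (2 * mx * ((`|dphi| + 1) * `|x - x0|))).
      by apply: ler_pM => //; exact: ltW.
    have : C * (mx / 2 * `|x - x0|) <= C * `|L x - L0| by rewrite ler_wpM2l.
    apply: le_trans; rewrite /C le_eqVlt; apply/orP; left; apply/eqP; by field.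
  rewrite -[leLHS]addr0 lerD// /f /chi indicE memNset; last exact/negP.
  rewrite !mulr0 subr0 normrM normfV ler_wpM2l// lef_pV2 ?posrE//.
    move: xcd; rewrite in_itv /= negb_and -!ltNge => /orP[xc|xd].
      have := phase_decreasing dL m0 xab cD xc => Lx.
      by rewrite gtr0_norm; [rewrite ge_min; apply/orP; left; lra|rewrite subr_gt0; lra].
    have := phase_decreasing dL m0 dD xab xd => Lx.
    by rewrite ltr0_norm; [rewrite ge_min; apply/orP; right; lra|rewrite subr_lt0; lra].
  move: xcd; rewrite in_itv /= negb_and -!ltNge normr_gt0 subr_eq0 => /orP[xc|xd].
    by have := phase_decreasing dL m0 xab cD xc => Lx; rewrite gt_eqF//; lra.
  by have := phase_decreasing dL m0 dD xab xd => Lx; rewrite lt_eqF//; lra.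
have fi : mu.-integrable `]a, b[ (EFin \o f).
  apply: (@le_integrable _ _ R mu _ _ _ (EFin \o (fun x => eta^-1 * `|h x| + C))) => //.
  - exact/measurable_EFinP.
  - move=> x xab /=; rewrite lee_fin [leRHS]ger0_norm; last first.
      by rewrite addr_ge0// mulr_ge0// invr_ge0 ltW.
    by rewrite [eta^-1 * _]mulrC; exact: fle.
  - apply: integrable_realD => //; last exact: integrable_cst_oo.
    by apply: integrable_realZ => //; exact: integrable_norm.
have dL0 : {in `]a, b[, forall x : R, is_derive x (1 : R) (fun x => L x - L0) (- m x)}.
  move=> x xab; have dLx := dL _ xab.
  by rewrite -[X in is_derive _ _ _ X]subr0; exact: is_deriveB.
have RL := riemann_lebesgue ab dL0 cm m0 fi.
(* The subtracted part is integrated exactly by the substitution [T (L x - L0)]; its two sine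
   integrals tend to [pi/2] each, while the rest tends to 0. *)
have key T : 0 < T -> \int[mu]_(x in `]a, b[) (h x * (T * sinc (T * (L x - L x0)))) =
   \int[mu]_(x in `]a, b[) (f x * sin (T * (L x - L0))) +
   phi x0 * (Si (T * (L0 - L d)) + Si (T * (L c - L0))).
  move=> T0.
  rewrite -Si_symmetric ?mulr_ge0 ?(ltW T0) ?subr_ge0 ?(ltW Lc) ?(ltW Ld)//.
  rewrite -mulrN opprB -(phase_substitution dL cm m0)//.
  pose g x := m x * (T * sinc (T * (L x - L0))).
  have cg : {in `]a, b[, continuous g}.
    move=> x xab; apply: cvgM; first exact: cm.
    apply: cvgM; first exact: cvg_cst.
    apply: (@continuous_comp _ _ _ (fun x => T * (L x - L0)) sinc); last exact: sinc_continuous.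
    apply: cvgM; first exact: cvg_cst.
    by apply: cvgB; [exact: cL|exact: cvg_cst].
  have icd : mu.-integrable `]a, b[ (EFin \o (g \_ `[c, d])).
    rewrite -restrict_EFin; apply/integrable_restrict => //.
    rewrite (setIidr sub); apply: continuous_integrable_cc.
    exact: in_continuous_within cg sub.
  have -> : \int[mu]_(x in `[c, d]) (m x * (T * sinc (T * (L x - L0)))) =
      \int[mu]_(x in `]a, b[) (g \_ `[c, d]) x.
    by rewrite -Rintegral_mkcondr (setIidr sub).
  rewrite -RintegralZl// -RintegralD//; last 2 first.
  - apply: (@le_integrable _ _ R mu _ _ _ (EFin \o f)) => //.
      apply/measurable_EFinP; apply: measurable_funM => //.
      apply: oo_continuous_measurable => x xab.
      apply: (@continuous_comp _ _ _ (fun x => T * (L x - L0)) sin); last exact: continuous_sin.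
      apply: cvgM; first exact: cvg_cst.
      by apply: cvgB; [exact: cL|exact: cvg_cst].
    by move=> x _ /=; rewrite lee_fin normrM ler_piMr// sin_max.
  - exact: integrable_realZ.
  apply: eq_Rintegral => x; rewrite inE => xab.
  have -> : (g \_ `[c, d]) x = g x * chi x.
    by rewrite patchE /chi indicE; case: (x \in _); rewrite ?mulr1 ?mulr0.
  (* At [x0] the quotient [f] takes the default value of a division by 0, but it is multiplied by
     [sin 0]. *)
  have [->|xx0] := eqVneq x x0.
    rewrite /g -/L0 subrr mulr0 sin0 mulr0 add0r /chi indicE mem_set; last first.
      by rewrite /= inE' subrr normr0 ltW.
    by rewrite mulr1 mulrA /phi divfK// lt0r_neq0.
  have LL : L x - L0 != 0.
    rewrite subr_eq0; move: xx0; rewrite neq_lt => /orP[xx|xx].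
      by have := phase_decreasing dL m0 xab x0D xx => Lx; rewrite gt_eqF.
    by have := phase_decreasing dL m0 x0D xab xx => Lx; rewrite lt_eqF.
  rewrite -/L0 -[sin _]sincM /f /g.
  by field.
have cvgS (k : R) : 0 < k -> Si (T * k) @[T --> +oo] --> pi / 2.
  move=> k0; have H : (T * k) @[T --> +oo] --> +oo; last exact: (cvg_comp _ _ H Si_cvg).
  by apply/cvgryPge => A; near=> T; rewrite -ler_pdivrMr//.
have LIM : \int[mu]_(x in `]a, b[) (f x * sin (T * (L x - L0))) +
   phi x0 * (Si (T * (L0 - L d)) + Si (T * (L c - L0))) @[T --> +oo] --> pi * phi x0.
  have -> : pi * phi x0 = 0 + phi x0 * (pi / 2 + pi / 2) by field.
  apply: cvgD; first exact: RL.
  apply: cvgM; first exact: cvg_cst.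
  by apply: cvgD; apply: cvgS; rewrite subr_gt0.
apply: cvg_trans LIM; apply: near_eq_cvg; near=> T.
by rewrite key//; near: T; exact: nbhs_pinfty_gt.
Unshelve. all: by end_near. Qed.

End sinc.

(** * The curve and its weight *)

Section kernel.
Context {R : realType}.
Notation mu := (@lebesgue_measure R).
Implicit Types (x y : R).
Variable p : R.
Hypothesis p1 : 1 < p.

(** [X] and [rho] enter through their logarithms [logx] and [logR], so that [X^s rho^r] is a single
    exponential for complex [s] too; [weight] is [B_r]. *)
Definition logx x : R := p * ln (sin (p * x)) - (p - 1) * ln (sin ((p - 1) * x)) - ln (sin x).
Definition logR x : R := ln (sin (p * x)) - ln (sin ((p - 1) * x)).
Definition weight r x : R :=
  sin ((r + 1) * x) / sin x + (p - 1) * (sin ((p - 1 - r) * x) / sin ((p - 1) * x)).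
(** Minus the derivative of [logx], a positive quantity. *)
Definition dlogx x : R := (p - 1) ^+ 2 * (cos ((p - 1) * x) / sin ((p - 1) * x))
  + cos x / sin x - p ^+ 2 * (cos (p * x) / sin (p * x)).
Definition dlogR x : R := p * (cos (p * x) / sin (p * x)) -
  (p - 1) * (cos ((p - 1) * x) / sin ((p - 1) * x)).
Definition tip : R := pi / p.

Lemma logxE x : logx x = p * ln (sin (p * x)) - (p - 1) * ln (sin ((p - 1) * x)) - ln (sin x).
Proof. by []. Qed.
Lemma logRE x : logR x = ln (sin (p * x)) - ln (sin ((p - 1) * x)).
Proof. by []. Qed.
Lemma weightE r x : weight r x =
  sin ((r + 1) * x) / sin x + (p - 1) * (sin ((p - 1 - r) * x) / sin ((p - 1) * x)).
Proof. by []. Qed.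
Lemma dlogxE x : dlogx x = (p - 1) ^+ 2 * (cos ((p - 1) * x) / sin ((p - 1) * x))
  + cos x / sin x - p ^+ 2 * (cos (p * x) / sin (p * x)).
Proof. by []. Qed.
Lemma tipE : tip = pi / p. Proof. by []. Qed.

Let p0 : 0 < p. Proof. exact: lt_trans p1. Qed.
Let q0 : 0 < p - 1. Proof. by rewrite subr_gt0. Qed.

Lemma tip_gt0 : 0 < tip.
Proof. by rewrite divr_gt0// pi_gt0. Qed.

Lemma tipM : p * tip = pi.
Proof. by rewrite /tip mulrC divfK// lt0r_neq0. Qed.

Lemma tip_lt_pi : tip < pi.
Proof. by rewrite ltr_pdivrMr// ltr_pMr// pi_gt0. Qed.

Lemma sin_args x : x \in `]0, tip[ -> [/\ 0 < x, x < tip, 0 < sin x,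
  0 < sin ((p - 1) * x) & 0 < sin (p * x)].
Proof.
rewrite in_itv /= => /andP[x0 xt].
have px : p * x < pi by rewrite -tipM ltr_pM2l.
have tp := tip_lt_pi; have pp := @pi_gt0 R.
split => //; apply: sin_gt0_pi; apply/andP; split => //.
- exact: lt_trans tp.
- by rewrite mulr_gt0.
- by rewrite mulrBl mul1r; lra.
- by rewrite mulr_gt0.
Qed.

(** Writing [(p - 1) x = p x - x] and [x = p x - (p - 1) x] eliminates two cosines; the identities
    between weights then become rational ones in the remaining sines and cosines. *)
Lemma sin_sub_args x : x \in `]0, tip[ ->
  cos x = (sin ((p - 1) * x) + cos (p * x) * sin x) / sin (p * x) /\
  cos ((p - 1) * x) = (cos (p * x) * sin ((p - 1) * x) + sin x) / sin (p * x).
Proof.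
move=> /sin_args[_ _ s1 s2 s3].
have e1 : sin ((p - 1) * x) = sin (p * x) * cos x - cos (p * x) * sin x.
  by rewrite mulrBl mul1r sinB.
have e2 : sin x = sin (p * x) * cos ((p - 1) * x) - cos (p * x) * sin ((p - 1) * x).
  by rewrite -sinB; congr sin; ring.
split; [rewrite e1|rewrite e2]; field; exact: lt0r_neq0.
Qed.

Lemma weight_args r x : weight r x =
  (sin (r * x) * cos x + cos (r * x) * sin x) / sin x +
  (p - 1) * ((sin ((p - 1) * x) * cos (r * x) - cos ((p - 1) * x) * sin (r * x)) / sin ((p - 1) * x)).
Proof.
rewrite /weight (_ : (r + 1) * x = r * x + x); last by ring.
by rewrite (mulrBl x (p - 1) r) sinD sinB.
Qed.

Lemma weight_pred_args r x : weight (r - 1) x =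
  sin (r * x) / sin x +
  (p - 1) * ((sin (p * x) * cos (r * x) - cos (p * x) * sin (r * x)) / sin ((p - 1) * x)).
Proof.
rewrite /weight subrK (_ : (p - 1 - (r - 1)) * x = p * x - r * x) ?sinB//; ring.
Qed.

Lemma weight_shift_args r x : weight (r + (p - 1)) x =
  (sin (r * x) * cos (p * x) + cos (r * x) * sin (p * x)) / sin x -
  (p - 1) * (sin (r * x) / sin ((p - 1) * x)).
Proof.
rewrite /weight (_ : (r + (p - 1) + 1) * x = r * x + p * x); last by ring.
by rewrite sinD (_ : (p - 1 - (r + (p - 1))) * x = - (r * x)) ?sinN; [ring|ring].
Qed.

(* With [z] the point of the contour, [weight r] is the imaginary part of
   [(1 + z)^r dz/z] up to [|1 + z|^r]; the three identities below are
   [(1 + z)^r = (1 + z)^(r-1) + z (1 + z)^(r-1)] and the two derivatives of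
   [(1 + z)^a z^-s]. *)
Lemma weight_pascal r x : x \in `]0, tip[ ->
  weight r x = sin ((p - 1) * x) / sin (p * x) * weight (r - 1) x +
    sin x / sin (p * x) * weight (r + (p - 1)) x.
Proof.
move=> xD; have [_ _ s1 s2 s3] := sin_args xD.
rewrite weight_args weight_pred_args weight_shift_args.
have [-> ->] := sin_sub_args xD; field; rewrite !lt0r_neq0//.
Qed.

Lemma weight_dlogx r x : x \in `]0, tip[ ->
  - dlogx x * sin (r * x) = (p - 1) * weight r x -
    p * (sin ((p - 1) * x) / sin (p * x) * weight (r - 1) x).
Proof.
move=> xD; have [_ _ s1 s2 s3] := sin_args xD.
rewrite weight_args weight_pred_args /dlogx.
have [-> ->] := sin_sub_args xD; field; rewrite !lt0r_neq0//.
Qed.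

Lemma weight_dlogR r x : x \in `]0, tip[ ->
  dlogR x * sin (r * x) + cos (r * x) = weight r x -
    sin ((p - 1) * x) / sin (p * x) * weight (r - 1) x.
Proof.
move=> xD; have [_ _ s1 s2 s3] := sin_args xD.
rewrite weight_args weight_pred_args /dlogR.
have [-> ->] := sin_sub_args xD; field; rewrite !lt0r_neq0//.
Qed.

(** The sum of squares is the squared modulus of the logarithmic derivative
    [cot x - (p - 1) cot((p - 1) x) + i p] of [z] along the contour, whose imaginary part never
    vanishes. *)
Lemma dlogx_gt0 : {in `]0, tip[, forall x, 0 < dlogx x}.
Proof.
move=> x xD; have [_ _ s1 s2 s3] := sin_args xD.
have e3 : sin (p * x) = sin x * cos ((p - 1) * x) + cos x * sin ((p - 1) * x).
  by rewrite -sinD; congr sin; ring.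
have c3 : cos (p * x) = cos x * cos ((p - 1) * x) - sin x * sin ((p - 1) * x).
  by rewrite -cosD; congr cos; ring.
have -> : dlogx x = sin x * sin ((p - 1) * x) / sin (p * x) *
    ((cos x / sin x - (p - 1) * (cos ((p - 1) * x) / sin ((p - 1) * x))) ^+ 2 + p ^+ 2).
  rewrite /dlogx c3 {1 2}e3; rewrite e3 in s3; field; rewrite !lt0r_neq0//.
rewrite mulr_gt0// ?divr_gt0 ?mulr_gt0// ltr_wpDl ?sqr_ge0// exprn_gt0//.
Qed.

Lemma is_derive_lin (k : R) x : is_derive x (1 : R) (fun x => k * x) k.
Proof. by rewrite -[X in is_derive _ _ _ X]mulr1; exact: is_deriveZ. Qed.

Lemma is_derive_ln_sin (k : R) x : 0 < sin (k * x) ->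
  is_derive x (1 : R) (fun x => ln (sin (k * x))) (k * (cos (k * x) / sin (k * x))).
Proof.
move=> s0; rewrite mulrCA mulrA; apply: (@is_derive_ln_comp _ _ (fun x => sin (k * x))) => //.
by apply: is_derive_sin_comp; exact: is_derive_lin.
Qed.

Lemma is_derive_logx : {in `]0, tip[, forall x : R, is_derive x (1 : R) logx (- dlogx x)}.
Proof.
move=> x xD; have [_ _ s1 s2 s3] := sin_args xD.
have d3 := is_derive_ln_sin s3; have d2 := is_derive_ln_sin s2.
rewrite -[x in sin x]mul1r in s1; have d1 := is_derive_ln_sin s1.
have -> : - dlogx x = p * (p * (cos (p * x) / sin (p * x))) -
   (p - 1) * ((p - 1) * (cos ((p - 1) * x) / sin ((p - 1) * x))) - 1 * (cos (1 * x) / sin (1 * x)).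
  by rewrite /dlogx !mul1r; ring.
have -> : logx = (fun x => p * ln (sin (p * x)) - (p - 1) * ln (sin ((p - 1) * x)) - ln (sin (1 * x))).
  by apply/funext => y; rewrite /logx mul1r.
apply: is_deriveB; apply: is_deriveB; exact: is_deriveZ.
Qed.

Lemma is_derive_logR : {in `]0, tip[, forall x : R, is_derive x (1 : R) logR (dlogR x)}.
Proof.
move=> x xD; have [_ _ s1 s2 s3] := sin_args xD.
have d3 := is_derive_ln_sin s3; have d2 := is_derive_ln_sin s2.
exact: is_deriveB.
Qed.

Lemma continuous_sin_lin (k : R) : continuous (fun x => sin (k * x)).
Proof. by move=> x; have := is_derive_sin_comp (is_derive_lin k x); exact: is_derive_continuous. Qed.

Lemma continuous_cos_lin (k : R) : continuous (fun x => cos (k * x)).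
Proof. by move=> x; have := is_derive_cos_comp (is_derive_lin k x); exact: is_derive_continuous. Qed.

Lemma continuous_dlogx : {in `]0, tip[, continuous dlogx}.
Proof.
move=> x xD; have [_ _ s1 s2 s3] := sin_args xD.
have H k : 0 < sin (k * x) -> {for x, continuous (fun x => cos (k * x) / sin (k * x))}.
  move=> s0; apply: cvgM; first exact: continuous_cos_lin.
  by apply: cvgV; [rewrite lt0r_neq0|exact: continuous_sin_lin].
have -> : dlogx = (fun x => (p - 1) ^+ 2 * (cos ((p - 1) * x) / sin ((p - 1) * x))
  + cos (1 * x) / sin (1 * x) - p ^+ 2 * (cos (p * x) / sin (p * x))).
  by apply/funext => y; rewrite /dlogx mul1r.
apply: cvgB; first apply: cvgD.
- by apply: cvgM; [exact: cvg_cst|exact: H].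
- by apply: H; rewrite mul1r.
- by apply: cvgM; [exact: cvg_cst|exact: H].
Qed.

Lemma continuous_weight r : {in `]0, tip[, continuous (weight r)}.
Proof.
move=> x xD; have [_ _ s1 s2 s3] := sin_args xD.
apply: cvgD.
  apply: cvgM; first exact: continuous_sin_lin.
  by apply: cvgV; [rewrite lt0r_neq0|exact: continuous_sin].
apply: cvgM; first exact: cvg_cst.
apply: cvgM; first exact: continuous_sin_lin.
by apply: cvgV; [rewrite lt0r_neq0|exact: continuous_sin_lin].
Qed.

Lemma continuous_logx : {in `]0, tip[, continuous logx}.
Proof. by move=> x xD; exact: is_derive_continuous (is_derive_logx xD). Qed.

Lemma continuous_logR : {in `]0, tip[, continuous logR}.
Proof. by move=> x xD; exact: is_derive_continuous (is_derive_logR xD). Qed.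

End kernel.

(** * Behaviour of the kernel at both ends *)

Section kernel_bounds.
Context {R : realType}.
Notation mu := (@lebesgue_measure R).
Implicit Types (x y : R).

Lemma cvg_expR_ln_end (b c : R) : 0 < c -> expR (c * ln (b - x)) @[x --> b^'-] --> 0.
Proof.
move=> c0; apply/cvg_at_leftP => u [ub uc].
have /cvg_at_rightP/(_ (fun n => b - u n)) := powR_cvg0 c0.
have -> : (fun n => (b - u n) `^ c) = (fun n => expR (c * ln (b - u n))).
  by apply/funext => n; rewrite /powR gt_eqF ?subr_gt0.
apply; split; first by move=> n; rewrite subr_gt0.
by rewrite -(subrr b); apply: cvgB => //; exact: cvg_cst.
Qed.

Variable p : R.
Hypothesis p1 : 1 < p.
Let p0 : 0 < p. Proof. exact: lt_trans p1. Qed.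
Let q0 : 0 < p - 1. Proof. by rewrite subr_gt0. Qed.
Notation tip := (tip p).
Notation logx := (logx p).
Notation logR := (logR p).
Notation weight := (weight p).

(** The first two arguments stay away from [pi], whereas [p * x] reaches it at [tip]; hence the
    additional factor [tip - x]. *)
Lemma sin_lower x : x \in `]0, tip[ ->
  [/\ x * ((pi - tip) / 8) <= sin x,
      x * ((p - 1) * tip / 8) <= sin ((p - 1) * x) &
      x * (p ^+ 2 / 8 * (tip - x)) <= sin (p * x)].
Proof.
move=> xD; have [x0 xt s1 s2 s3] := sin_args p1 xD.
have tp := tip_lt_pi p1; have pt := tipM p1; have pp := @pi_gt0 R.
have px : p * x <= pi by rewrite -pt ler_pM2l ?ltW.
have qx : (p - 1) * x <= pi by rewrite mulrBl mul1r; lra.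
split.
- have := @sin_ge_quadratic R x; rewrite (ltW x0) (ltW (lt_trans xt tp)) => /(_ isT).
  by apply: le_trans; rewrite -[leRHS]mulrA ler_wpM2l ?(ltW x0)// ler_wpM2r// lerD2l lerN2 ltW.
- have := @sin_ge_quadratic R ((p - 1) * x); rewrite (mulr_ge0 (ltW q0) (ltW x0)) qx => /(_ isT).
  apply: le_trans.
  have -> : (p - 1) * x * (pi - (p - 1) * x) / 8 = x * ((p - 1) * (pi - (p - 1) * x) / 8) by ring.
  rewrite ler_wpM2l ?(ltW x0)// ler_wpM2r// ler_wpM2l ?(ltW q0)//.
  have : (p - 1) * x <= (p - 1) * tip by rewrite ler_wpM2l ?ltW.
  by rewrite (mulrBl tip) mul1r pt; lra.
- have := @sin_ge_quadratic R (p * x); rewrite (mulr_ge0 (ltW p0) (ltW x0)) px => /(_ isT).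
  by apply: le_trans; rewrite -pt le_eqVlt; apply/orP; left; apply/eqP; field.
Qed.

Lemma sin_upper x (k : R) : 0 <= k -> 0 <= x -> sin (k * x) <= k * x.
Proof.
move=> k0 x0; apply: le_trans (ler_norm _) _; apply: le_trans (sin_le_norm _) _.
by rewrite ger0_norm ?mulr_ge0.
Qed.

Lemma weight_bounded r : exists C, {in `]0, tip[, forall x, `|weight r x| <= C}.
Proof.
have tp := tip_lt_pi p1; have t0 := tip_gt0 p1.
exists (`|r + 1| / ((pi - tip) / 8) + (p - 1) * (`|p - 1 - r| / ((p - 1) * tip / 8))) => x xD.
have [x0 xt s1 s2 s3] := sin_args p1 xD.
have [l1 l2 _] := sin_lower xD.
have k1 : 0 < (pi - tip) / 8 by rewrite divr_gt0// subr_gt0.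
have k2 : 0 < (p - 1) * tip / 8 by apply: divr_gt0 => //; exact: mulr_gt0.
have H (k s c : R) : 0 < c -> 0 < s -> x * c <= s -> `|sin (k * x) / s| <= `|k| / c.
  move=> c0 sp xc; rewrite normrM normfV (gtr0_norm sp) ler_pdivrMr//.
  apply: le_trans (sin_le_norm _) _; rewrite normrM (gtr0_norm x0).
  by rewrite -mulrA ler_wpM2l// mulrC ler_pdivlMr.
apply: le_trans (ler_normD _ _) _; apply: lerD; first exact: H.
by rewrite normrM (gtr0_norm q0) ler_wpM2l ?(ltW q0)//; exact: H.
Qed.

(** In terms of the contour, [X^s rho^r = rho^(sp+r) |z|^(-s)]. As [|z|] is bounded above and below,
    only the exponent [s p + r] of [rho] governs the singularity at [tip]. *)
Lemma log_kernelE s r x : s * logx x + r * logR x =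
  (s * p + r) * logR x - s * (ln (sin x) - ln (sin ((p - 1) * x))).
Proof. by rewrite !logxE !logRE; ring. Qed.

(** This is [log |z|]: both sines are comparable to [x] on the whole interval. *)
Lemma logrho_bounded : exists C, {in `]0, tip[, forall x,
  `|ln (sin x) - ln (sin ((p - 1) * x))| <= C}.
Proof.
have tp := tip_lt_pi p1; have t0 := tip_gt0 p1.
have k1 : 0 < (pi - tip) / 8 by rewrite divr_gt0// subr_gt0.
have k2 : 0 < (p - 1) * tip / 8 by apply: divr_gt0 => //; exact: mulr_gt0.
exists (`|ln ((pi - tip) / 8)| + `|ln (p - 1)| + `|ln ((p - 1) * tip / 8)|) => x xD.
have [x0 xt s1 s2 s3] := sin_args p1 xD.
have [l1 l2 _] := sin_lower xD.
have u1 := @sin_upper x 1 ler01 (ltW x0); rewrite !mul1r in u1.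
have u2 := @sin_upper x (p - 1) (ltW q0) (ltW x0).
have L1 : ln x + ln ((pi - tip) / 8) <= ln (sin x).
  by rewrite -lnM ?posrE// ler_ln ?posrE// mulr_gt0.
have L2 : ln x + ln ((p - 1) * tip / 8) <= ln (sin ((p - 1) * x)).
  by rewrite -lnM ?posrE// ler_ln ?posrE// mulr_gt0.
have U1 : ln (sin x) <= ln x by rewrite ler_ln ?posrE.
have U2 : ln (sin ((p - 1) * x)) <= ln (p - 1) + ln x.
  by rewrite -lnM ?posrE// ler_ln ?posrE// mulr_gt0.
move: (ler_norm (ln ((pi - tip) / 8))) (ler_norm (- ln ((pi - tip) / 8))).
move: (ler_norm (ln (p - 1))) (ler_norm (- ln (p - 1))).
move: (ler_norm (ln ((p - 1) * tip / 8))) (ler_norm (- ln ((p - 1) * tip / 8))).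
rewrite !normrN => a1 a2 a3 a4 a5 a6.
have n1 := normr_ge0 (ln ((pi - tip) / 8)); have n2 := normr_ge0 (ln (p - 1)).
have n3 := normr_ge0 (ln ((p - 1) * tip / 8)).
rewrite ler_norml; apply/andP; split; lra.
Qed.

Lemma logR_bounds : exists C, {in `]0, tip[, forall x,
  logR x <= C /\ ln (tip - x) - C <= logR x}.
Proof.
have tp := tip_lt_pi p1; have t0 := tip_gt0 p1.
have k2 : 0 < (p - 1) * tip / 8 by apply: divr_gt0 => //; exact: mulr_gt0.
have k3 : 0 < p ^+ 2 / 8 by rewrite divr_gt0// exprn_gt0.
exists (`|ln p| + `|ln ((p - 1) * tip / 8)| + `|ln (p ^+ 2 / 8)| + `|ln (p - 1)|) => x xD.
have [x0 xt s1 s2 s3] := sin_args p1 xD.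
have [_ l2 l3] := sin_lower xD.
have u2 := @sin_upper x (p - 1) (ltW q0) (ltW x0).
have u3 := @sin_upper x p (ltW p0) (ltW x0).
have L2 : ln x + ln ((p - 1) * tip / 8) <= ln (sin ((p - 1) * x)).
  by rewrite -lnM ?posrE// ler_ln ?posrE// mulr_gt0.
have L3 : ln x + (ln (p ^+ 2 / 8) + ln (tip - x)) <= ln (sin (p * x)).
  by rewrite -!lnM ?posrE ?mulr_gt0 ?subr_gt0// ler_ln ?posrE// ?mulr_gt0 ?subr_gt0.
have U2 : ln (sin ((p - 1) * x)) <= ln (p - 1) + ln x.
  by rewrite -lnM ?posrE// ler_ln ?posrE// mulr_gt0.
have U3 : ln (sin (p * x)) <= ln p + ln x.
  by rewrite -lnM ?posrE// ler_ln ?posrE// mulr_gt0.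
move: (ler_norm (ln p)) (ler_norm (- ln p)).
move: (ler_norm (ln (p - 1))) (ler_norm (- ln (p - 1))).
move: (ler_norm (ln (p ^+ 2 / 8))) (ler_norm (- ln (p ^+ 2 / 8))).
move: (ler_norm (ln ((p - 1) * tip / 8))) (ler_norm (- ln ((p - 1) * tip / 8))).
rewrite !normrN => a1 a2 a3 a4 a5 a6 a7 a8; rewrite !logRE.
have n1 := normr_ge0 (ln p); have n2 := normr_ge0 (ln (p - 1)).
have n3 := normr_ge0 (ln ((p - 1) * tip / 8)); have n4 := normr_ge0 (ln (p ^+ 2 / 8)).
split; lra.
Qed.

Definition kmod s r x : R := expR (s * logx x + r * logR x).

Lemma kmod_gt0 s r x : 0 < kmod s r x. Proof. exact: expR_gt0. Qed.

(** A positive power of [rho] is simply bounded; a negative one grows at most like the same power of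
    [tip - x]. The minimum with 0 covers both. *)
Lemma kmod_bound s r : exists C, {in `]0, tip[, forall x,
  kmod s r x <= C * expR (Num.min (s * p + r) 0 * ln (tip - x))}.
Proof.
have [C1 H1] := logrho_bounded; have [C2 H2] := logR_bounds.
exists (expR (`|s| * C1 + `|s * p + r| * C2)) => x xD.
have h1 := H1 _ xD; have [h2 h3] := H2 _ xD.
rewrite /kmod log_kernelE -expRD ler_expR.
have t1 : - (s * (ln (sin x) - ln (sin ((p - 1) * x)))) <= `|s| * C1.
  by apply: le_trans (ler_norm _) _; rewrite normrN normrM ler_wpM2l.
suff : (s * p + r) * logR x <= `|s * p + r| * C2 + Num.min (s * p + r) 0 * ln (tip - x) by lra.
have [A0|A0] := leP (s * p + r) 0.
  rewrite (ler0_norm A0).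
  have : (s * p + r) * logR x <= (s * p + r) * (ln (tip - x) - C2) by rewrite ler_wnM2l.
  lra.
by rewrite (gtr0_norm A0) mul0r addr0 ler_wpM2l// ltW.
Qed.

Lemma continuous_kmod s r : {in `]0, tip[, continuous (kmod s r)}.
Proof.
move=> x xD; apply: (@continuous_comp _ _ _ (fun x => s * logx x + r * logR x) expR); last exact: continuous_expR.
apply: cvgD; apply: cvgM; try exact: cvg_cst; [exact: continuous_logx|exact: continuous_logR].
Qed.

(** With [s = d - 1], the condition on the exponent is the condition [d > 1 - (1 + r)/p] on the line
    of integration. *)
Lemma integrable_kernel s r (g : R -> R) (C : R) : -1 < s * p + r ->
  {in `]0, tip[, continuous g} -> {in `]0, tip[, forall x, `|g x| <= C} ->
  mu.-integrable `]0, tip[ (EFin \o (fun x => kmod s r x * g x)).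
Proof.
move=> A1 cg gC; have [C1 HC] := kmod_bound s r.
apply: (@integrable_le_oo _ _ _ _ (fun x => C1 * C * expR (Num.min (s * p + r) 0 * ln (tip - x)))).
- by move=> x xD; apply: cvgM; [exact: continuous_kmod|exact: cg].
- move=> x xD; rewrite normrM (gtr0_norm (kmod_gt0 _ _ _)) mulrAC.
  by apply: ler_pM => //; [exact: ltW (kmod_gt0 _ _ _)|exact: HC|exact: gC].
- apply: integrable_realZ => //; apply: integrable_power_end; first exact: tip_gt0.
  by rewrite lt_min A1 ltrN10.
Qed.

Lemma kmod_cvg_tip s r : 0 < s * p + r -> kmod s r x @[x --> tip^'-] --> 0.
Proof.
move=> A0; have [C1 H1] := logrho_bounded.
have tp := tip_lt_pi p1; have t0 := tip_gt0 p1.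
have k2 : 0 < (p - 1) * tip / 8 by apply: divr_gt0 => //; exact: mulr_gt0.
pose M := expR (`|s| * C1 + (s * p + r) * (ln p - ln (tip / 2) - ln ((p - 1) * tip / 8))).
have : M * expR ((s * p + r) * ln (tip - x)) @[x --> tip^'-] --> 0.
  rewrite -[X in _ --> X](mulr0 M); apply: cvgM; first exact: cvg_cst.
  exact: cvg_expR_ln_end.
apply: (@squeeze_cvgr _ _ _ _ (fun=> 0)); last exact: cvg_cst.
near=> x; rewrite (ltW (kmod_gt0 _ _ _)) /=.
have xt : x < tip by near: x; exact: nbhs_left_lt.
(* On the right half of the interval [sin ((p - 1) * x)] is bounded below, so [rho] is at most a
   constant times [tip - x]. *)
have xt2 : tip / 2 < x by near: x; apply: nbhs_left_gt; rewrite ltr_pdivrMr// ltr_pMr// ltr1n.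
have x0 : 0 < x by apply: lt_trans xt2; apply: divr_gt0.
have xD : x \in `]0, tip[ by rewrite in_itv /= x0.
have [_ _ s1 s2 s3] := sin_args p1 xD.
have [_ l2 _] := sin_lower xD.
have h1 := H1 _ xD.
rewrite /kmod log_kernelE /M -expRD ler_expR.
have t1 : - (s * (ln (sin x) - ln (sin ((p - 1) * x)))) <= `|s| * C1.
  by apply: le_trans (ler_norm _) _; rewrite normrN normrM ler_wpM2l.
have L2 : ln x + ln ((p - 1) * tip / 8) <= ln (sin ((p - 1) * x)).
  by rewrite -lnM ?posrE// ler_ln ?posrE// mulr_gt0.
have t20 : 0 < tip / 2 by apply: divr_gt0.
have Lx : ln (tip / 2) <= ln x by rewrite ler_ln ?posrE ?(ltW xt2).
have U3 : ln (sin (p * x)) <= ln p + ln (tip - x).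
  have u3 : sin (p * x) <= p * (tip - x).
    have -> : sin (p * x) = sin (p * (tip - x)).
      by rewrite mulrBr tipM// sinB sinpi cospi mul0r mulN1r opprK add0r.
    by apply: sin_upper; rewrite ?subr_ge0 ltW.
  by rewrite -lnM ?posrE ?subr_gt0// ler_ln ?posrE// mulr_gt0 ?subr_gt0.
suff : (s * p + r) * logR x <= (s * p + r) * (ln p - ln (tip / 2) - ln ((p - 1) * tip / 8) + ln (tip - x)) by lra.
by rewrite ler_wpM2l ?(ltW A0)// !logRE; lra.
Unshelve. all: by end_near. Qed.

Lemma sinc_cvg0 (k : R) : sinc (k * x) @[x --> 0^'+] --> (1 : R).
Proof.
have -> : 1 = sinc (k * 0) :> R by rewrite mulr0 /sinc eqxx.
apply: cvg_at_right_filter.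
apply: (@continuous_comp _ _ _ (fun x => k * x) sinc); last exact: sinc_continuous.
by apply: cvgM; [exact: cvg_cst|exact: cvg_id].
Qed.

Lemma ln_sin_cvg0 (k : R) : 0 < k -> ln (k * sinc (k * x)) @[x --> 0^'+] --> ln k.
Proof.
move=> k0; apply: continuous_cvg; first exact: continuous_ln.
rewrite -[X in _ --> X]mulr1; apply: cvgM; [exact: cvg_cst|exact: sinc_cvg0].
Qed.

Lemma ln_sinE (k x : R) : 0 < x -> 0 < k -> 0 < sin (k * x) ->
  ln (sin (k * x)) = ln x + ln (k * sinc (k * x)).
Proof.
move=> x0 k0 s0; have E : sin (k * x) = x * (k * sinc (k * x)) by rewrite -sincM; ring.
rewrite E lnM ?posrE//; move: s0; rewrite E; first by rewrite pmulr_rgt0.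
Qed.

Lemma near0_tip : \forall x \near 0^'+, x \in `]0, tip[.
Proof.
near=> x; rewrite in_itv /=; apply/andP; split; near: x; first exact: nbhs_right_gt.
by apply: nbhs_right_lt; exact: tip_gt0.
Unshelve. all: by end_near. Qed.

(** Writing [sin(kx) = x k sinc(kx)], the terms in [ln x] cancel because [p - (p - 1) - 1 = 0]. *)
Lemma logx_cvg0 : logx x @[x --> 0^'+] --> p * ln p - (p - 1) * ln (p - 1).
Proof.
have H : p * ln (p * sinc (p * x)) - (p - 1) * ln ((p - 1) * sinc ((p - 1) * x))
   - ln (1 * sinc (1 * x)) @[x --> 0^'+] --> p * ln p - (p - 1) * ln (p - 1) - ln 1.
  apply: cvgB; last exact: ln_sin_cvg0.
  by apply: cvgB; apply: cvgM; try exact: cvg_cst; exact: ln_sin_cvg0.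
rewrite ln1 subr0 in H; apply: cvg_trans H; apply: near_eq_cvg.
apply: filterS near0_tip => x xD; have [x0 _ s1 s2 s3] := sin_args p1 xD.
have := ln_sinE x0 ltr01; rewrite !mul1r => /(_ s1) E1.
by rewrite !logxE E1 !ln_sinE//; ring.
Qed.

Lemma logR_cvg0 : logR x @[x --> 0^'+] --> ln p - ln (p - 1).
Proof.
have H : ln (p * sinc (p * x)) - ln ((p - 1) * sinc ((p - 1) * x))
   @[x --> 0^'+] --> ln p - ln (p - 1).
  by apply: cvgB; exact: ln_sin_cvg0.
apply: cvg_trans H; apply: near_eq_cvg.
apply: filterS near0_tip => x xD; have [x0 _ s1 s2 s3] := sin_args p1 xD.
by rewrite !logRE !ln_sinE//; ring.
Qed.

(** The limit [(r + 1) + (p - 1 - r)] is the same for all [r]; this lets [mellin n 0] normalize the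
    integrals for every [r]. *)
Lemma weight_cvg0 r : weight r x @[x --> 0^'+] --> p.
Proof.
have H : (r + 1) * sinc ((r + 1) * x) / sinc (1 * x) + (p - 1) * (((p - 1 - r) * sinc ((p - 1 - r) * x)) /
   ((p - 1) * sinc ((p - 1) * x))) @[x --> 0^'+] -->
   (r + 1) * 1 / 1 + (p - 1) * (((p - 1 - r) * 1) / ((p - 1) * 1)).
  apply: cvgD; first apply: cvgM.
  - by apply: cvgM; [exact: cvg_cst|exact: sinc_cvg0].
  - by apply: cvgV; [rewrite oner_neq0|exact: sinc_cvg0].
  - apply: cvgM; first exact: cvg_cst.
    apply: cvgM; first by apply: cvgM; [exact: cvg_cst|exact: sinc_cvg0].
    apply: cvgV; first by rewrite mulr1 lt0r_neq0.
    by apply: cvgM; [exact: cvg_cst|exact: sinc_cvg0].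
have Ep : (r + 1) * 1 / 1 + (p - 1) * (((p - 1 - r) * 1) / ((p - 1) * 1)) = p.
  by field; rewrite lt0r_neq0.
rewrite Ep in H.
apply: cvg_trans H; apply: near_eq_cvg.
apply: filterS near0_tip => x xD; have [x0 _ s1 s2 s3] := sin_args p1 xD.
have E k : sin (k * x) = x * (k * sinc (k * x)) by rewrite -sincM; ring.
rewrite !weightE -[in sin x](mul1r x) !E mul1r.
have n2 : (p - 1) * sinc ((p - 1) * x) != 0.
  by rewrite lt0r_neq0//; move: s2; rewrite E pmulr_rgt0.
have n1 : sinc x != 0.
  by rewrite lt0r_neq0//; move: s1; rewrite -sincM pmulr_rgt0.
move: n2; rewrite mulf_eq0 negb_or => /andP[q1 n2].
field; rewrite n1 n2 q1 !lt0r_neq0//.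
Qed.

End kernel_bounds.

(** * The Mellin transform of the weight *)

Section complex_integral.
Context {R : realType}.
Notation mu := (@lebesgue_measure R).
Variable D : set R.
Hypothesis mD : measurable D.
Implicit Types (f g : R -> R[i]).

Definition cint f : R[i] :=
  (\int[mu]_(x in D) complex.Re (f x)) +i* (\int[mu]_(x in D) complex.Im (f x)).

Definition cintegrable f :=
  mu.-integrable D (EFin \o (fun x => complex.Re (f x))) /\
  mu.-integrable D (EFin \o (fun x => complex.Im (f x))).

Lemma cintegrableZ (c : R[i]) f : cintegrable f -> cintegrable (fun x => c * f x).
Proof.
move=> [fr fi]; split.
  under eq_fun do rewrite cReM.
  by apply: integrable_realB => //; exact: integrable_realZ.
under eq_fun do rewrite cImM.
by apply: integrable_realD => //; exact: integrable_realZ.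
Qed.

Lemma cintegrableD f g : cintegrable f -> cintegrable g -> cintegrable (fun x => f x + g x).
Proof.
move=> [fr fi] [gr gi]; split.
  by under eq_fun do rewrite cReD; exact: integrable_realD.
by under eq_fun do rewrite cImD; exact: integrable_realD.
Qed.

Lemma cintZ (c : R[i]) f : cintegrable f -> cint (fun x => c * f x) = c * cint f.
Proof.
move=> [fr fi]; apply: complex_ext; rewrite /= /cint ?cReM ?cImM /=.
  under eq_Rintegral do rewrite cReM.
  by rewrite RintegralB ?RintegralZl//; exact: integrable_realZ.
under eq_Rintegral do rewrite cImM.
by rewrite RintegralD ?RintegralZl//; exact: integrable_realZ.
Qed.

Lemma cintD f g : cintegrable f -> cintegrable g ->
  cint (fun x => f x + g x) = cint f + cint g.
Proof.
move=> [fr fi] [gr gi]; apply: complex_ext; rewrite /= /cint ?cReD ?cImD /=.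
  by under eq_Rintegral do rewrite cReD; rewrite RintegralD.
by under eq_Rintegral do rewrite cImD; rewrite RintegralD.
Qed.

Lemma eq_cint f g : {in D, f =1 g} -> cint f = cint g.
Proof.
by move=> fg; apply: complex_ext => /=; apply: eq_Rintegral => x xD; rewrite fg.
Qed.

End complex_integral.

Section complex_kernel.
Context {R : realType}.
Notation mu := (@lebesgue_measure R).
Implicit Types (x y r : R) (s : R[i]).
Variable p : R.
Hypothesis p1 : 1 < p.
Let p0 : 0 < p. Proof. exact: lt_trans p1. Qed.
Let q0 : 0 < p - 1. Proof. by rewrite subr_gt0. Qed.
Notation tip := (tip p).
Notation logx := (logx p).
Notation logR := (logR p).
Notation weight := (weight p).
Notation D := (`]0, tip[%classic : set R).

Definition cker s r x : R[i] := cexp (s * (logx x)%:C + (r * logR x)%:C).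

Lemma ckerE s r x : cker s r x = cexp (s * (logx x)%:C + (r * logR x)%:C).
Proof. by []. Qed.

Lemma Re_cker s r x : complex.Re (cker s r x) =
  kmod p (complex.Re s) r x * cos (complex.Im s * logx x).
Proof.
rewrite /cker Re_cexp cReD cImD cReM cImM /= /kmod.
by congr (expR _ * cos _); ring.
Qed.

Lemma Im_cker s r x : complex.Im (cker s r x) =
  kmod p (complex.Re s) r x * sin (complex.Im s * logx x).
Proof.
rewrite /cker Im_cexp cReD cImD cReM cImM /= /kmod.
by congr (expR _ * sin _); ring.
Qed.

(** The quotient is [1/rho]; the one in [cker_logx] is [rho^(p-1) / X]. Multiplying by them only
    shifts the parameters of the kernel. *)
Lemma cker_logR s r x : x \in `]0, tip[ ->
  cker s r x * (sin ((p - 1) * x) / sin (p * x))%:C = cker s (r - 1) x.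
Proof.
move=> xD; have [_ _ s1 s2 s3] := sin_args p1 xD.
have -> : sin ((p - 1) * x) / sin (p * x) = expR (- logR x).
  by rewrite !logRE opprB expRB !lnK.
rewrite -cexp_real /cker -cexpD -addrA -rmorphD; congr (cexp (_ + _%:C)); ring.
Qed.

Lemma cker_logx s r x : x \in `]0, tip[ ->
  cker s r x * (sin x / sin (p * x))%:C = cker (s - 1) (r + (p - 1)) x.
Proof.
move=> xD; have [_ _ s1 s2 s3] := sin_args p1 xD.
have -> : sin x / sin (p * x) = expR (- logx x + (p - 1) * logR x).
  rewrite (_ : - logx x + _ = ln (sin x) - ln (sin (p * x))) ?expRB ?lnK//.
  by rewrite !logxE !logRE; ring.
rewrite -cexp_real /cker -cexpD; congr cexp.
by move: (logx x) (logR x) => u v; ring.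
Qed.

Lemma continuous_phase (t : R) : {in `]0, tip[, continuous (fun x => t * logx x)}.
Proof. by move=> x xD; apply: cvgM; [exact: cvg_cst|exact: continuous_logx]. Qed.

Lemma cintegrable_kernel s r (g : R -> R) (C : R) : -1 < complex.Re s * p + r ->
  {in `]0, tip[, continuous g} -> {in `]0, tip[, forall x, `|g x| <= C} ->
  cintegrable D (fun x => cker s r x * (g x)%:C).
Proof.
move=> A1 cg gC; split.
  rewrite (_ : (fun x => _) = (fun x => kmod p (complex.Re s) r x * (cos (complex.Im s * logx x) * g x))).
    apply: (integrable_kernel p1 A1 (C := C)) => x xD.
      apply: cvgM; last exact: cg.
      apply: (@continuous_comp _ _ _ (fun x => complex.Im s * logx x) cos); last exact: continuous_cos.
      exact: continuous_phase.
    rewrite normrM; apply: le_trans (gC _ xD); rewrite ler_piMl//.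
    exact: cos_max.
  by apply/funext => x; rewrite cReM Re_cker /= mulr0 subr0 mulrA.
rewrite (_ : (fun x => _) = (fun x => kmod p (complex.Re s) r x * (sin (complex.Im s * logx x) * g x))).
  apply: (integrable_kernel p1 A1 (C := C)) => x xD.
    apply: cvgM; last exact: cg.
    apply: (@continuous_comp _ _ _ (fun x => complex.Im s * logx x) sin); last exact: continuous_sin.
    exact: continuous_phase.
  rewrite normrM; apply: le_trans (gC _ xD); rewrite ler_piMl//.
  exact: sin_max.
by apply/funext => x; rewrite cImM Im_cker /= mulr0 add0r mulrA.
Qed.

Lemma cintegrable_weight s r r' : -1 < complex.Re s * p + r ->
  cintegrable D (fun x => cker s r x * (weight r' x)%:C).
Proof.
move=> A1; have [C HC] := weight_bounded p1 r'.
by apply: cintegrable_kernel HC => //; exact: continuous_weight.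
Qed.

Definition mellin s r : R[i] := (pi^-1)%:C * cint D (fun x => cker s r x * (weight r x)%:C).

Lemma mellinE s r : mellin s r = (pi^-1)%:C * cint D (fun x => cker s r x * (weight r x)%:C).
Proof. by []. Qed.

Definition cprim s r x : R[i] := cker s r x * (sin (r * x))%:C.
(** The derivative of [cprim], already rewritten by [weight_dlogx] and [weight_dlogR] as a
    combination of the integrands of [mellin s r] and [mellin s (r - 1)]. *)
Definition cprim' s r x : R[i] := cker s r x *
  ((s * (p - 1)%:C + r%:C) * (weight r x)%:C -
   (s * p%:C + r%:C) * (sin ((p - 1) * x) / sin (p * x) * weight (r - 1) x)%:C).

Lemma is_derive_kmod (s r : R) : {in `]0, tip[, forall x : R,
  is_derive x (1 : R) (kmod p s r) (kmod p s r x * (s * - dlogx p x + r * dlogR p x))}.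
Proof.
move=> x xD; apply: is_derive_expR_comp; apply: is_deriveD.
  by have := is_derive_logx p1 xD => H; exact: is_deriveZ.
by have := is_derive_logR p1 xD => H; exact: is_deriveZ.
Qed.

Lemma is_derive_mul x (f g : R -> R) (df dg : R) :
  is_derive x (1 : R) f df -> is_derive x (1 : R) g dg ->
  is_derive x (1 : R) (fun y => f y * g y) (df * g x + f x * dg).
Proof.
move=> hf hg; rewrite addrC [df * _]mulrC; exact: is_deriveM.
Qed.

Lemma is_derive_Re_cprim s r : {in `]0, tip[, forall x : R,
  is_derive x (1 : R) (fun x => complex.Re (cprim s r x)) (complex.Re (cprim' s r x))}.
Proof.
move=> x xD.
have -> : (fun x => complex.Re (cprim s r x)) =
    (fun x => (kmod p (complex.Re s) r x * cos (complex.Im s * logx x)) * sin (r * x)).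
  by apply/funext => y; rewrite /cprim cReM Re_cker /= mulr0 subr0.
have dm := is_derive_kmod (complex.Re s) r xD.
have dl : is_derive x (1 : R) (fun x => complex.Im s * logx x) (complex.Im s * - dlogx p x).
  by have := is_derive_logx p1 xD => H; exact: is_deriveZ.
have d2 := is_derive_mul (is_derive_mul dm (is_derive_cos_comp dl)) (is_derive_sin_comp (is_derive_lin r x)).
have I1 := weight_dlogx p1 r xD; have I2 := weight_dlogR p1 r xD.
apply: is_derive_eq.
rewrite /cprim' cReM Re_cker Im_cker !(cReD, cImD, cReN, cImN, cReM, cImM) /=.
rewrite !(mulr0, mul0r, addr0, add0r, subr0).
move: I1 I2; set w := weight r x; set C := _ * weight (r - 1) x => I1 I2.
set m := kmod _ _ _ _; set c := cos (complex.Im s * _); set sn := sin (complex.Im s * _).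
(* Collecting the terms in [s] and in [r] exhibits the left-hand sides of [weight_dlogx] and
   [weight_dlogR]. *)
transitivity (m * c * (complex.Re s * (- dlogx p x * sin (r * x)) +
    r * (dlogR p x * sin (r * x) + cos (r * x))) -
    m * sn * complex.Im s * (- dlogx p x * sin (r * x))); first by ring.
by rewrite I1 I2; ring.
Qed.

Lemma is_derive_Im_cprim s r : {in `]0, tip[, forall x : R,
  is_derive x (1 : R) (fun x => complex.Im (cprim s r x)) (complex.Im (cprim' s r x))}.
Proof.
move=> x xD.
have -> : (fun x => complex.Im (cprim s r x)) =
    (fun x => (kmod p (complex.Re s) r x * sin (complex.Im s * logx x)) * sin (r * x)).
  by apply/funext => y; rewrite /cprim cImM Im_cker /= mulr0 add0r.
have dm := is_derive_kmod (complex.Re s) r xD.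
have dl : is_derive x (1 : R) (fun x => complex.Im s * logx x) (complex.Im s * - dlogx p x).
  by have := is_derive_logx p1 xD => H; exact: is_deriveZ.
have d2 := is_derive_mul (is_derive_mul dm (is_derive_sin_comp dl)) (is_derive_sin_comp (is_derive_lin r x)).
have I1 := weight_dlogx p1 r xD; have I2 := weight_dlogR p1 r xD.
apply: is_derive_eq.
rewrite /cprim' cImM Re_cker Im_cker !(cReD, cImD, cReN, cImN, cReM, cImM) /=.
rewrite !(mulr0, mul0r, addr0, add0r, subr0).
move: I1 I2; set w := weight r x; set C := _ * weight (r - 1) x => I1 I2.
set m := kmod _ _ _ _; set c := cos (complex.Im s * _); set sn := sin (complex.Im s * _).
transitivity (m * sn * (complex.Re s * (- dlogx p x * sin (r * x)) +
    r * (dlogR p x * sin (r * x) + cos (r * x))) +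
    m * c * complex.Im s * (- dlogx p x * sin (r * x))); first by ring.
by rewrite I1 I2; ring.
Qed.

Lemma cker_weight_pred s r : {in `]0, tip[, forall x,
  cker s r x * (sin ((p - 1) * x) / sin (p * x) * weight (r - 1) x)%:C =
  cker s (r - 1) x * (weight (r - 1) x)%:C}.
Proof. by move=> x xD; rewrite rmorphM mulrA cker_logR. Qed.

Lemma cker_weight_shift s r : {in `]0, tip[, forall x,
  cker s r x * (sin x / sin (p * x) * weight (r + (p - 1)) x)%:C =
  cker (s - 1) (r + (p - 1)) x * (weight (r + (p - 1)) x)%:C}.
Proof. by move=> x xD; rewrite rmorphM mulrA cker_logx. Qed.

Definition ccontinuous (f : R -> R[i]) :=
  {in `]0, tip[, continuous (fun x => complex.Re (f x))} /\
  {in `]0, tip[, continuous (fun x => complex.Im (f x))}.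

Lemma ccontinuousM f g : ccontinuous f -> ccontinuous g -> ccontinuous (fun x => f x * g x).
Proof.
move=> [fr fi] [gr gi]; split => x xD.
  under eq_fun do rewrite cReM.
  by apply: cvgB; apply: cvgM; [exact: fr|exact: gr|exact: fi|exact: gi].
under eq_fun do rewrite cImM.
by apply: cvgD; apply: cvgM; [exact: fr|exact: gi|exact: fi|exact: gr].
Qed.

Lemma ccontinuousB f g : ccontinuous f -> ccontinuous g -> ccontinuous (fun x => f x - g x).
Proof.
move=> [fr fi] [gr gi]; split => x xD.
  under eq_fun do rewrite cReD cReN.
  by apply: cvgB; [exact: fr|exact: gr].
under eq_fun do rewrite cImD cImN.
by apply: cvgB; [exact: fi|exact: gi].
Qed.

Lemma ccontinuous_cst (c : R[i]) : ccontinuous (fun=> c).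
Proof. by split => x _; exact: cvg_cst. Qed.

Lemma ccontinuous_real (f : R -> R) : {in `]0, tip[, continuous f} ->
  ccontinuous (fun x => (f x)%:C).
Proof. by move=> cf; split => x xD; [exact: cf|exact: cvg_cst]. Qed.

Lemma ccontinuous_cker s r : ccontinuous (cker s r).
Proof.
split => x xD.
  under eq_fun do rewrite Re_cker.
  apply: cvgM; first exact: continuous_kmod.
  apply: (@continuous_comp _ _ _ (fun x => complex.Im s * logx x) cos); last exact: continuous_cos.
  exact: continuous_phase.
under eq_fun do rewrite Im_cker.
apply: cvgM; first exact: continuous_kmod.
apply: (@continuous_comp _ _ _ (fun x => complex.Im s * logx x) sin); last exact: continuous_sin.
exact: continuous_phase.
Qed.

Lemma ccontinuous_cprim' s r : ccontinuous (cprim' s r).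
Proof.
apply: ccontinuousM; first exact: ccontinuous_cker.
apply: ccontinuousB.
  apply: ccontinuousM; first exact: ccontinuous_cst.
  by apply: ccontinuous_real; exact: continuous_weight.
apply: ccontinuousM; first exact: ccontinuous_cst.
apply: ccontinuous_real => x xD; have [_ _ s1 s2 s3] := sin_args p1 xD.
apply: cvgM; last exact: continuous_weight.
apply: cvgM; first exact: continuous_sin_lin.
by apply: cvgV; [rewrite lt0r_neq0|exact: continuous_sin_lin].
Qed.

Lemma cvg0_dominated {T : Type} (F : set_system T) {FF : Filter F} (f g : T -> R) :
  (forall t, `|f t| <= g t) -> g t @[t --> F] --> 0 -> f t @[t --> F] --> 0.
Proof.
move=> fg /cvgrPdist_le g0; apply/cvgrPdist_le => e e0.
apply: filterS (g0 _ e0) => x; rewrite !sub0r !normrN => ge.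
by apply: le_trans (fg x) _; exact: le_trans (ler_norm _) ge.
Qed.

Lemma cprim_le s r x : `|complex.Re (cprim s r x)| <= kmod p (complex.Re s) r x * `|sin (r * x)| /\
  `|complex.Im (cprim s r x)| <= kmod p (complex.Re s) r x * `|sin (r * x)|.
Proof.
split.
  rewrite /cprim cReM Re_cker /= mulr0 subr0 !normrM.
  rewrite (gtr0_norm (kmod_gt0 _ _ _ _)) -!mulrA.
  by rewrite ler_wpM2l ?(ltW (kmod_gt0 _ _ _ _))// ler_piMl// cos_max.
rewrite /cprim cImM Im_cker /= mulr0 add0r !normrM.
rewrite (gtr0_norm (kmod_gt0 _ _ _ _)) -!mulrA.
by rewrite ler_wpM2l ?(ltW (kmod_gt0 _ _ _ _))// ler_piMl// sin_max.
Qed.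

Lemma kmod_cvg0 (s r : R) : kmod p s r x @[x --> 0^'+] -->
  expR (s * (p * ln p - (p - 1) * ln (p - 1)) + r * (ln p - ln (p - 1))).
Proof.
have H : s * logx x + r * logR x @[x --> 0^'+] -->
    s * (p * ln p - (p - 1) * ln (p - 1)) + r * (ln p - ln (p - 1)).
  by apply: cvgD; apply: cvgM; try exact: cvg_cst; [exact: logx_cvg0|exact: logR_cvg0].
exact: cvg_comp H (@continuous_expR R _).
Qed.

(** At [s = n] this is Pascal's rule for [binom(np + r, n)]. *)
Lemma mellin_pascal s r : 0 < complex.Re s * p + r ->
  mellin s r = mellin s (r - 1) + mellin (s - 1) (r + (p - 1)).
Proof.
move=> A0; rewrite /mellin -mulrDr -cintD//; last 2 first.
- by apply: cintegrable_weight; lra.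
- by apply: cintegrable_weight; rewrite cReD cReN /=; lra.
congr (_ * _); apply: eq_cint => x; rewrite inE => xD.
by rewrite (weight_pascal p1)// rmorphD mulrDr cker_weight_pred// cker_weight_shift.
Qed.

(** The boundary terms of [cprim] vanish: at 0 because of [sin (r * x)], at [tip] because the
    exponent of [rho] has positive real part. *)
Lemma mellin_pred s r : 0 < complex.Re s * p + r ->
  (s * (p - 1)%:C + r%:C) * mellin s r = (s * p%:C + r%:C) * mellin s (r - 1).
Proof.
move=> A0.
have i1 : cintegrable D (fun x => cker s r x * (weight r x)%:C).
  by apply: cintegrable_weight; lra.
have i2 : cintegrable D (fun x => cker s (r - 1) x * (weight (r - 1) x)%:C).
  by apply: cintegrable_weight; lra.
suff H : cint D (cprim' s r) = 0.
  apply/eqP; rewrite -subr_eq0 /mellin mulrCA [X in _ - X]mulrCA -mulrBr; apply/eqP.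
  rewrite -[RHS](mulr0 (pi^-1)%:C) -H; congr (_ * _).
  rewrite -[_ * cint _ _]cintZ// -[X in _ - X]cintZ//.
  rewrite -[X in _ + X]mulN1r -cintZ//; last exact: cintegrableZ.
  rewrite -cintD//; last 2 first.
  - exact: cintegrableZ.
  - by apply: cintegrableZ => //; exact: cintegrableZ.
  apply: eq_cint => x; rewrite inE => xD.
  by rewrite -cker_weight_pred// /cprim'; ring.
have [i3r i3i] : cintegrable D (cprim' s r).
  have [jr ji] : cintegrable D (fun x => (s * (p - 1)%:C + r%:C) * (cker s r x * (weight r x)%:C) +
      - (s * p%:C + r%:C) * (cker s (r - 1) x * (weight (r - 1) x)%:C)).
    by apply: cintegrableD => //; exact: cintegrableZ.
  have E : {in D, cprim' s r =1 (fun x => (s * (p - 1)%:C + r%:C) * (cker s r x * (weight r x)%:C) +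
      - (s * p%:C + r%:C) * (cker s (r - 1) x * (weight (r - 1) x)%:C))}.
    by move=> x; rewrite inE => xD; rewrite -cker_weight_pred// /cprim'; ring.
  split; [apply: eq_integrable jr|apply: eq_integrable ji] => // x xD /=; by rewrite E.
have cvgb (f : R -> R) : (forall x, `|f x| <= kmod p (complex.Re s) r x * `|sin (r * x)|) ->
    f x @[x --> tip^'-] --> 0.
  move=> fk; apply: (@cvg0_dominated _ _ _ f (kmod p (complex.Re s) r)); last exact: kmod_cvg_tip.
  move=> x; apply: le_trans (fk x) _; rewrite ler_piMr ?(ltW (kmod_gt0 _ _ _ _))//.
  exact: sin_max.
have cvga (f : R -> R) : (forall x, `|f x| <= kmod p (complex.Re s) r x * `|sin (r * x)|) ->
    f x @[x --> 0^'+] --> 0.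
  move=> fk; apply: cvg0_dominated fk _.
  set M := expR (complex.Re s * (p * ln p - (p - 1) * ln (p - 1)) + r * (ln p - ln (p - 1))).
  rewrite -[X in _ --> X](mulr0 M); apply: cvgM; first exact: kmod_cvg0.
  have H : sin (r * x) @[x --> 0^'+] --> sin (r * 0).
    by apply: cvg_at_right_filter; exact: continuous_sin_lin.
  have E : `|sin (r * 0)| = 0 by rewrite mulr0 sin0 normr0.
  rewrite -[X in _ --> X]E; exact: (cvg_norm H).
have [cr ci] := ccontinuous_cprim' s r.
apply: complex_ext; rewrite /cint /=.
  rewrite (FTC_oo (tip_gt0 p1) cr (is_derive_Re_cprim s r) (la := 0) (lb := 0)) ?subrr//.
  - by apply: cvga => x; have [] := cprim_le s r x.
  - by apply: cvgb => x; have [] := cprim_le s r x.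
rewrite (FTC_oo (tip_gt0 p1) ci (is_derive_Im_cprim s r) (la := 0) (lb := 0)) ?subrr//.
- by apply: cvga => x; have [] := cprim_le s r x.
- by apply: cvgb => x; have [] := cprim_le s r x.
Qed.

(** Eliminate [mellin s (r - 1)] between the two preceding relations, using
    [s p - s (p - 1) = s]. *)
Lemma mellin_shift s r : 0 < complex.Re s * p + r ->
  s * mellin s r = (s * p%:C + r%:C) * mellin (s - 1) (r + (p - 1)).
Proof.
move=> A0; have E1 := mellin_pred A0; have E2 := mellin_pascal A0.
have -> : s * mellin s r = (s * p%:C + r%:C) * mellin s r - (s * (p - 1)%:C + r%:C) * mellin s r.
  by rewrite rmorphB; ring.
by rewrite E1 E2; ring.
Qed.

Lemma mellin_iter_pred s r m : -1 < complex.Re s * p + r ->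
  rising (s * p%:C + r%:C + 1) m * mellin s r =
  rising (s * (p - 1)%:C + r%:C + 1) m * mellin s (r + m%:R).
Proof.
move=> A1; elim: m => [|m IH]; first by rewrite !rising0 addr0.
rewrite !risingS mulrAC IH -[LHS]mulrA -[RHS]mulrA; congr (_ * _).
have := @mellin_pred s (r + m%:R + 1).
have m0 : 0 <= m%:R :> R by [].
have A' : 0 < complex.Re s * p + (r + m%:R + 1) by lra.
move/(_ A'); rewrite addrK -[m.+1%:R]natr1 [r + (_ + _)]addrA => E.
have Em : (r + m%:R + 1)%:C = r%:C + m%:R + 1 by rewrite !rmorphD rmorph_nat rmorph1.
rewrite Em !addrA in E; rewrite [LHS]mulrC.
have -> : s * p%:C + r%:C + 1 + m%:R = s * p%:C + r%:C + m%:R + 1 by ring.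
by rewrite -E; congr (_ * _); ring.
Qed.

(** Each step adds 1 to [s] and removes [p - 1] from [r], so [s p + r] grows by 1 and the
    convergence condition persists. *)
Lemma mellin_iter_shift s r m : -1 < complex.Re s * p + r ->
  rising (s * p%:C + r%:C + 1) m * mellin s r =
  rising (s + 1) m * mellin (s + m%:R) (r - m%:R * (p - 1)).
Proof.
move=> A1; elim: m => [|m IH]; first by rewrite !rising0 addr0 mul0r subr0.
rewrite !risingS mulrAC IH -[LHS]mulrA -[RHS]mulrA; congr (_ * _).
have m0 : 0 <= m%:R :> R by [].
have := @mellin_shift (s + m.+1%:R) (r - m.+1%:R * (p - 1)).
have A' : 0 < complex.Re (s + m.+1%:R) * p + (r - m.+1%:R * (p - 1)).
  rewrite cReD cRe_nat -[m.+1%:R]natr1; lra.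
move/(_ A').
have -> : s + m.+1%:R - 1 = s + m%:R by rewrite -natr1; ring.
have -> : r - m.+1%:R * (p - 1) + (p - 1) = r - m%:R * (p - 1) by rewrite -natr1; ring.
have -> : (s + m.+1%:R) * p%:C + (r - m.+1%:R * (p - 1))%:C = s * p%:C + r%:C + 1 + m%:R.
  by rewrite rmorphB rmorphM rmorph_nat rmorphB rmorph1 -natr1; ring.
by move=> E; rewrite [LHS]mulrC -E; rewrite -[m.+1%:R]natr1 [s + 1 + _]addrAC addrA.
Qed.

End complex_kernel.

Section rising_theory.
Context {R : realType}.
Implicit Types (z : R[i]).

Lemma risingD z m n : rising z (m + n) = rising z m * rising (z + m%:R) n.
Proof.
elim: n => [|n IH]; first by rewrite addn0 rising0 mulr1.
by rewrite addnS !risingS IH natrD -!mulrA addrA.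
Qed.

Lemma rising_gauss z n :
  rising (z + 1) n = gauss z n * n`!%:R * cexp (z * (ln n%:R)%:C).
Proof.
rewrite /gauss mulNr cexpN; have f0 := @factC_neq0 R n.
have c0 := cexp_neq0 (z * (ln n%:R)%:C).
by move: (cexp _) c0 (rising _ _) => e e0 u; field; rewrite f0 e0.
Qed.

Lemma rising1 n : rising (1 : R[i]) n = n`!%:R.
Proof.
elim: n => [|n IH]; first by rewrite rising0.
by rewrite risingS IH factS natrM mulrC nat1r.
Qed.

Lemma cRe_realM (a : R) z : complex.Re (a%:C * z) = a * complex.Re z.
Proof. by rewrite cReM /= mul0r subr0. Qed.

Lemma cIm_realM (a : R) z : complex.Im (a%:C * z) = a * complex.Im z.
Proof. by rewrite cImM /= mul0r addr0. Qed.

Lemma gauss0 n : gauss (0 : R[i]) n = 1.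
Proof.
rewrite /gauss oppr0 mul0r cexp0 mulr1 add0r.
by rewrite rising1 mulfV// factC_neq0.
Qed.

Lemma cvgny_muln k : (0 < k)%N -> (n * k)%N @[n --> \oo] --> \oo.
Proof.
move=> k0; apply/cvgnyPge => A; near=> n.
by apply: (@leq_trans n); [near: n; exact: nbhs_infty_ge|exact: leq_pmulr].
Unshelve. all: by end_near.
Qed.

Lemma ccvg_muln (u : nat -> R[i]) z k : (0 < k)%N -> ccvg \oo u z ->
  ccvg \oo (fun n => u (n * k)%N) z.
Proof.
move=> k0 [ur ui]; split.
  exact: cvg_comp (cvgny_muln k0) ur.
exact: cvg_comp (cvgny_muln k0) ui.
Qed.

End rising_theory.

(** * Evaluation of the Mellin transform by Gauss's product *)

Section mellin_value.
Context {R : realType}.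
Notation mu := (@lebesgue_measure R).
Implicit Types (x y r : R) (s : R[i]).
Variable p : R.
Hypothesis p1 : 1 < p.
Let p0 : 0 < p. Proof. exact: lt_trans p1. Qed.
Let q0 : 0 < p - 1. Proof. by rewrite subr_gt0. Qed.
Notation tip := (tip p).
Notation logx := (logx p).
Notation logR := (logR p).
Notation weight := (weight p).
Notation mellin := (mellin p).
Notation cker := (cker p).
Notation D := (`]0, tip[%classic : set R).
(** [L0] and [l0] are the limits of [logx] and [logR] at 0; [L0] is the logarithm of [c(p)]. *)
Let L0 := p * ln p - (p - 1) * ln (p - 1).
Let l0 := ln p - ln (p - 1).

Lemma weight0 x : x \in `]0, tip[ -> weight 0 x = p.
Proof.
move=> /(sin_args p1)[_ _ s1 s2 s3].
rewrite !weightE add0r mul1r subr0 !divff ?lt0r_neq0//; ring.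
Qed.

Lemma logx_decreasing : {in `]0, tip[ &, {homo logx : x y /~ x < y}}.
Proof.
move=> x y xD yD yx.
have H := is_derive_logx p1.
have sub z : z \in `[y, x] -> z \in `]0, tip[.
  rewrite !in_itv /= => /andP[yz zx]; move: xD yD.
  rewrite !in_itv /= => /andP[x0 xt] /andP[y0 yt].
  by rewrite (lt_le_trans y0 yz) (le_lt_trans zx xt).
apply: (@ltr0_derive1_decr _ logx y x) => //.
- move=> z zI; have [dz _] := H _ (sub _ (subset_itv_oo_cc zI)); exact: dz.
- move=> z zI; have [_] := H _ (sub _ (subset_itv_oo_cc zI)); rewrite derive1E => ->.
  by rewrite oppr_lt0; apply: dlogx_gt0 => //; apply: sub; exact: subset_itv_oo_cc.
- apply: derivable_within_continuous => z zI; have [dz _] := H _ (sub _ zI); exact: dz.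
Qed.

Lemma logx_lt : {in `]0, tip[, forall x, logx x < L0}.
Proof.
move=> x xD; have [x0 xt _ _ _] := sin_args p1 xD.
have x2D : x / 2 \in `]0, tip[ by rewrite in_itv /=; lra.
(* Going through [x / 2] keeps the inequality strict although the limit only yields a weak one. *)
apply: (@lt_le_trans _ _ (logx (x / 2))); first by apply: logx_decreasing => //; lra.
have H := logx_cvg0 p1.
apply: (cvgr_to_ge H); near=> y; apply: ltW; apply: logx_decreasing => //.
  by near: y; exact: near0_tip.
by near: y; apply: nbhs_right_lt; rewrite divr_gt0.
Unshelve. all: by end_near.
Qed.

Lemma cker_addn s r n x : cker (s + n%:R) r x = (expR (logx x) ^+ n)%:C * cker s r x.
Proof.
rewrite -expRM_natl -cexp_real !ckerE -cexpD natrC; congr cexp.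
by rewrite rmorphM; ring.
Qed.

(** As [weight 0] is the constant [p], [mellin n 0] is [p / pi] times this integral. *)
Let J n : R := \int[mu]_(x in D) (expR (logx x) ^+ n).

Lemma mellin_addn s r n : mellin (s + n%:R) r = (pi^-1)%:C *
  cint D (fun x => (expR (logx x) ^+ n)%:C * (cker s r x * (weight r x)%:C)).
Proof.
by congr (_ * _); apply: eq_cint => x _; rewrite cker_addn mulrA.
Qed.

Lemma mellin_nat0 n : mellin n%:R 0 = (p / pi * J n)%:C.
Proof.
rewrite -[n%:R]add0r mellin_addn.
have -> : p / pi * J n = pi^-1 * (p * J n) by ring.
rewrite [RHS]rmorphM; congr (_ * _).
rewrite (@eq_cint _ _ _ (fun x => (p * expR (logx x) ^+ n)%:C)).
  apply: complex_ext => /=; last by rewrite Rintegral_cst ?mul0r.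
  rewrite RintegralZl//.
  have := @cintegrable_kernel _ p p1 n%:R 0 (fun=> 1) 1; rewrite cRe_nat addr0.
  have n0 : -1 < n%:R * p by rewrite (@lt_le_trans _ _ 0)// mulr_ge0// ltW.
  move=> /(_ n0) [| |H _].
  - by move=> x _; exact: cvg_cst.
  - by move=> x _; rewrite normr1.
  apply: eq_integrable H => // x xD; rewrite [LHS]/comp [RHS]/comp.
  by rewrite mulr1 Re_cker cIm_nat mul0r cos0 mulr1 /kmod cRe_nat mul0r addr0 expRM_natl.
move=> x; rewrite inE => xD; rewrite weight0//.
by rewrite !ckerE !mul0r addr0 cexp0 mul1r -rmorphM mulrC.
Qed.

Lemma mellin00 : mellin 0 0 = 1.
Proof.
rewrite (mellin_nat0 0).
suff -> : J 0 = tip by rewrite mulrC mulrA [tip * p]mulrC tipM// divff ?lt0r_neq0 ?pi_gt0.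
rewrite /J; under eq_Rintegral do rewrite expr0.
rewrite Rintegral_cst// mul1r.
have E : lebesgue_measure (`]0, tip[%classic : set R) = tip%:E.
  by rewrite lebesgue_measure_itv /= lte_fin tip_gt0// oppr0 adde0.
exact: (congr1 fine E).
Qed.

(** Numerator and denominator both concentrate at 0, where the kernel tends to the stated
    exponential and both weights to [p]. *)
Lemma mellin_ratio s r : -1 < complex.Re s * p + r ->
  ccvg \oo (fun n => mellin (s + n%:R) r / mellin n%:R 0) (cexp (s * L0%:C + (r * l0)%:C)).
Proof.
move=> A1; pose h x := cker s r x * (weight r x)%:C.
have [hr hi] : cintegrable D h by exact: cintegrable_weight.
have pin0 : pi != 0 :> R by rewrite lt0r_neq0// pi_gt0.
have pn0 : p != 0 by rewrite lt0r_neq0.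
have lim0 : ccvg 0^'+ h (cexp (s * L0%:C + (r * l0)%:C) * p%:C).
  apply: ccvgM; last by apply: ccvg_real; exact: weight_cvg0.
  apply: ccvg_cexp; have X0 := logx_cvg0 p1; have R0 := logR_cvg0 p1.
  split; [under eq_fun do rewrite cReD cReM /= mulr0 subr0 | under eq_fun do rewrite cImD cImM /= mulr0 add0r addr0].
    rewrite cReD cReM /= mulr0 subr0.
    by apply: cvgD; apply: cvgM => //; exact: cvg_cst.
  rewrite cImD cImM /= mulr0 add0r addr0.
  by apply: cvgM => //; exact: cvg_cst.
have [lr li] := lim0.
have cX : {in `]0, tip[, continuous (fun x => expR (logx x))}.
  move=> x xD; apply: (@continuous_comp _ _ _ logx expR); last exact: continuous_expR.
  exact: continuous_logx.
have bX : {in `]0, tip[, forall x, 0 < expR (logx x) <= expR L0}.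
  by move=> x xD; rewrite expR_gt0 ler_expR ltW// logx_lt.
have dX : {in `]0, tip[ &, {homo (fun x => expR (logx x)) : x y /~ x < y}}.
  by move=> x y xD yD xy; rewrite ltr_expR; exact: logx_decreasing.
have Hr := approximate_identity (tip_gt0 p1) cX bX dX hr lr.
have Hi := approximate_identity (tip_gt0 p1) cX bX dX hi li.
rewrite -/(J _) in Hr Hi.
have E n : mellin (s + n%:R) r / mellin n%:R 0 =
  (p^-1)%:C * (((\int[mu]_(x in D) (expR (logx x) ^+ n * complex.Re (h x))) / J n) +i*
   ((\int[mu]_(x in D) (expR (logx x) ^+ n * complex.Im (h x))) / J n)).
  rewrite mellin_addn mellin_nat0.
  have -> : ((p / pi * J n)%:C)^-1 = ((p / pi * J n)^-1)%:C by rewrite fmorphV.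
  rewrite /cint; set u := \int[mu]_(x in D) _; set v := \int[mu]_(x in D) _.
  have -> : u = \int[mu]_(x in D) (expR (logx x) ^+ n * complex.Re (h x)).
    by apply: eq_Rintegral => x _; rewrite cRe_realM.
  have -> : v = \int[mu]_(x in D) (expR (logx x) ^+ n * complex.Im (h x)).
    by apply: eq_Rintegral => x _; rewrite cIm_realM.
  rewrite !invfM invrK.
  set uu := Rintegral _ _ _; set vv := Rintegral _ _ _; move: uu vv (J n)^-1 => {}u {}v j.
  have E1 : pi^-1 * (p^-1 * pi * j) = p^-1 * j by rewrite -[p^-1 * _ * _]mulrA mulrCA mulKf.
  rewrite mulrAC -rmorphM E1 rmorphM -mulrA; congr (_ * _).
  by apply: complex_ext; rewrite ?cRe_realM ?cIm_realM mulrC.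
apply: (@ccvg_near _ _ _ _ (fun n => _)).
  by near=> n; exact: esym (E n).
have -> : cexp (s * L0%:C + (r * l0)%:C) = (p^-1)%:C * (cexp (s * L0%:C + (r * l0)%:C) * p%:C).
  by rewrite mulrCA -rmorphM mulVf// mulr1.
apply: ccvgM; first exact: ccvg_cst.
split; [exact: Hr|exact: Hi].
Unshelve. all: by end_near.
Qed.

(** [n l] shifts of [s] lower [r] by [n l (p - 1)], which for [p = k/l] is the integer [n (k - l)];
    that many unit steps in [r] restore it. Only [s] has changed in the end. *)
Lemma mellin_gauss k l s r n : (0 < l)%N -> (l < k)%N -> p = k%:R / l%:R ->
  -1 < complex.Re s * p + r ->
  rising (s * p%:C + r%:C + 1) (n * k) * mellin s r =
  rising (s + 1) (n * l) * rising (s * (p - 1)%:C + r%:C + 1) (n * (k - l)) *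
  mellin (s + (n * l)%:R) r.
Proof.
move=> l0' lk pE A1.
have lR : l%:R != 0 :> R by rewrite pnatr_eq0 -lt0n.
have E : (n * (k - l))%:R = (n * l)%:R * (p - 1) :> R.
  by rewrite pE !natrM natrB ?(ltnW lk)//; field.
have -> : (n * k = n * l + n * (k - l))%N by rewrite -mulnDr subnKC// ltnW.
rewrite risingD mulrAC (mellin_iter_shift p1)// -[LHS]mulrA -[RHS]mulrA; congr (_ * _).
have := @mellin_iter_pred _ p p1 (s + (n * l)%:R) (r - (n * l)%:R * (p - 1)) (n * (k - l)).
have -> : r - (n * l)%:R * (p - 1) + (n * (k - l))%:R = r by rewrite E subrK.
have m0 : 0 <= (n * l)%:R :> R by [].
have A' : -1 < complex.Re (s + (n * l)%:R) * p + (r - (n * l)%:R * (p - 1)).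
  rewrite cReD cRe_nat; lra.
move=> /(_ A').
have -> : (s + (n * l)%:R) * p%:C + (r - (n * l)%:R * (p - 1))%:C + 1 =
    s * p%:C + r%:C + 1 + (n * l)%:R.
  by rewrite !natrC !rmorphD !rmorphN !rmorphM !rmorphD !rmorphN !rmorph1; ring.
have -> : (s + (n * l)%:R) * (p - 1)%:C + (r - (n * l)%:R * (p - 1))%:C + 1 =
    s * (p - 1)%:C + r%:C + 1.
  by rewrite !natrC !rmorphD !rmorphN !rmorphM !rmorphD !rmorphN !rmorph1; ring.
by move=> <-; rewrite [LHS]mulrC.
Qed.

(** Divide the iterated relation at [(s, r)] by the one at [(0, 0)], where [mellin] is 1: the
    factorials cancel and only Gauss products and the ratio of [mellin_ratio] remain. *)
Lemma mellin_cGammaV k l s r : (0 < l)%N -> (l < k)%N -> p = k%:R / l%:R ->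
  -1 < complex.Re s * p + r ->
  mellin s r * cGammaV (s * p%:C + r%:C + 1) =
  cGammaV (s + 1) * cGammaV (s * (p - 1)%:C + r%:C + 1).
Proof.
move=> l_gt0 lk pE A1; set a := s * p%:C + r%:C; set b := s * (p - 1)%:C + r%:C.
set G := cexp (s * L0%:C + (r * l0)%:C).
have k_gt0 : (0 < k)%N := leq_ltn_trans (leq0n _) lk.
have kl_gt0 : (0 < k - l)%N by rewrite subn_gt0.
have pos m : (0 < m)%N -> 0 < m%:R :> R by rewrite ltr0n.
have lnp : ln k%:R = ln p + ln l%:R.
  rewrite -lnM ?posrE ?pos// pE divfK// lt0r_neq0//; exact: pos.
have lnq : ln (k - l)%:R = ln (p - 1) + ln l%:R.
  rewrite -lnM ?posrE ?pos//; congr ln; rewrite natrB ?(ltnW lk)// pE.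
  field; rewrite lt0r_neq0//; exact: pos.
have E n : (0 < n)%N -> mellin s r * gauss a (n * k) =
   gauss s (n * l) * gauss b (n * (k - l)) *
   (G^-1 * (mellin (s + (n * l)%:R) r / mellin (n * l)%:R 0)).
  move=> n0.
  have := mellin_gauss n l_gt0 lk pE A1; rewrite -/a -/b !rising_gauss.
  have A0 : -1 < complex.Re 0 * p + 0 by rewrite /= mul0r addr0.
  have := mellin_gauss n l_gt0 lk pE A0; rewrite mellin00 mulr1 !mul0r !addr0 !add0r.
    rewrite !rising1.
  set M0 := mellin _ 0; set M1 := mellin (s + _) r => F0 F1.
  have fk : (n * k)`!%:R != 0 :> R[i] := factC_neq0 _.
  have fl : (n * l)`!%:R != 0 :> R[i] := factC_neq0 _.
  have fm : (n * (k - l))`!%:R != 0 :> R[i] := factC_neq0 _.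
  have M00 : M0 != 0 by apply/eqP => M0E; move: fk; rewrite F0 M0E mulr0 eqxx.
  (* Since [a = s + b], the powers of [n] and of [l] cancel; what is left of [k] and [k - l] are
     powers of [p] and [p - 1], and these make up [G]. *)
  have Gn : G^-1 * cexp (a * (ln (n * k)%:R)%:C) =
     cexp (s * (ln (n * l)%:R)%:C) * cexp (b * (ln (n * (k - l))%:R)%:C).
    rewrite -cexpN -!cexpD; congr cexp.
    rewrite !natrM !lnM ?posrE ?pos// lnp lnq /a /b /L0 /l0.
    rewrite !(rmorphD, rmorphN, rmorphM, rmorph1); ring.
  apply: (mulfI fk); apply: (mulfI (cexp_neq0 (a * (ln (n * k)%:R)%:C))).
  transitivity (gauss a (n * k) * (n * k)`!%:R * cexp (a * (ln (n * k)%:R)%:C) * mellin s r); first by ring.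
  rewrite F1.
  transitivity (gauss s (n * l) * gauss b (n * (k - l)) * (cexp (s * (ln (n * l)%:R)%:C) *
     cexp (b * (ln (n * (k - l))%:R)%:C)) * ((n * l)`!%:R * (n * (k - l))`!%:R) * M1); first by ring.
  rewrite -Gn F0.
  transitivity (gauss s (n * l) * gauss b (n * (k - l)) * (G^-1 * cexp (a * (ln (n * k)%:R)%:C)) *
    ((n * l)`!%:R * (n * (k - l))`!%:R) * M1 * (M0 * M0^-1)); last by ring.
  by rewrite mulfV// mulr1.
have H1 : ccvg \oo (fun n => mellin s r * gauss a (n * k)%N) (mellin s r * cGammaV (a + 1)).
  by apply: ccvgM; [exact: ccvg_cst|apply: (ccvg_muln k_gt0); exact: gauss_cGammaV].
apply: ccvg_unique H1 _.
apply: (@ccvg_near _ _ _ _ (fun n => gauss s (n * l)%N * gauss b (n * (k - l))%N *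
   (G^-1 * (mellin (s + (n * l)%:R) r / mellin (n * l)%:R 0)))).
  by near=> n; rewrite E//; near: n; exact: nbhs_infty_gt.
have -> : cGammaV (s + 1) * cGammaV (b + 1) = cGammaV (s + 1) * cGammaV (b + 1) * (G^-1 * G).
  by rewrite mulVf ?mulr1// cexp_neq0.
apply: ccvgM.
  by apply: ccvgM; [apply: (ccvg_muln l_gt0)|apply: (ccvg_muln kl_gt0)]; exact: gauss_cGammaV.
apply: ccvgM; first exact: ccvg_cst.
exact: (ccvg_muln l_gt0 (mellin_ratio A1)).
Unshelve. all: by end_near.
Qed.

(** The convergence condition makes the real part of the numerator's argument positive, so [psi] is
    the plain quotient here. *)
Lemma psi_mellin k l s r : (0 < l)%N -> (l < k)%N -> p = k%:R / l%:R ->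
  -1 < complex.Re s * p + r -> psi p r (s + 1) = mellin s r.
Proof.
move=> l_gt0 lk pE A1; have H := mellin_cGammaV l_gt0 lk pE A1.
have np : ~ Gamma_pole (s * p%:C + r%:C + 1).
  move=> [n] /(congr1 (@complex.Re _)); rewrite !cReD cReM cReN cRe_nat /= mulr0 subr0.
  have n0 : 0 <= n%:R :> R by [].
  by move=> ?; lra.
rewrite /psi addrK; case: asboolP => // _.
rewrite /psi_quotient addrK -H.
have V0 := cGammaV_neq0 np.
have V0E : cGammaV (s * p%:C + r%:C + 1) = (cGamma (s * p%:C + r%:C + 1))^-1.
  by rewrite /cGammaV; case: asboolP.
by rewrite mulrCA V0E mulfV ?mulr1// -invr_eq0 -V0E.
Qed.

End mellin_value.

(** * Determinacy of the moment problem *)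

Section step_polynomial.
Context {R : realType}.
Implicit Types x : R.

(* [2^(n^2+n) x^(n^2) = (2 (2x)^n)^n] tends to 0 if [x < 1/2] and to infinity
   otherwise; the extra [n] in the exponent settles the case [x = 1/2]. *)
Definition step n x : R := (1 - x ^+ (n * n)) ^+ (2 ^ (n * n + n)).

Lemma bernoulli_ge x k : 0 <= x <= 1 -> 1 - k%:R * x <= (1 - x) ^+ k.
Proof.
move=> /andP[x0 x1]; elim: k => [|k IH]; first by rewrite mul0r subr0 expr0.
rewrite exprS; apply: (@le_trans _ _ ((1 - x) * (1 - k%:R * x))).
  rewrite -[k.+1%:R]natr1; have k0 : 0 <= k%:R :> R by [].
  by move: (k%:R) k0 => y y0; nra.
by rewrite ler_wpM2l// subr_ge0.
Qed.

Lemma bernoulli_le x k : 0 <= x <= 1 -> (1 - x) ^+ k <= expR (- (k%:R * x)).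
Proof.
move=> /andP[x0 x1]; rewrite -mulrN expRM_natl lerXn2r ?nnegrE ?expR_ge0 ?subr_ge0//.
exact: expR_ge1Dx.
Qed.

Lemma step_itv n x : 0 <= x <= 1 -> 0 <= step n x <= 1.
Proof.
move=> /andP[x0 x1]; have xn : 0 <= 1 - x ^+ (n * n) <= 1.
  by rewrite subr_ge0 exprn_ile1//= gerBl exprn_ge0.
by rewrite exprn_ge0 ?exprn_ile1//; case/andP: xn.
Qed.

Lemma step_exponent n x : (2 ^ (n * n + n))%:R * x ^+ (n * n) = (2 * (2 * x) ^+ n) ^+ n.
Proof. by rewrite natrX exprD mulrAC -exprMn exprM mulrC -exprMn. Qed.

Lemma cvg_expr2V : (2^-1 : R) ^+ n @[n --> \oo] --> 0.
Proof. by apply: cvg_expr; rewrite ger0_norm; lra. Qed.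

(** Bernoulli's inequality bounds the distance to 1 by [(2 (2x)^n)^n], which is at most [2^-n] once
    [(2x)^n <= 1/4]. *)
Lemma step_cvg_lt x : 0 <= x < 2^-1 -> step n x @[n --> \oo] --> (1 : R).
Proof.
move=> /andP[x0 x2]; have x2' : `|2 * x| < 1 by rewrite ger0_norm; lra.
have H : 1 - (2^-1 : R) ^+ n @[n --> \oo] --> (1 : R).
  by rewrite -[X in _ --> X]subr0; apply: cvgB; [exact: cvg_cst|exact: cvg_expr2V].
apply: (squeeze_cvgr _ H (cvg_cst (1 : R))); near=> n.
have x01 : 0 <= x <= 1 by lra.
have /andP[_ ->] := step_itv n x01; rewrite andbT.
apply: le_trans (bernoulli_ge _ _); last by rewrite exprn_ge0 ?exprn_ile1//; lra.
rewrite step_exponent lerB// lerXn2r ?nnegrE ?invr_ge0//.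
  by rewrite mulr_ge0// exprn_ge0//; lra.
suff : (2 * x) ^+ n <= 4^-1 by lra.
near: n; have := cvg_expr x2' => /cvgrPdist_le /(_ 4^-1) /(_ _).
have i0 : 0 < 4^-1 :> R by rewrite invr_gt0.
move=> /(_ i0); apply: filterS => n; rewrite sub0r normrN.
exact: le_trans (ler_norm _).
Unshelve. all: by end_near.
Qed.

(** Here [(1 - u)^N <= exp(- N u)] with [N u >= 2^n], and [exp(- 2^n) <= 2^-n]. *)
Lemma step_cvg_ge x : 2^-1 <= x <= 1 -> step n x @[n --> \oo] --> (0 : R).
Proof.
move=> /andP[x2 x1].
apply: (squeeze_cvgr _ (cvg_cst 0) cvg_expr2V); near=> n.
have x01 : 0 <= x <= 1 by lra.
have /andP[-> _] := step_itv n x01 => /=.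
apply: le_trans (bernoulli_le _ _) _; first by rewrite exprn_ge0 ?exprn_ile1//; lra.
apply: (@le_trans _ _ (expR (- 2 ^+ n))); last first.
  rewrite expRN exprVn lef_pV2 ?posrE ?expR_gt0 ?exprn_gt0//.
  by apply: le_trans (expR_ge1Dx _); rewrite lerDr.
rewrite ler_expR lerN2 step_exponent lerXn2r ?nnegrE//.
  by rewrite mulr_ge0// exprn_ge0//; lra.
suff : 1 <= (2 * x) ^+ n by lra.
by apply: exprn_ege1; lra.
Unshelve. all: by end_near.
Qed.

End step_polynomial.

Section determinacy.
Context {R : realType}.
Notation mu := (@lebesgue_measure R).
Variable nu : probability (measurableTypeR R) R.
Variables (a b c m : R) (X w : R -> R).
Notation D := (`]a, b[%classic : set R).
Hypothesis X_continuous : {in `]a, b[, continuous X}.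
Hypothesis X_itv : {in `]a, b[, forall x, 0 <= X x <= c}.
Hypothesis w_ge0 : {in `]a, b[, forall x, 0 <= w x}.
Hypothesis w_integrable : mu.-integrable D (EFin \o w).
Hypothesis m0 : 0 <= m.
Hypothesis c0 : 0 < c.
Hypothesis nu_integrable : forall n, nu.-integrable setT (fun x => (x ^+ n)%:E).
Hypothesis nu_moment : forall n, \int[nu]_x (x ^+ n) =
  m * 0 ^+ n + \int[mu]_(x in D) (X x ^+ n * w x).

Let mX : measurable_fun D X. Proof. exact: oo_continuous_measurable. Qed.

Let integrable_Xw n : mu.-integrable D (EFin \o (fun x => X x ^+ n * w x)).
Proof.
have mw : measurable_fun D w by have /integrableP[/measurable_EFinP] := w_integrable.
apply: (@le_integrable _ _ R mu D _ _ (EFin \o (fun x => c ^+ n * w x))) => //.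
- apply/measurable_EFinP; apply: measurable_funM => //; exact: measurable_funX.
- move=> x xD /=; rewrite lee_fin !normrM ler_wpM2r// !ger0_norm ?exprn_ge0 ?(ltW c0)//.
    by apply: lerXn2r; rewrite ?nnegrE ?(ltW c0)//; case/andP: (X_itv xD).
  by case/andP: (X_itv xD).
- exact: integrable_realZ.
Qed.

Let total := m + \int[mu]_(x in D) w x.

Lemma moment_le n : \int[nu]_x (x ^+ n.+1) <= c ^+ n.+1 * total.
Proof.
rewrite nu_moment expr0n /= mulr0 add0r /total mulrDr.
apply: (@le_trans _ _ (c ^+ n.+1 * \int[mu]_(x in D) w x)); last first.
  by rewrite lerDr mulr_ge0// exprn_ge0// ltW.
rewrite -RintegralZl//; apply: le_Rintegral => //; first exact: integrable_realZ.
move=> x xD; rewrite ler_wpM2r ?w_ge0//.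
by apply: lerXn2r; rewrite ?nnegrE ?(ltW c0)//; case/andP: (X_itv xD).
Qed.

Let far : set R := [set x | c + 1 <= `|x|].

Let mfar : measurable (far : set (measurableTypeR R)).
Proof.
rewrite (_ : far = (fun x : R => `|x|) @^-1` `[c + 1, +oo[); last first.
  by apply/seteqP; split => x /=; rewrite in_itv /= andbT.
by rewrite -[X in measurable X]setTI; exact: normr_measurable.
Qed.

(** Markov's inequality with even powers, since [x] may be negative: the mass is at most a constant
    times [(c / (c + 1))^(2n+2)] for every [n]. *)
Lemma nu_far : nu far = 0%E.
Proof.
have fin := fin_num_measure nu _ mfar.
have integrable_indic_far : nu.-integrable setT (EFin \o (\1_far : R -> R)).
  exact: integrable_indic.
have le n : (c + 1) ^+ n.*2.+2 * fine (nu far) <= c ^+ n.*2.+2 * total.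
  apply: le_trans (moment_le n.*2.+1).
  have i1 : nu.-integrable setT (EFin \o (fun x => (c + 1) ^+ n.*2.+2 * \1_far x)).
    by apply: integrable_realZ => //; apply: integrable_indic_far.
  have -> : fine (nu far) = \int[nu]_x (\1_far x).
    by rewrite /Rintegral integral_indic// setIT.
  rewrite -RintegralZl//.
  apply: le_Rintegral => //; first exact: nu_integrable.
  move=> x _; rewrite indicE.
  have x2 : 0 <= x ^+ n.*2.+2 by rewrite -doubleS -mul2n exprM exprn_ge0// sqr_ge0.
  case: (boolP (x \in far)) => [|_]; last by rewrite mulr0.
  rewrite inE /far /= mulr1 => cx.
  rewrite -[leRHS]ger0_norm// normrX; apply: lerXn2r; rewrite ?nnegrE//.
  by rewrite addr_ge0// ltW.
have le' n : fine (nu far) <= (c / (c + 1)) ^+ n.*2.+2 * total.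
  have cn : 0 < (c + 1) ^+ n.*2.+2 by rewrite exprn_gt0// addr_gt0.
  by rewrite expr_div_n mulrAC ler_pdivlMr// mulrC.
have le0 : fine (nu far) <= 0.
  have H : (c / (c + 1)) ^+ n @[n --> \oo] --> 0.
    apply: cvg_expr; rewrite ger0_norm ?divr_ge0 ?addr_ge0 ?(ltW c0)//.
    by rewrite ltr_pdivrMr ?addr_gt0// mul1r ltrDl.
  have H2 : (c / (c + 1)) ^+ n.*2.+2 * total @[n --> \oo] --> 0 * total.
    apply: cvgM; last exact: cvg_cst.
    apply: (cvg_comp _ _ _ H); apply/cvgnyPge => A; near=> n.
    by rewrite -addnn -addn2 -addnA; apply: leq_trans (leq_addr _ _); near: n; exact: nbhs_infty_ge.
  rewrite mul0r in H2; apply: (cvgr_to_ge H2); exact: nearW.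
apply/eqP; rewrite eq_le measure_ge0 andbT -[nu far]fineK// lee_fin//.
Unshelve. all: by end_near.
Qed.

Lemma integral_horner (p : {poly R}) :
  [/\ nu.-integrable setT (EFin \o (fun x => p.[x])),
   mu.-integrable D (EFin \o (fun x => p.[X x] * w x)) &
   \int[nu]_x p.[x] = m * p.[0] + \int[mu]_(x in D) (p.[X x] * w x)].
Proof.
pose q n (x : R) := \sum_(i < n) p`_i * x ^+ i.
suff H n : [/\ nu.-integrable setT (EFin \o q n),
   mu.-integrable D (EFin \o (fun x => q n (X x) * w x)) &
   \int[nu]_x (q n x) = m * q n 0 + \int[mu]_(x in D) (q n (X x) * w x)].
  have E x : p.[x] = q (size p) x by rewrite horner_coef.
  have [h1 h2 h3] := H (size p); split.
  - by under eq_fun do rewrite E.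
  - rewrite (_ : (fun x => _) = (fun x => q (size p) (X x) * w x))//.
    by apply/funext => x; rewrite E.
  - by under eq_Rintegral do rewrite E; rewrite h3 E; under [in RHS]eq_Rintegral do rewrite E.
elim: n => [|n [h1 h2 h3]].
  have E x : q 0%N x = 0 by rewrite /q big_ord0.
  split; rewrite ?E ?mulr0 ?add0r.
  - by rewrite (_ : EFin \o q 0%N = cst 0%E) ?integrable0//; apply/funext => x; rewrite /= E.
  - rewrite (_ : EFin \o _ = cst 0%E) ?integrable0//.
    by apply/funext => x; rewrite /= E mul0r.
  - under eq_Rintegral do rewrite E; under [in RHS]eq_Rintegral do rewrite E mul0r.
    by rewrite !Rintegral_cst// !mul0r.
have E x : q n.+1 x = q n x + p`_n * x ^+ n by rewrite /q big_ord_recr.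
have Ew x : q n.+1 (X x) * w x = q n (X x) * w x + p`_n * (X x ^+ n * w x).
  by rewrite E mulrDl mulrA.
have i1 : nu.-integrable setT (EFin \o (fun x => p`_n * x ^+ n)).
  by apply: integrable_realZ => //; exact: nu_integrable.
have i2 : mu.-integrable D (EFin \o (fun x => p`_n * (X x ^+ n * w x))).
  exact: integrable_realZ.
split.
- by rewrite (_ : q n.+1 = fun x => q n x + p`_n * x ^+ n); [exact: integrable_realD|exact/funext].
- rewrite (_ : (fun x => _) = fun x => q n (X x) * w x + p`_n * (X x ^+ n * w x)); last exact/funext.
  exact: integrable_realD.
- under eq_Rintegral do rewrite E; under [in RHS]eq_Rintegral do rewrite Ew.
  rewrite RintegralD// RintegralD// RintegralZl//; last exact: nu_integrable.
  rewrite RintegralZl// h3 nu_moment E.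
  by move: (Rintegral _ _ _) (Rintegral _ _ _) => u v; ring.
Qed.

(** The polynomials [step n] composed with an affine map converge pointwise to the indicator of
    [x < t] and stay in [[0, 1]] on the support. Equality of polynomial integrals then passes to the
    limit on both sides by dominated convergence. *)
Lemma nu_ray (t : R) : nu (`]-oo, t[%classic : set R) =
  (m * (0 < t)%R%:R + \int[mu]_(x in D `&` [set x | X x < t]) w x)%:E.
Proof.
have mem_ray x : (x \in (`]-oo, t[%classic : set R)) = (x < t).
  by apply/idP/idP; rewrite inE /= in_itv.
have fine_lim (u : nat -> \bar R) l : l \is a fin_num -> u @ \oo --> l ->
    fine (u n) @[n --> \oo] --> fine l.
  by move=> /fineK <- /fine_cvg.
(* [K] bounds [|x - t|] for [|x| < c + 1], so [h] maps that range into [[0, 1]] and sends [t] to the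
   jump 1/2. *)
pose K := c + 1 + `|t|; have K0 : 0 < K by rewrite /K ltr_pwDl// addr_gt0.
pose h (x : R) := 2^-1 + (x - t) / (2 * K).
have h01 x : `|x| < c + 1 -> 0 <= h x <= 1.
  move=> xc; have : `|(x - t) / (2 * K)| <= 2^-1.
    rewrite normrM normfV [`|2 * K|]ger0_norm ?mulr_ge0 ?(ltW K0)// ler_pdivrMr ?mulr_gt0//.
    rewrite mulrA mulVf ?mul1r//; apply: le_trans (ler_normB _ _) _.
    by rewrite lerD2r ltW.
  by rewrite ler_norml /h; lra.
have hlt x : (h x < 2^-1) = (x < t).
  by rewrite /h gtrDl pmulr_llt0 ?invr_gt0 ?mulr_gt0// subr_lt0.
have hcvg x : `|x| < c + 1 -> step n (h x) @[n --> \oo] --> ((x < t)%R%:R : R).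
  move=> /h01 /andP[h0 h1]; case: ltP => xt; last first.
    by apply: step_cvg_ge; rewrite h1 andbT leNgt hlt -leNgt.
  by apply: step_cvg_lt; rewrite h0 hlt.
pose hp : {poly R} := (2^-1)%:P + ('X - t%:P) * ((2 * K)^-1)%:P.
pose sp n : {poly R} := (1 - hp ^+ (n * n)) ^+ (2 ^ (n * n + n)).
have spE n x : (sp n).[x] = step n (h x).
  by rewrite /sp /hp /step /h !(horner_exp, hornerE).
have c1 : 0 < c + 1 by rewrite addr_gt0.
have Xc x : x \in `]a, b[ -> `|X x| < c + 1.
  by move=> /X_itv /andP[X0 Xc]; rewrite ger0_norm//; apply: le_lt_trans Xc _; rewrite ltrDl.
have mw : measurable_fun D w by have /integrableP[/measurable_EFinP] := w_integrable.
have N : fine (nu `]-oo, t[%classic) = m * (0 < t)%R%:R +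
    \int[mu]_(x in D) ((X x < t)%R%:R * w x); last first.
  rewrite -[LHS]fineK ?N; last first.
    by apply: fin_num_measure; exact: measurable_itv.
  congr (_ + _)%:E; rewrite /Rintegral; congr fine.
  rewrite integral_mkcondr; apply: eq_integral => x _; rewrite patchE.
  case: (boolP (X x < t)) => h1; first by rewrite mem_set//= mul1r.
  by rewrite memNset/= ?mul0r//; exact/negP.
have L1 : \int[nu]_x (sp n).[x] @[n --> \oo] --> fine (nu `]-oo, t[%classic).
  have [] := @dominated_convergence _ (measurableTypeR R) R nu setT measurableT
    (fun n x => ((sp n).[x])%:E) (fun x => (\1_(`]-oo, t[%classic : set R) x)%:E) (cst 1%:E).
  - move=> n; have [+ _ _] := integral_horner (sp n); exact: measurable_int.
  - by apply/measurable_EFinP; exact: measurable_indic.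
  (* Nothing is known about the polynomials outside the bounded range, but that set is null for
     [nu]. *)
  - exists far; split => //; first exact: nu_far.
    move=> x /= xf; rewrite /far /=; rewrite leNgt; apply/negP => xc; apply: xf => _.
    apply: cvg_EFin; first exact: nearW.
    rewrite indicE; under eq_fun do rewrite /= spE.
    by rewrite mem_ray; exact: hcvg.
  - by apply: finite_measure_integrable_cst.
  - exists far; split => //; first exact: nu_far.
    move=> x /= xf; rewrite /far /=; rewrite leNgt; apply/negP => xc; apply: xf => n _.
    rewrite spE lee_fin; have /andP[s0 s1] := step_itv n (h01 _ xc).
    by rewrite ger0_norm.
  move=> _ _; rewrite integral_indic// setIT => H; apply: fine_lim H; exact: fin_num_measure.
have L2 : \int[mu]_(x in D) ((sp n).[X x] * w x) @[n --> \oo] -->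
    \int[mu]_(x in D) ((X x < t)%R%:R * w x).
  have [] := @dominated_convergence _ _ R mu D (measurable_itv _)
    (fun n x => ((sp n).[X x] * w x)%:E) (fun x => ((X x < t)%R%:R * w x)%:E) (EFin \o w).
  - move=> n; have [_ + _] := integral_horner (sp n); exact: measurable_int.
  - apply/measurable_EFinP; apply: measurable_funM => //.
    rewrite (_ : (fun x => _) = (\1_(`]-oo, t[%classic : set R) : R -> R) \o X).
      by apply: measurableT_comp => //; exact: measurable_indic.
    by apply/funext => x; rewrite /= indicE mem_ray.
  - apply: aeW => x xD; apply: cvg_EFin; first exact: nearW.
    apply: cvgM; last exact: cvg_cst.
    under eq_fun do rewrite spE; exact: (hcvg _ (Xc _ xD)).
  - exact: w_integrable.
  - apply: aeW => x n xD /=; rewrite lee_fin spE normrM [`|w x|]ger0_norm ?w_ge0//.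
    rewrite ler_piMl ?w_ge0//; have /andP[s0 s1] := step_itv n (h01 _ (Xc _ xD)).
    by rewrite ger0_norm.
  by move=> i _ H; apply: fine_lim H; exact: integrable_fin_num.
have L3 : m * (sp n).[0] + \int[mu]_(x in D) ((sp n).[X x] * w x) @[n --> \oo] -->
    m * (0 < t)%R%:R + \int[mu]_(x in D) ((X x < t)%R%:R * w x).
  apply: cvgD; last exact: L2.
  apply: cvgM; first exact: cvg_cst.
  by under eq_fun do rewrite spE; apply: hcvg; rewrite normr0.
have E : (fun n => \int[nu]_x (sp n).[x]) =
    (fun n => m * (sp n).[0] + \int[mu]_(x in D) ((sp n).[X x] * w x)).
  by apply/funext => n; have [_ _ ->] := integral_horner (sp n).
by rewrite E in L1; exact: (cvg_unique _ L1 L3).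
Qed.

End determinacy.

(** * Change of variables and density *)

Section decreasing_bijection.
Context {R : realType}.
Notation mu := (@lebesgue_measure R).
Variables (a b c : R) (X dX : R -> R).
Hypothesis ab : a < b.
Hypothesis dX_continuous : {in `]a, b[, continuous dX}.
Hypothesis is_derive_X : {in `]a, b[, forall x : R, is_derive x (1 : R) X (- dX x)}.
Hypothesis X_decreasing : {in `]a, b[ &, {homo X : x y /~ x < y}}.
Hypothesis X_cvga : X x @[x --> a^'+] --> c.
Hypothesis X_cvgb : X x @[x --> b^'-] --> 0.

Lemma X_continuous : {in `]a, b[, continuous X}.
Proof. by move=> x xab; exact: is_derive_continuous (is_derive_X xab). Qed.

Lemma X_itv : {in `]a, b[, forall x, 0 < X x < c}.
Proof.
move=> x; rewrite in_itv /= => /andP[ax xb].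
have xab : x \in `]a, b[ by rewrite in_itv /= ax.
apply/andP; split.
  have x2 : (x + b) / 2 \in `]a, b[ by rewrite in_itv /=; lra.
  apply: (@le_lt_trans _ _ (X ((x + b) / 2))); last by apply: X_decreasing => //; lra.
  apply: (cvgr_to_le X_cvgb); near=> y; apply: ltW; apply: X_decreasing => //.
    rewrite in_itv /=; apply/andP; split; last by near: y; exact: nbhs_left_lt.
    by near: y; exact: nbhs_left_gt.
  by near: y; apply: nbhs_left_gt; lra.
have x2 : (a + x) / 2 \in `]a, b[ by rewrite in_itv /=; lra.
apply: (@lt_le_trans _ _ (X ((a + x) / 2))); first by apply: X_decreasing => //; lra.
apply: (cvgr_to_ge X_cvga); near=> y; apply: ltW; apply: X_decreasing => //.
  rewrite in_itv /=; apply/andP; split; first by near: y; exact: nbhs_right_gt.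
  by near: y; exact: nbhs_right_lt.
by near: y; apply: nbhs_right_lt; lra.
Unshelve. all: by end_near.
Qed.

Lemma X_lt : {in `]a, b[ &, forall x y, (X x < X y) = (y < x)}.
Proof.
move=> x y xab yab; apply/idP/idP => [|yx]; last exact: X_decreasing.
rewrite !ltNge; apply: contra; rewrite le_eqVlt => /predU1P[->//|xy].
by apply: ltW; exact: X_decreasing.
Qed.

Lemma X_near y : y \in `]0, c[ -> exists x1 x2, [/\ x1 \in `]a, b[, x2 \in `]a, b[, y < X x1 & X x2 < y].
Proof.
rewrite in_itv /= => /andP[y0 yc].
have [x1 [x1D yx1]] : exists x1, (x1 \in `]a, b[) /\ y < X x1.
  have : \forall x \near a^'+, (x \in `]a, b[) /\ y < X x.
    near=> x; split.
      rewrite in_itv /=; apply/andP; split; first by near: x; exact: nbhs_right_gt.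
      by near: x; exact: nbhs_right_lt.
    by near: x; exact: (cvgr_gt c X_cvga).
  exact: filter_ex.
have [x2 [x2D yx2]] : exists x2, (x2 \in `]a, b[) /\ X x2 < y.
  have : \forall x \near b^'-, (x \in `]a, b[) /\ X x < y.
    near=> x; split.
      rewrite in_itv /=; apply/andP; split; first by near: x; exact: nbhs_left_gt.
      by near: x; exact: nbhs_left_lt.
    by near: x; exact: (cvgr_lt 0 X_cvgb).
  exact: filter_ex.
by exists x1, x2.
Unshelve. all: by end_near.
Qed.

Lemma X_surj y : y \in `]0, c[ -> exists x, (x \in `]a, b[) /\ X x = y.
Proof.
move=> yc; have [x1 [x2 [x1D x2D yx1 yx2]]] := X_near yc.
have x12 : x1 < x2 by rewrite -X_lt// (lt_trans yx2).
have sub : `[x1, x2] `<=` `]a, b[.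
  move=> z /=; move: x1D x2D; rewrite !in_itv /= => /andP[h1 h2] /andP[h3 h4] /andP[h5 h6].
  by rewrite (lt_le_trans h1 h5) (le_lt_trans h6 h4).
have [|z zx <-] := @IVT R X x1 x2 y (ltW x12) (in_continuous_within X_continuous sub).
  by rewrite ge_min le_max (ltW yx2) (ltW yx1) orbT.
by exists z; split => //; exact: sub.
Qed.

(* Junk value [a] outside [`]0, c[]. *)
Definition Xinv y : R := xget a [set x | (x \in `]a, b[) /\ X x = y].

Lemma XinvP y : y \in `]0, c[ -> (Xinv y \in `]a, b[) /\ X (Xinv y) = y.
Proof. by move=> /X_surj[x [xD xy]]; rewrite /Xinv; case: xgetP => [z _ //|/(_ x)]; case. Qed.

Lemma XinvK : {in `]a, b[, cancel X Xinv}.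
Proof.
move=> x xD; have /XinvP[yD XE] : X x \in `]0, c[ by rewrite in_itv /= X_itv.
by apply/eqP; rewrite eq_le !leNgt -(X_lt xD yD) -(X_lt yD xD) XE ltxx.
Qed.

Lemma continuous_Xinv : {in `]0, c[, continuous Xinv}.
Proof.
move=> y yc; have [xD XE] := XinvP yc.
apply/cvgrPdist_lt => e e0; move: (xD); rewrite in_itv /= => /andP[ax xb].
set x := Xinv y in xD XE ax xb *.
(* Two points of []a, b[] on either side of [x], within [e] of it; their images bracket [y]
   strictly. *)
pose x1 := Num.max ((a + x) / 2) (x - e / 2); pose x2 := Num.min ((x + b) / 2) (x + e / 2).
have x1x : x1 < x by rewrite /x1 gt_max; apply/andP; split; lra.
have xx2 : x < x2 by rewrite /x2 lt_min; apply/andP; split; lra.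
have ax1 : a < x1 by rewrite /x1 lt_max; apply/orP; left; lra.
have x2b : x2 < b by rewrite /x2 gt_min; apply/orP; left; lra.
have ex1 : x - e < x1 by rewrite /x1 lt_max; apply/orP; right; lra.
have ex2 : x2 < x + e by rewrite /x2 gt_min; apply/orP; right; lra.
have x1D : x1 \in `]a, b[ by rewrite in_itv /= ax1 (lt_trans x1x).
have x2D : x2 \in `]a, b[ by rewrite in_itv /= x2b (lt_trans ax).
near=> z.
have zc : z \in `]0, c[ by near: z; exact: near_in_itvoo.
have [zD ZE] := XinvP zc.
have h1 : x1 < Xinv z.
  rewrite -X_lt// ZE; near: z; apply: (@cvgr_lt _ _ _ _ _ y) => //.
  by rewrite -XE X_lt.
have h2 : Xinv z < x2.
  rewrite -X_lt// ZE; near: z; apply: (@cvgr_gt _ _ _ _ _ y) => //.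
  by rewrite -XE X_lt.
by rewrite ltr_norml; apply/andP; split; lra.
Unshelve. all: by end_near.
Qed.

(** [X'] may degenerate at the ends, so the substitution is made on segments and both sides increase
    to the integrals over the open intervals. *)
Lemma substitution_decreasing_oo (w W : R -> R) :
  {in `]0, c[, continuous W} -> {in `]0, c[, forall y, 0 <= W y} ->
  {in `]a, b[, continuous w} -> {in `]a, b[, forall x, 0 <= w x} ->
  {in `]a, b[, forall x, W (X x) * dX x = w x} ->
  (\int[mu]_(y in `]0%R, c[) (W y)%:E = \int[mu]_(x in `]a, b[) (w x)%:E)%E.
Proof.
move=> cW W0 cw w0 wE.
pose aa n := a + exhaust_gap a b n; pose bb n := b - exhaust_gap a b n.
have aabb n : aa n < bb n by exact: exhaust_gap_lt.
have aaD n : aa n \in `]a, b[.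
  by apply: (@exhaust_sub _ a b n ab); rewrite /exhaust /= in_itv /= lexx ltW// aabb.
have bbD n : bb n \in `]a, b[.
  by apply: (@exhaust_sub _ a b n ab); rewrite /exhaust /= in_itv /= lexx ltW// aabb.
pose F n : set R := `[X (bb n), X (aa n)]%classic.
have FD n : F n `<=` `]0, c[.
  move=> y; rewrite /F /= !in_itv /= => /andP[h1 h2].
  have /andP[h3 _] := X_itv (bbD n); have /andP[_ h4] := X_itv (aaD n).
  by rewrite (lt_le_trans h3 h1) (le_lt_trans h2 h4).
have XleD : {in `]a, b[ &, forall x y, x <= y -> X y <= X x}.
  by move=> x y xD yD; rewrite !leNgt; apply: contra; rewrite X_lt.
have gap_le m n : (m <= n)%N -> exhaust_gap a b n <= exhaust_gap a b m.
  by move=> mn; rewrite ler_wpM2l ?subr_ge0 ?(ltW ab)// lef_pV2 ?posrE// ler_nat.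
have Fnd : nondecreasing_seq F.
  move=> m n mn; rewrite subsetEset => y; rewrite /F /= !in_itv /= => /andP[h1 h2].
  apply/andP; split.
    by apply: le_trans h1; apply: XleD => //; rewrite lerD2l lerN2 gap_le.
  by apply: (le_trans h2); apply: XleD => //; rewrite lerD2l gap_le.
have Fcup : \bigcup_n F n = `]0, c[%classic.
  apply/seteqP; split => [y [n _]|y yc]; first exact: FD.
  have [x1 [x2 [x1D x2D yx1 yx2]]] := X_near yc.
  have [n [h1 h2]] : exists n, exhaust a b n x1 /\ exhaust a b n x2.
    have n1 := near_exhaust x1D; have n2 := near_exhaust x2D.
    exact: filter_ex (filterI n1 n2).
  exists n => //; rewrite /F /= in_itv /=; move: h1 h2; rewrite /exhaust /= !in_itv /=.
  move=> /andP[h1 _] /andP[_ h2]; apply/andP; split.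
    by apply: (le_trans _ (ltW yx2)); exact: XleD.
  by apply: (le_trans (ltW yx1)); exact: XleD.
have mW := oo_continuous_measurable cW; have mw := oo_continuous_measurable cw.
have int n : (\int[mu]_(y in F n) (W y)%:E = \int[mu]_(x in exhaust a b n) (w x)%:E)%E.
  have sub : `[aa n, bb n] `<=` `]a, b[ by exact: exhaust_sub.
  have sub' x : x \in `]aa n, bb n[ -> x \in `]a, b[.
    by move=> /subset_itv_oo_cc; exact: sub.
  have dXE x : x \in `]a, b[ -> derive1 X x = - dX x.
    by move=> xD; have [_] := is_derive_X xD; rewrite derive1E.
  have near_dXE x : x \in `]a, b[ -> {near x, - dX =1 derive1 X}.
    move=> xD; near=> z; rewrite dXE//; near: z; exact: near_in_itvoo.
  have cdX x : x \in `]a, b[ -> derive1 X z @[z --> x] --> - dX x.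
    move=> xD; apply: cvg_trans (near_eq_cvg (near_dXE _ xD)) _.
    by apply: cvgN; exact: dX_continuous.
  rewrite (@integration_by_substitution_decreasing _ X W (aa n) (bb n)) ?(ltW (aabb n))//.
  - apply: eq_integral => x; rewrite inE => xn.
    transitivity (W (X x) * - derive1 X x)%:E => //.
    by rewrite dXE ?opprK ?wE//; exact: sub.
  - by move=> x y xn yn; apply: X_decreasing; exact: sub.
  - by move=> x /sub' xD; rewrite /continuous_at dXE//; exact: cdX.
  - by apply/cvg_ex; exists (- dX (aa n)); apply: cvg_at_right_filter; exact: cdX.
  - by apply/cvg_ex; exists (- dX (bb n)); apply: cvg_at_left_filter; exact: cdX.
  - split.
    + by move=> x /sub' xD; have [] := is_derive_X xD.
    + by apply: cvg_at_right_filter; exact: X_continuous.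
    + by apply: cvg_at_left_filter; exact: X_continuous.
  - by apply: in_continuous_within cW _; exact: FD.
have H1 : (fun n => \int[mu]_(y in F n) (W y)%:E)%E @ \oo --> (\int[mu]_(y in `]0%R, c[) (W y)%:E)%E.
  rewrite -Fcup; apply: ge0_nondecreasing_set_cvg_integral => //.
  - by move=> n; exact: measurable_itv.
  - by move=> n; apply/measurable_EFinP; apply: measurable_funS mW => //; exact: FD.
  - by move=> n y /FD yc; rewrite lee_fin W0.
have H2 : (fun n => \int[mu]_(x in exhaust a b n) (w x)%:E)%E @ \oo --> (\int[mu]_(x in `]a, b[) (w x)%:E)%E.
  rewrite -(bigcup_exhaust ab); apply: ge0_nondecreasing_set_cvg_integral => //.
  - exact: exhaust_nondecreasing.
  - by move=> n; exact: measurable_itv.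
  - by move=> n; apply/measurable_EFinP; apply: measurable_funS mw => //; exact: exhaust_sub.
  - by move=> n x /(exhaust_sub ab) xD; rewrite lee_fin w0.
move: H1; under eq_fun do rewrite int.
by move=> H1; apply: (cvg_unique _ H1 H2).
Unshelve. all: by end_near.
Qed.

End decreasing_bijection.

Section density_measure.
Context {R : realType}.
Notation mu := (@lebesgue_measure R).
Variables (m c : R) (f : R -> R).
Hypothesis m0 : 0 <= m.
Hypothesis f_continuous : {in `]0, c[, continuous f}.
Hypothesis f_ge0 : {in `]0, c[, forall x, 0 <= f x}.

Let g : R -> \bar R := (EFin \o f) \_ (`]0, c[%classic).

Let mg : measurable_fun setT g.
Proof.
apply/(measurable_restrictT _ _).1; first exact: measurable_itv.
by apply/measurable_EFinP; exact: oo_continuous_measurable.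
Qed.

Let g0 x : (0 <= g x)%E.
Proof. by rewrite /g patchE; case: ifPn => //; rewrite inE => xc; rewrite lee_fin f_ge0. Qed.

(** Built as a measure so that agreement with [nu] on the rays []-oo, t[], which are stable under
    intersection, extends to all Borel sets. *)
Definition atom_density (A : set (measurableTypeR R)) : \bar R :=
  (mscale (NngNum m0) (\d_(0%R : R)) A + \int[mu]_(x in A) g x)%E.

Let atom_density0 : atom_density set0 = 0%E.
Proof. by rewrite /atom_density measure0 integral_set0 adde0. Qed.

Let atom_density_ge0 A : (0 <= atom_density A)%E.
Proof. by rewrite adde_ge0// integral_ge0. Qed.

Let atom_density_additive : semi_sigma_additive atom_density.
Proof.
move=> F mF tF mUF; rewrite /atom_density; under eq_fun do rewrite big_split.
apply: cvgeD => //=.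
- exact: measure_semi_sigma_additive.
- exact: semi_sigma_additive_nng_induced.
Qed.

HB.instance Definition _ := isMeasure.Build _ _ _ atom_density
  atom_density0 atom_density_ge0 atom_density_additive.

Lemma atom_densityE A : atom_density A =
  (m%:E * \d_(0%R : R) A + \int[mu]_(x in A `&` `]0%R, c[) (f x)%:E)%E.
Proof. by rewrite /atom_density integral_mkcondr. Qed.

Lemma density_of_rays (nu : probability (measurableTypeR R) R) :
  (forall t, nu (`]-oo, t[%classic : set R) = atom_density `]-oo, t[%classic) ->
  forall A : set R, measurable A -> nu A = atom_density A.
Proof.
move=> H A mA.
have sA : (@RGenInftyO.G R).-sigma.-measurable A by rewrite -RGenInftyO.measurableE.
have U := @g_sigma_algebra_measure_unique _ R (measurableTypeR R) (@RGenInftyO.G R) _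
  (fun n => `]-oo, n%:R[%classic) _ _ nu atom_density.
apply: U sA => //.
- by move=> B [x ->]; exact: measurable_itv.
- by move=> n; exists n%:R.
- apply/seteqP; split => // x _; exists (Num.truncn `|x|).+1 => //=.
  by rewrite in_itv /=; apply: le_lt_trans (ler_norm x) _; exact: truncnS_gt.
- move=> B C [x ->] [y ->]; exists (Num.min x y).
  by apply/seteqP; split => z /=; rewrite !in_itv /= lt_min => /andP.
- by move=> B [x ->]; exact: H.
- move=> n; apply: le_lt_trans (ltry 1); apply: probability_le1; exact: measurable_itv.
Qed.

End density_measure.

(** * The density of nu(p, r) *)

Section nu_density.
Context {R : realType}.
Notation mu := (@lebesgue_measure R).
Implicit Types (x y r : R).
Variable p : R.
Hypothesis p1 : 1 < p.
Let p0 : 0 < p. Proof. exact: lt_trans p1. Qed.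
Let q0 : 0 < p - 1. Proof. by rewrite subr_gt0. Qed.
Notation tip := (tip p).
Notation logx := (logx p).
Notation logR := (logR p).
Notation dlogx := (dlogx p).
Notation weight := (weight p).
Notation mellin := (mellin p).
Notation D := (`]0, tip[%classic : set R).

Lemma Re_cint (A : set R) (f : R -> R[i]) :
  complex.Re (cint A f) = \int[mu]_(x in A) complex.Re (f x).
Proof. by []. Qed.

Definition xcurve x : R := expR (logx x).
Definition xspeed x : R := xcurve x * dlogx x.
Definition wcurve r x : R := pi^-1 * (expR (r * logR x) * weight r x).
Definition xinv : R -> R := Xinv 0 tip xcurve.
(** Density at [y] of the image under [X] of [wcurve r]: the weight divided by the speed [- X'] at
    the unique preimage. *)
Definition dens r y : R := wcurve r (xinv y) / xspeed (xinv y).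

Lemma cpE : cp p = expR (p * ln p - (p - 1) * ln (p - 1)).
Proof.
rewrite /cp /powR !gt_eqF// -expRD; congr expR; ring.
Qed.

Lemma cp_gt0 : 0 < cp p. Proof. by rewrite cpE expR_gt0. Qed.

Lemma is_derive_xcurve : {in `]0, tip[, forall x : R, is_derive x (1 : R) xcurve (- xspeed x)}.
Proof.
move=> x xD; rewrite /xspeed -mulrN; apply: is_derive_expR_comp.
exact: is_derive_logx.
Qed.

Lemma xcurve_decreasing : {in `]0, tip[ &, {homo xcurve : x y /~ x < y}}.
Proof. by move=> x y xD yD xy; rewrite ltr_expR; exact: logx_decreasing. Qed.

Lemma xcurve_cvg0 : xcurve x @[x --> 0^'+] --> cp p.
Proof. by rewrite cpE; exact: cvg_comp (logx_cvg0 p1) (@continuous_expR R _). Qed.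

Lemma xcurve_cvg_tip : xcurve x @[x --> tip^'-] --> 0.
Proof.
have -> : xcurve = kmod p 1 0 by apply/funext => x; rewrite /xcurve /kmod mul1r mul0r addr0.
by apply: kmod_cvg_tip => //; rewrite mul1r addr0.
Qed.

Lemma xcurve_itv : {in `]0, tip[, forall x, 0 < xcurve x < cp p}.
Proof. exact: X_itv (tip_gt0 p1) xcurve_decreasing xcurve_cvg0 xcurve_cvg_tip. Qed.

Lemma continuous_xcurve : {in `]0, tip[, continuous xcurve}.
Proof. by move=> x xD; exact: is_derive_continuous (is_derive_xcurve xD). Qed.

Lemma continuous_xspeed : {in `]0, tip[, continuous xspeed}.
Proof. by move=> x xD; apply: cvgM; [exact: continuous_xcurve|exact: continuous_dlogx]. Qed.

Lemma xspeed_gt0 : {in `]0, tip[, forall x, 0 < xspeed x}.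
Proof. by move=> x xD; rewrite mulr_gt0 ?expR_gt0// dlogx_gt0. Qed.

Lemma continuous_wcurve r : {in `]0, tip[, continuous (wcurve r)}.
Proof.
move=> x xD; apply: cvgM; first exact: cvg_cst.
apply: cvgM; last exact: continuous_weight.
apply: (@continuous_comp _ _ _ (fun x => r * logR x) expR); last exact: continuous_expR.
by apply: cvgM; [exact: cvg_cst|exact: continuous_logR].
Qed.

(** The range of [r] says that [r + 1] and [p - 1 - r] both lie in [[0, p]], so their multiples of
    [x] stay in [[0, pi]]. *)
Lemma weight_ge0 r : -1 <= r <= p - 1 -> {in `]0, tip[, forall x, 0 <= weight r x}.
Proof.
move=> /andP[r1 rq] x xD; have [x0 xt s1 s2 s3] := sin_args p1 xD.
have px : p * x < pi by rewrite -(tipM p1) ltr_pM2l.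
have sin_ge0 k : 0 <= k <= p -> 0 <= sin (k * x).
  move=> /andP[k0 kp]; apply: sin_ge0_pi; apply/andP; split; first by rewrite mulr_ge0// ltW.
  by apply: le_trans (ltW px); rewrite ler_wpM2r// ltW.
rewrite addr_ge0// ?mulr_ge0 ?invr_ge0 ?(ltW s1) ?(ltW s2) ?(ltW q0)//; apply: sin_ge0; lra.
Qed.

Lemma wcurve_ge0 r : -1 <= r <= p - 1 -> {in `]0, tip[, forall x, 0 <= wcurve r x}.
Proof.
move=> hr x xD; rewrite mulr_ge0 ?invr_ge0 ?pi_ge0// mulr_ge0 ?expR_ge0//.
exact: weight_ge0.
Qed.

Lemma xinvP y : y \in `]0, cp p[ -> (xinv y \in `]0, tip[) /\ xcurve (xinv y) = y.
Proof.
exact: (XinvP (tip_gt0 p1) is_derive_xcurve xcurve_decreasing xcurve_cvg0 xcurve_cvg_tip).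
Qed.

Lemma xcurveK : {in `]0, tip[, cancel xcurve xinv}.
Proof.
exact: (XinvK (tip_gt0 p1) is_derive_xcurve xcurve_decreasing xcurve_cvg0 xcurve_cvg_tip).
Qed.

Lemma continuous_dens r : {in `]0, cp p[, continuous (dens r)}.
Proof.
move=> y yc; have [xD _] := xinvP yc.
have ci : {for y, continuous xinv}.
  exact: (continuous_Xinv (tip_gt0 p1) is_derive_xcurve xcurve_decreasing xcurve_cvg0 xcurve_cvg_tip).
apply: cvgM.
  by apply: (@continuous_comp _ _ _ xinv (wcurve r)) => //; exact: continuous_wcurve.
apply: cvgV; first by rewrite lt0r_neq0// xspeed_gt0.
by apply: (@continuous_comp _ _ _ xinv xspeed) => //; exact: continuous_xspeed.
Qed.

Lemma dens_ge0 r : -1 <= r <= p - 1 -> {in `]0, cp p[, forall y, 0 <= dens r y}.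
Proof.
move=> hr y /xinvP[xD _]; rewrite divr_ge0 ?wcurve_ge0// ltW// xspeed_gt0//.
Qed.

Lemma dens_xcurve r : {in `]0, tip[, forall x, dens r (xcurve x) * xspeed x = wcurve r x}.
Proof. by move=> x xD; rewrite /dens xcurveK// divfK// lt0r_neq0// xspeed_gt0. Qed.

(** For [t] inside []0, cp p[] the condition [X x < t] cuts out []xinv t, tip[], which [X] maps onto
    []0, t[]; the other [t] give the empty set or everything. *)
Lemma dens_ray r t : -1 <= r <= p - 1 ->
  (\int[mu]_(y in `]-oo, t[ `&` `]0%R, cp p[) (dens r y)%:E =
   \int[mu]_(x in D `&` [set x | (xcurve x < t)%R]) (wcurve r x)%:E)%E.
Proof.
move=> hr; have t0' := tip_gt0 p1.
have [t0|t0] := leP t 0.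
  rewrite (_ : _ `&` _ = set0) ?integral_set0; last first.
    by apply/seteqP; split => y //= -[]; rewrite !in_itv /= => h1 /andP[h2 h3]; lra.
  rewrite (_ : _ `&` _ = set0) ?integral_set0//.
  by apply/seteqP; split => x //= -[xD h]; have /andP[h1 h2] := xcurve_itv xD; lra.
have [tc|tc] := leP (cp p) t.
  rewrite (_ : _ `&` _ = `]0, cp p[%classic); last first.
    apply/seteqP; split => y /=; first by case.
    by rewrite !in_itv /= => /andP[h1 h2]; split; [lra|rewrite h1].
  rewrite (_ : _ `&` _ = D); last first.
    apply/seteqP; split => x /=; first by case.
    by move=> xD; split => //; have /andP[_ h2] := xcurve_itv xD; apply: lt_le_trans tc.
  apply: (substitution_decreasing_oo t0' continuous_xspeed is_derive_xcurve xcurve_decreasing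
    xcurve_cvg0 xcurve_cvg_tip).
  - exact: continuous_dens.
  - exact: dens_ge0.
  - exact: continuous_wcurve.
  - exact: wcurve_ge0.
  - exact: dens_xcurve.
have tI : t \in `]0, cp p[ by rewrite in_itv /= t0.
have [aD aE] := xinvP tI; set a := xinv t in aD aE.
move: (aD); rewrite in_itv /= => /andP[a0 at'].
have sub x : x \in `]a, tip[ -> x \in `]0, tip[.
  by rewrite !in_itv /= => /andP[h1 h2]; rewrite (lt_trans a0).
have subt y : y \in `]0, t[ -> y \in `]0, cp p[.
  by rewrite !in_itv /= => /andP[h1 h2]; rewrite h1 (lt_trans h2).
rewrite (_ : `]-oo, t[ `&` _ = `]0, t[%classic); last first.
  apply/seteqP; split => y /=; first by rewrite !in_itv /= => -[-> /andP[->]].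
  by move=> h; split; [move: h; rewrite !in_itv /= => /andP[]|exact: subt].
rewrite (_ : D `&` _ = `]a, tip[%classic); last first.
  have lt_xcurve := X_lt xcurve_decreasing.
  apply/seteqP; split => x /=.
    move=> [xD]; rewrite -aE lt_xcurve// => ax; move: xD.
    by rewrite !in_itv /= ax => /andP[].
  move=> xa; have xD := sub _ xa; split => //.
  by rewrite -aE lt_xcurve//; move: xa; rewrite in_itv /= => /andP[].
apply: (@substitution_decreasing_oo _ a tip t xcurve xspeed).
- exact: at'.
- by move=> x /sub; exact: continuous_xspeed.
- by move=> x /sub; exact: is_derive_xcurve.
- by move=> x y /sub xD /sub yD; exact: xcurve_decreasing.
- by rewrite -aE; apply: cvg_at_right_filter; exact: continuous_xcurve.
- exact: xcurve_cvg_tip.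
- by move=> y /subt; exact: continuous_dens.
- by move=> y /subt; exact: dens_ge0.
- by move=> x /sub; exact: continuous_wcurve.
- by move=> x /sub; exact: wcurve_ge0.
- by move=> x /sub; exact: dens_xcurve.
Qed.

(** [weight (-1)] is [(p - 1) rho], which cancels the factor [rho^-1]. The weight is therefore
    integrable although the exponent -1 is the excluded borderline. *)
Lemma wcurveN1 : {in `]0, tip[, forall x, wcurve (-1) x = (p - 1) / pi}.
Proof.
move=> x xD; have [x0 xt s1 s2 s3] := sin_args p1 xD.
have -> : (-1 : R) = 0 - 1 by rewrite sub0r.
rewrite /wcurve weight_pred_args sub0r !mul0r sin0 cos0 mul0r add0r mulr0 subr0 mulr1.
have -> : expR (-1 * logR x) = sin ((p - 1) * x) / sin (p * x).
  by rewrite mulN1r !logRE opprB expRB !lnK.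
rewrite mulrC; congr (_ / _).
by field; rewrite !lt0r_neq0.
Qed.

Lemma integrable_wcurve r : -1 <= r -> mu.-integrable D (EFin \o wcurve r).
Proof.
rewrite le_eqVlt => /predU1P[<-|r1].
  apply: (eq_integrable _ (EFin \o cst ((p - 1) / pi))) => //; last exact: integrable_cst_oo.
  by move=> x; rewrite inE => xD /=; rewrite wcurveN1.
have [C HC] := weight_bounded p1 r.
apply: integrable_realZ => //.
have := @integrable_kernel _ p p1 0 r (weight r) C.
rewrite mul0r add0r => /(_ r1 (@continuous_weight _ p p1 r) HC).
apply: eq_integrable => // x xD; rewrite /= /kmod mul0r add0r//.
Qed.

Variables k l : nat.
Hypotheses (l_gt0 : (0 < l)%N) (lk : (l < k)%N) (pE : p = k%:R / l%:R).

(** At [s = 0] both sides of [mellin_cGammaV] contain the same nonzero value at [r + 1], which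
    cancels. *)
Lemma mellin0 r : -1 < r -> mellin 0 r = 1.
Proof.
move=> r1; have A1 : -1 < complex.Re 0 * p + r by rewrite /= mul0r add0r.
have := mellin_cGammaV p1 l_gt0 lk pE A1; rewrite !mul0r !add0r.
have -> : cGammaV (1 : R[i]) = 1.
  have := @gauss_cGammaV R 0; rewrite add0r => H; apply: ccvg_unique H _.
  have -> : gauss (0 : R[i]) = (fun=> 1) by apply/funext => n; exact: gauss0.
  exact: ccvg_cst.
have np : ~ Gamma_pole (r%:C + 1).
  move=> [n] /(congr1 (@complex.Re _)); rewrite cReD cReN cRe_nat /=.
  have n0 : 0 <= n%:R :> R by [].
  by move=> ?; lra.
by move=> H; apply: (mulIf (cGammaV_neq0 np)).
Qed.

(** Start from total mass 1 at the parameter [r + n (p - 1)] and iterate the shift [n] times; the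
    rising product is the numerator of [gbinom] read backwards. *)
Lemma mellin_nat n r : -1 < n%:R * (p - 1) + r -> mellin n%:R r = (gbinom (n%:R * p + r) n)%:C.
Proof.
move=> r1; have n0 : 0 <= n%:R :> R by [].
pose r' := r + n%:R * (p - 1).
have A1 : -1 < complex.Re 0 * p + r' by rewrite /= mul0r add0r /r' addrC.
have := mellin_iter_shift p1 n A1; rewrite mellin0 ?mulr1; last by rewrite /r' addrC.
rewrite !mul0r !add0r rising1 /r' addrK => H.
apply: (mulfI (factC_neq0 n)); rewrite -H /gbinom natrC -rmorphM mulrCA mulfV ?mulr1; last first.
  by rewrite pnatr_eq0 -lt0n fact_gt0.
rewrite rmorph_prod (reindex_inj rev_ord_inj) /rising; apply: eq_bigr => i _.
have -> : n%:R * p + r - (rev_ord i)%:R = r + n%:R * (p - 1) + 1 + i%:R :> R.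
  by rewrite natrB ?(ltn_ord i)// -[i.+1%:R]natr1; ring.
by rewrite [RHS]rmorphD [in RHS]rmorphD rmorph1 rmorph_nat.
Qed.

Definition atom_mass r : R := if r == -1 then p^-1 else 0.

(** The only case not covered by [mellin_nat] is [n = 0], [r = -1]: there the curve carries mass
    [(p - 1)/p] and the atom supplies the rest. *)
Lemma wcurve_moment n r : -1 <= r ->
  gbinom (n%:R * p + r) n = atom_mass r * 0 ^+ n + \int[mu]_(x in D) (xcurve x ^+ n * wcurve r x).
Proof.
move=> r1; have [r_gt|] := boolP (-1 < n%:R * (p - 1) + r).
  have n0 : 0 <= n%:R :> R by [].
  have M : gbinom (n%:R * p + r) n = complex.Re (mellin n%:R r) by rewrite mellin_nat.
  have -> : atom_mass r * 0 ^+ n = 0.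
    rewrite /atom_mass; case: eqP => [rE|_]; last by rewrite mul0r.
    by case: n r_gt {n0 M} => [|n] r_gt; [lra|rewrite expr0n mulr0].
  rewrite add0r M !mellinE cRe_realM Re_cint.
  rewrite -RintegralZl//; last first.
    by have [] := @cintegrable_weight _ p p1 n%:R r r _; rewrite ?cRe_nat//; lra.
  apply: eq_Rintegral => x _.
  rewrite [X in complex.Re X]mulrC cRe_realM Re_cker cIm_nat mul0r cos0 mulr1 /kmod cRe_nat /wcurve /xcurve.
  by rewrite expRD -expRM_natl; ring.
case: n => [|n]; last first.
  have n0 : 0 <= n%:R :> R by [].
  have nq : 0 <= n%:R * (p - 1) by rewrite mulr_ge0// ltW.
  move/negP; case; rewrite -[n.+1%:R]natr1 mulrDl mul1r.
  by move: (n%:R * (p - 1)) nq q0 r1 => u u0 v0 r1; move: (p - 1) v0 => v v0; lra.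
rewrite mul0r add0r -leNgt => r1'; have -> : r = -1 by apply/eqP; rewrite eq_le r1'.
rewrite /atom_mass eqxx /gbinom big_ord0 fact0 divr1 expr0 mulr1.
rewrite (@eq_Rintegral _ _ _ _ _ (cst ((p - 1) / pi))); last first.
  by move=> x; rewrite inE => xD; rewrite expr0 mul1r wcurveN1.
rewrite Rintegral_cst//.
have E : lebesgue_measure (`]0, tip[%classic : set R) = tip%:E.
  by rewrite lebesgue_measure_itv /= lte_fin tip_gt0// oppr0 adde0.
rewrite (_ : fine _ = tip); last exact: (congr1 fine E).
have pin0 : pi != 0 :> R by rewrite lt0r_neq0// pi_gt0.
by rewrite !tipE mulrA divfK//; field; rewrite lt0r_neq0.
Qed.

Lemma atom_mass_ge0 r : 0 <= atom_mass r.
Proof. by rewrite /atom_mass; case: ifP => // _; rewrite invr_ge0 ltW. Qed.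

Theorem is_nu_dens r (nu : probability (measurableTypeR R) R) : -1 <= r <= p - 1 ->
  is_nu p r nu -> forall A : set R, measurable A ->
  (nu A = (atom_mass r)%:E * \d_(0%R : R) A +
     \int[mu]_(x in A `&` `]0%R, cp p[) (dens r x)%:E)%E.
Proof.
move=> hr hnu A mA; have /andP[r1 rq] := hr.
have nui n : nu.-integrable setT (fun x => (x ^+ n)%:E) by have [] := hnu n.
have num n : \int[nu]_x (x ^+ n) =
    atom_mass r * 0 ^+ n + \int[mu]_(x in D) (xcurve x ^+ n * wcurve r x).
  by rewrite -wcurve_moment// /Rintegral; have [_ ->] := hnu n.
have xci : {in `]0, tip[, forall x, 0 <= xcurve x <= cp p}.
  by move=> x /xcurve_itv /andP[h1 h2]; rewrite !ltW.
rewrite (@density_of_rays _ (atom_mass r) (cp p) (dens r) (atom_mass_ge0 r) (@continuous_dens r) (dens_ge0 hr))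
  ?atom_densityE//.
move=> t; rewrite (nu_ray continuous_xcurve xci (wcurve_ge0 hr) (integrable_wcurve r1)
  (atom_mass_ge0 r) cp_gt0 nui num) atom_densityE dens_ray// EFinD EFinM diracE.
congr (_ * _ + _)%E.
  rewrite (_ : (0 \in _) = (0 < t))//; apply/idP/idP; rewrite inE /= in_itv//.
have mX : measurable_fun D xcurve by exact: oo_continuous_measurable continuous_xcurve.
have mA' : measurable (D `&` [set x | xcurve x < t]).
  rewrite (_ : [set x | _] = xcurve @^-1` `]-oo, t[); first exact: mX.
  by apply/seteqP; split => x /=; rewrite in_itv.
rewrite /Rintegral fineK//; apply: integrable_fin_num => //.
by apply: integrableS (integrable_wcurve r1) => //; exact: measurable_itv.
Qed.

End nu_density.

(** * Inversion of the Mellin transform *)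

Section fubini_kernel.
Context {R : realType}.
Notation mu := (@lebesgue_measure R).

(** The product is dominated by [|h x|] over a set of finite measure in [t]. Both functions are
    extended by 0 in order to apply Fubini on the whole plane. *)
Lemma fubini_kernel (A D : set R) (h : R -> R) (k : R -> R -> R) :
  measurable A -> measurable D -> (mu A < +oo)%E ->
  mu.-integrable D (EFin \o h) ->
  measurable_fun setT (fun z : measurableTypeR R * measurableTypeR R => k z.1 z.2) ->
  (forall t x, `|k t x| <= 1) ->
  \int[mu]_(t in A) (\int[mu]_(x in D) (h x * k t x)) =
  \int[mu]_(x in D) (h x * \int[mu]_(t in A) k t x).
Proof.
move=> mA mD Afin ih mk k1.
pose hD (x : R) : R := if x \in D then h x else 0.
pose F (z : measurableTypeR R * measurableTypeR R) : \bar R := (\1_A z.1 * (hD z.2 * k z.1 z.2))%:E.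
have /integrableP[/measurable_EFinP mh hfin] := ih.
have mhD : measurable_fun setT hD.
  apply/measurable_EFinP; rewrite (_ : EFin \o hD = (EFin \o h) \_ D).
    apply/(measurable_restrictT _ _).1; first exact: mD.
    exact/measurable_EFinP.
  by apply/funext => x; rewrite /= /hD patchE; case: ifP.
have mkx t : measurable_fun setT (k t).
  exact: (measurableT_comp mk (measurable_pair1 t)).
have mkt x : measurable_fun setT (fun t => k t x).
  exact: (measurableT_comp mk (measurable_pair2 x)).
have mF : measurable_fun setT F.
  apply/measurable_EFinP; apply: measurable_funM.
    have mi : measurable_fun setT (\1_A : measurableTypeR R -> measurableTypeR R) by exact: measurable_indic.
    by apply: (measurableT_comp mi); exact: measurable_fst.
  by apply: measurable_funM => //; apply: (measurableT_comp mhD); exact: measurable_snd.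
have ihk t : mu.-integrable D (EFin \o (fun x => h x * k t x)).
  have ih' := ih; apply: le_integrable ih' => //.
    by apply/measurable_EFinP; apply: measurable_funM;
      [exact: mh|exact: measurable_funTS (mkx t)].
  by move=> x _ /=; rewrite lee_fin normrM ler_piMr.
have ik x : mu.-integrable A (EFin \o (fun t => k t x)).
  apply/integrableP; split; first by apply/measurable_EFinP; exact: measurable_funTS (mkt x).
  apply: le_lt_trans (_ : (\int[mu]_(t in A) cst 1%:E t < +oo)%E).
    apply: ge0_le_integral => //.
    - by apply: measurableT_comp => //; apply/measurable_EFinP; exact: measurable_funTS (mkt x).
    - by move=> t _ /=; rewrite lee_fin.
  by rewrite integral_cst// mul1e.
have F1 t : (\int[mu]_x F (t, x) = ((fun t => \int[mu]_(x in D) (h x * k t x)%:E) \_ A) t)%E.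
  rewrite patchE; case: ifPn => tA; last first.
    by under eq_integral do rewrite /F /= indicE (negbTE tA) mul0r; rewrite integral0.
  rewrite [RHS]integral_mkcond; apply: eq_integral => x _.
  rewrite /F /= indicE tA mul1r /hD patchE; case: ifPn => //=; by rewrite mul0r.
have F2 x : (\int[mu]_t F (t, x) = ((fun x => (h x * \int[mu]_(t in A) k t x)%:E) \_ D) x)%E.
  rewrite patchE; case: ifPn => xD; last first.
    by under eq_integral do rewrite /F /= /hD (negbTE xD) mul0r mulr0; rewrite integral0.
  rewrite EFinM /Rintegral fineK; last by apply: integrable_fin_num => //; exact: ik.
  rewrite -integralZl//; last exact: ik.
  rewrite [RHS]integral_mkcond; apply: eq_integral => t _.
  rewrite /F /= indicE /hD patchE xD; case: (t \in A) => //=; by rewrite ?mul1r ?mul0r.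
have iF : (mu \x mu)%E.-integrable setT F.
  apply/(integrable12ltyP mu mu mF).
  have mabs : measurable_fun setT ((fun x => `|(h x)%:E|%E) \_ D).
    rewrite (_ : _ \_ _ = (fun x => `|(hD x)%:E|%E)); last first.
      by apply/funext => x; rewrite patchE /hD; case: ifP => // _; rewrite abse0.
    by apply: measurableT_comp => //; exact/measurable_EFinP.
  have le t : (\int[mu]_x `|F (t, x)| <= (\1_A t)%:E * \int[mu]_(x in D) `|(h x)%:E|)%E.
    rewrite [in leRHS]integral_mkcond -ge0_integralZl//; last first.
      by move=> x _; rewrite patchE; case: ifPn.
    apply: ge0_le_integral => //.
    - by apply: measurableT_comp => //; exact: (measurableT_comp mF (measurable_pair1 t)).
    - by apply: measurable_funeM; exact: mabs.
    - move=> x _; rewrite /F /= indicE /hD patchE.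
      case: (t \in A); rewrite ?mul1r ?mul0r ?normr0 ?mul0e// mul1e.
      case: ifPn => _; last by rewrite mul0r normr0.
      by rewrite lee_fin normrM ler_piMr.
  apply: le_lt_trans (_ : (\int[mu]_t ((\1_A t)%:E * \int[mu]_(x in D) `|(h x)%:E|) < +oo)%E).
    apply: ge0_le_integral => //.
    - by move=> t _; exact: integral_ge0.
    - have mF' : measurable_fun setT (abse \o F) by apply: measurableT_comp.
      have F0' z : (0 <= (abse \o F) z)%E by exact: abse_ge0.
      exact: (@measurable_fun_fubini_tonelli_F _ _ (measurableTypeR R) (measurableTypeR R) R mu _ mF' F0').
    - by apply: emeasurable_funM => //; apply/measurable_EFinP; exact: measurable_indic.
  rewrite ge0_integralZr//; last 2 first.
  - by apply/measurable_EFinP; exact: measurable_indic.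
  - exact: integral_ge0.
  rewrite integral_indic// setIT lte_mul_pinfty//.
  by rewrite ge0_fin_numE.
rewrite /Rintegral.
have -> : (\int[mu]_(t in A) (fine (\int[mu]_(x in D) (h x * k t x)%:E))%:E =
    \int[mu]_t \int[mu]_x F (t, x))%E.
  rewrite integral_mkcond; apply: eq_integral => t _; rewrite F1 !patchE; case: ifPn => // _.
  by rewrite fineK//; apply: integrable_fin_num => //; exact: ihk.
rewrite (Fubini iF) integral_mkcond; congr fine.
by apply: eq_integral => x _; rewrite F2.
Qed.

End fubini_kernel.

Lemma Im_cint {R : realType} (A : set R) (f : R -> R[i]) :
  complex.Im (cint A f) = \int[lebesgue_measure]_(x in A) complex.Im (f x).
Proof. by []. Qed.

Section symmetric_integrals.
Context {R : realType}.
Notation mu := (@lebesgue_measure R).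
Implicit Types (T u : R).

Lemma Rintegral_sym_FTC T (f F : R -> R) : 0 < T -> continuous f ->
  (forall x : R, is_derive x (1 : R) F (f x)) ->
  \int[mu]_(t in `[- T, T]) f t = F T - F (- T).
Proof.
move=> T0 cf dF.
have TT : - T < T by lra.
have sub : `[- T, T] `<=` `]- T - 1, T + 1[.
  by move=> x /=; rewrite !in_itv /= => /andP[h1 h2]; apply/andP; split; lra.
by rewrite /Rintegral (FTC_cc TT sub (F := F)).
Qed.

Lemma Rintegral_sym_cos T u : 0 < T ->
  \int[mu]_(t in `[- T, T]) cos (t * u) = 2 * (T * sinc (T * u)).
Proof.
move=> T0; have [->|u0] := eqVneq u 0.
  transitivity (id T - id (- T)); first apply: Rintegral_sym_FTC => //.
  - by move=> x; under eq_fun do rewrite mulr0; exact: cvg_cst.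
  - by move=> x; rewrite mulr0 cos0; exact: is_derive_id.
  - by rewrite mulr0 /sinc eqxx /=; ring.
pose F t := u^-1 * sin (u * t).
transitivity (F T - F (- T)); last first.
  rewrite /F mulrN sinN [u * T]mulrC -sincM; move: (sinc _) => v; field; exact: u0.
apply: Rintegral_sym_FTC => //.
- by move=> x; under eq_fun do rewrite mulrC; exact: continuous_cos_lin.
- move=> x; have -> : cos (x * u) = u^-1 * (cos (u * x) * u) by rewrite mulrCA mulVf ?mulr1 1?mulrC.
  by apply: is_deriveZ; apply: is_derive_sin_comp; exact: is_derive_lin.
Qed.

Lemma Rintegral_sym_sin T u : 0 < T -> \int[mu]_(t in `[- T, T]) sin (t * u) = 0.
Proof.
move=> T0; have [->|u0] := eqVneq u 0.
  transitivity ((fun=> 0 : R) T - (fun=> 0 : R) (- T)); last by rewrite subrr.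
  apply: Rintegral_sym_FTC => //.
  - by move=> x; under eq_fun do rewrite mulr0; exact: cvg_cst.
  - by move=> x; rewrite mulr0 sin0; exact: is_derive_cst.
pose F t := - u^-1 * cos (u * t).
transitivity (F T - F (- T)); last by rewrite /F mulrN cosN subrr.
apply: Rintegral_sym_FTC => //.
- by move=> x; under eq_fun do rewrite mulrC; exact: continuous_sin_lin.
- move=> x; have -> : sin (x * u) = - u^-1 * (- sin (u * x) * u).
    by rewrite [u * x]mulrC; move: (sin _) => v; field; exact: u0.
  by apply: is_deriveZ; apply: is_derive_cos_comp; exact: is_derive_lin.
Qed.

End symmetric_integrals.

Section inversion.
Context {R : realType}.
Notation mu := (@lebesgue_measure R).
Implicit Types (x y r t T : R).
Variable p : R.
Hypothesis p1 : 1 < p.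
Let p0 : 0 < p. Proof. exact: lt_trans p1. Qed.
Let q0 : 0 < p - 1. Proof. by rewrite subr_gt0. Qed.
Notation tip := (tip p).
Notation logx := (logx p).
Notation logR := (logR p).
Notation dlogx := (dlogx p).
Notation weight := (weight p).
Notation mellin := (mellin p).
Notation D := (`]0, tip[%classic : set R).
Variables k l : nat.
Hypotheses (l_gt0 : (0 < l)%N) (lk : (l < k)%N) (pE : p = k%:R / l%:R).
Variables r d y : R.
Hypothesis hd : -1 < (d - 1) * p + r.
Hypothesis yI : y \in `]0, cp p[.

Let x0 := xinv p y.
Let x0D : x0 \in `]0, tip[. Proof. by have [] := xinvP p1 yI. Qed.
Let x0E : expR (logx x0) = y. Proof. by have [_] := xinvP p1 yI. Qed.
Let lny : ln y = logx x0. Proof. by rewrite -x0E expRK. Qed.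

(** The part of the integrand that does not depend on the ordinate [t]: the modulus
    [y^(-d) X^(d-1) rho^r], times [B_r / pi]. *)
Let h x := pi^-1 * (expR (- d * ln y) * (kmod p (d - 1) r x * weight r x)).

Let h_integrable : mu.-integrable D (EFin \o h).
Proof.
apply: integrable_realZ => //; apply: integrable_realZ => //.
have [C HC] := weight_bounded p1 r.
apply: (@integrable_kernel _ p p1 (d - 1) r (weight r) C) => //.
exact: continuous_weight.
Qed.

(** As [ln y = logx x0], the powers of [y] and [X] with exponents [- it] and [it] combine into one
    phase [t (logx x - logx x0)]. *)
Lemma integrand_phase t x :
  cpow y (- (d +i* t)) * (cker p (d +i* t - 1) r x * (weight r x)%:C) =
  (pi * (h x * cos (t * (logx x - logx x0)))) +i* (pi * (h x * sin (t * (logx x - logx x0)))).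
Proof.
have pin0 : pi != 0 :> R by rewrite lt0r_neq0// pi_gt0.
rewrite /cpow !ckerE mulrA -cexpD mulrC.
set e := (X in cexp X).
have Re_e : complex.Re e = - d * ln y + ((d - 1) * logx x + r * logR x).
  by rewrite /e !(cReD, cReM, cReN, cImD, cImN) /=; ring.
have Im_e : complex.Im e = t * (logx x - logx x0).
  by rewrite /e !(cImD, cImM, cImN, cReD, cReN) /= lny; ring.
have pK (v : R) : pi * (pi^-1 * v) = v by exact: mulVKf.
apply: complex_ext; rewrite ?cRe_realM ?cIm_realM ?Re_cexp ?Im_cexp Re_e Im_e /= /h.
  by rewrite [RHS]mulrA pK expRD /kmod; ring.
by rewrite [RHS]mulrA pK expRD /kmod; ring.
Qed.

Lemma psi_integrand t : cpow y (- (d +i* t)) * psi p r (d +i* t) =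
  (\int[mu]_(x in D) (h x * cos (t * (logx x - logx x0)))) +i*
  (\int[mu]_(x in D) (h x * sin (t * (logx x - logx x0)))).
Proof.
have A1 : -1 < complex.Re (d +i* t - 1) * p + r by rewrite cReD cReN.
have := psi_mellin p1 l_gt0 lk pE A1; rewrite subrK => ->.
have ci := cintegrable_weight p1 r A1.
have ci' := cintegrableZ (measurable_itv _) (cpow y (- (d +i* t))) ci.
rewrite !mellinE mulrCA -cintZ// -cintZ//.
have pin0 : pi != 0 :> R by rewrite lt0r_neq0// pi_gt0.
apply: complex_ext; rewrite ?Re_cint ?Im_cint [RHS]/=; apply: eq_Rintegral => x _.
  by rewrite integrand_phase cRe_realM mulKf.
by rewrite integrand_phase cIm_realM mulKf.
Qed.

(** The phase extended by 0 off the interval, where [logx] has no meaning, so that the kernel is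
    measurable on the whole plane. *)
Let u x := if x \in `]0, tip[ then logx x - logx x0 else 0.

Let mu_u : measurable_fun setT u.
Proof.
have mD : measurable (D : set (measurableTypeR R)) by exact: measurable_itv.
apply/measurable_EFinP.
rewrite (_ : EFin \o u = (EFin \o (fun x => logx x - logx x0)) \_ D); last first.
  apply/funext => x; rewrite patchE /= /u.
  rewrite (_ : (x \in D) = (x \in `]0, tip[)); last by apply/idP/idP; rewrite inE.
  by case: ifP.
apply/(measurable_restrictT _ _).1; first exact: mD.
apply/measurable_EFinP; apply: oo_continuous_measurable => x xD.
by apply: cvgB; [exact: continuous_logx|exact: cvg_cst].
Qed.

Let h_phase (f : R -> R) t : continuous f -> (forall x, `|f x| <= 1) ->
  mu.-integrable D (EFin \o (fun x => h x * f (t * (logx x - logx x0)))).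
Proof.
move=> cf f1; apply: (integrable_le_oo (g := fun x => `|h x|)).
- move=> x xD; apply: cvgM.
    apply: cvgM; first exact: cvg_cst.
    apply: cvgM; first exact: cvg_cst.
    by apply: cvgM; [exact: continuous_kmod|exact: continuous_weight].
  apply: (@continuous_comp _ _ _ (fun x => t * (logx x - logx x0)) f); last exact: cf.
  apply: cvgM; first exact: cvg_cst.
  by apply: cvgB; [exact: continuous_logx|exact: cvg_cst].
- by move=> x _; rewrite normrM ler_piMr.
- exact: integrable_abse h_integrable.
Qed.

Lemma fubini_phase T (g : R -> R) (f : R -> R) : mu.-integrable D (EFin \o g) ->
  continuous f -> (forall x, `|f x| <= 1) ->
  \int[mu]_(t in `[- T, T]) (\int[mu]_(x in D) (g x * f (t * (logx x - logx x0)))) =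
  \int[mu]_(x in D) (g x * \int[mu]_(t in `[- T, T]) f (t * (logx x - logx x0))).
Proof.
move=> ig cf f1.
have uE x : D x -> u x = logx x - logx x0 by rewrite /u /= => ->.
transitivity (\int[mu]_(t in `[- T, T]) (\int[mu]_(x in D) (g x * f (t * u x)))).
  by apply: eq_Rintegral => t _; apply: eq_Rintegral => x; rewrite inE => xD; rewrite uE.
transitivity (\int[mu]_(x in D) (g x * \int[mu]_(t in `[- T, T]) f (t * u x))); last first.
  by apply: eq_Rintegral => x; rewrite inE => xD; rewrite uE.
apply: (fubini_kernel (k := fun t x => f (t * u x))) => //.
  rewrite lebesgue_measure_itv /=; case: ifP => // _; exact: ltry.
have mf : measurable_fun setT (f : measurableTypeR R -> measurableTypeR R).
  exact: continuous_measurable_fun.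
apply: (measurableT_comp mf); apply: measurable_funM; first exact: measurable_fst.
by apply: (measurableT_comp mu_u); exact: measurable_snd.
Qed.

(** The sine part is odd in [t] and integrates to 0; the factor [i] of the parametrization makes the
    cosine part purely imaginary. *)
Lemma vertical_integralE T : 0 < T ->
  vertical_integral d T (fun s => cpow y (- s) * psi p r s) =
  0 +i* \int[mu]_(x in D) (2 * h x * (T * sinc (T * (logx x - logx x0)))).
Proof.
move=> T0; rewrite /vertical_integral /cintegral; apply: complex_ext => /=.
  transitivity (\int[mu]_(t in `[- T, T]) (\int[mu]_(x in D) (- 1 * h x * sin (t * (logx x - logx x0))))); last first.
    rewrite fubini_phase//.
    - rewrite (@eq_Rintegral _ _ _ _ _ (cst 0)) ?Rintegral_cst ?mul0r//.
      by move=> x _; rewrite Rintegral_sym_sin// mulr0.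
    - exact: integrable_realZ.
    - exact: continuous_sin.
    - by move=> x; exact: sin_max.
  apply: eq_Rintegral => t _; rewrite psi_integrand cReM /= mulr0 mulr1 sub0r.
  rewrite -[LHS]mulN1r -RintegralZl//; last by apply: h_phase; [exact: continuous_sin|move=> x; exact: sin_max].
  by apply: eq_Rintegral => x _; rewrite mulrA.
transitivity (\int[mu]_(t in `[- T, T]) (\int[mu]_(x in D) (h x * cos (t * (logx x - logx x0))))).
  by apply: eq_Rintegral => t _; rewrite psi_integrand cImM /= mulr1 mulr0 addr0.
rewrite fubini_phase//.
- by apply: eq_Rintegral => x _; rewrite Rintegral_sym_cos// mulrCA mulrA.
- exact: continuous_cos.
- by move=> x; exact: cos_max.
Qed.

Let h_derivable : derivable (fun x => 2 * h x / dlogx x) x0 1.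
Proof.
have [_ _ s1 s2 s3] := sin_args p1 x0D.
have dsin j : derivable (fun x => sin (j * x)) x0 1.
  by have [] := is_derive_sin_comp (is_derive_lin j x0).
have dcos j : derivable (fun x => cos (j * x)) x0 1.
  by have [] := is_derive_cos_comp (is_derive_lin j x0).
have dcot j : 0 < sin (j * x0) -> derivable (fun x => cos (j * x) / sin (j * x)) x0 1.
  move=> s0; apply: derivableM; first exact: dcos.
  by apply: derivableV; [rewrite lt0r_neq0|exact: dsin].
have d1 : derivable dlogx x0 1.
  have -> : dlogx = (fun x => (p - 1) ^+ 2 * (cos ((p - 1) * x) / sin ((p - 1) * x))
    + cos (1 * x) / sin (1 * x) - p ^+ 2 * (cos (p * x) / sin (p * x))).
    by apply/funext => x; rewrite !dlogxE mul1r.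
  apply: derivableB; first apply: derivableD.
  - by apply: derivableM; [exact: derivable_cst|exact: dcot].
  - by apply: dcot; rewrite mul1r.
  - by apply: derivableM; [exact: derivable_cst|exact: dcot].
have d2 : derivable (weight r) x0 1.
  have -> : weight r = (fun x => sin ((r + 1) * x) / sin (1 * x) +
      (p - 1) * (sin ((p - 1 - r) * x) / sin ((p - 1) * x))).
    by apply/funext => x; rewrite !weightE mul1r.
  apply: derivableD.
    apply: derivableM; first exact: dsin.
    by apply: derivableV; [rewrite mul1r lt0r_neq0|exact: dsin].
  apply: derivableM; first exact: derivable_cst.
  apply: derivableM; first exact: dsin.
  by apply: derivableV; [rewrite lt0r_neq0|exact: dsin].
have d3 : derivable (kmod p (d - 1) r) x0 1.
  by have [] := is_derive_kmod p1 (d - 1) r x0D.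
apply: derivableM; last by apply: derivableV; [rewrite lt0r_neq0// dlogx_gt0|exact: d1].
do 3 (apply: derivableM; first exact: derivable_cst).
by apply: derivableM; [exact: d3|exact: d2].
Qed.

(** The result is independent of [d]: at [x0] the power [X^(d-1)] cancels [y^(1-d)], and the
    remaining [1/y] turns [dlogx] into the speed of the curve. *)
Lemma V_dens : V p r d y = (dens p r y)%:C.
Proof.
have pin0 : pi != 0 :> R by rewrite lt0r_neq0// pi_gt0.
have dl0 : dlogx x0 != 0 by rewrite lt0r_neq0// dlogx_gt0.
have y0 : 0 < y by move: yI; rewrite in_itv /= => /andP[].
have h2_integrable : mu.-integrable D (EFin \o (fun x => 2 * h x)) by exact: integrable_realZ.
have H := fourier_inversion (tip_gt0 p1) (is_derive_logx p1) (continuous_dlogx p1)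
  (dlogx_gt0 p1) h2_integrable x0D (DeriveDef h_derivable erefl).
have L : ccvg +oo (fun T => vertical_integral d T (fun s => cpow y (- s) * psi p r s))
    (0 +i* (pi * (2 * h x0 / dlogx x0))).
  apply: (@ccvg_near _ _ _ _ (fun T => 0 +i*
    \int[mu]_(x in D) (2 * h x * (T * sinc (T * (logx x - logx x0)))))).
    near=> T; rewrite vertical_integralE//; near: T; exact: nbhs_pinfty_gt.
  by split; [exact: cvg_cst|exact: H].
rewrite /V (ccvg_lim L).
(* The limit carries exactly the factor [2 pi i] by which [V] divides. *)
have -> : 0 +i* (pi * (2 * h x0 / dlogx x0)) = 2 * pi%:C * 'i%C * (h x0 / dlogx x0)%:C.
  by apply: complex_ext; rewrite !(cReM, cImM) /=; ring.
rewrite mulKf; last first.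
  rewrite !mulf_neq0//.
  - by apply/eqP => /(congr1 (@complex.Re _)) /= /eqP; rewrite (negbTE pin0).
  - by apply/eqP => /(congr1 (@complex.Im _)) /= /eqP; rewrite oner_eq0.
congr (_%:C); rewrite /dens -/x0 /wcurve /xspeed /xcurve x0E /h /kmod.
have -> : expR (- d * ln y) = expR (- (d - 1) * ln y) / y.
  by rewrite -{3}(lnK y0) -expRB; congr expR; ring.
rewrite expRD lny mulNr expRN.
have e0 : expR ((d - 1) * logx x0) != 0 by rewrite lt0r_neq0// expR_gt0.
have y0' : y != 0 by rewrite lt0r_neq0.
move: (expR ((d - 1) * _)) e0 (pi^-1) => e e0 ip.
by field; rewrite e0 y0' dl0.
Unshelve. all: by end_near.
Qed.

End inversion.

Local Close Scope complex_scope.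

Theorem corollary4p3 (R : realType) (k l : nat) (p r d : R)
    (nu : probability (measurableTypeR R) R)
    (hl : (1 <= l)%N) (hlk : (l < k)%N) (hp : p = k%:R / l%:R)
    (hr : -1 <= r <= p - 1) (hd : 1 - (1 + r) / p < d)
    (hnu : is_nu p r nu) :
  (-1 < r -> nu `<< lebesgue_measure /\ has_density nu (cp p) (V p r d)) /\
  (r = -1 -> atom_plus_density nu p^-1 (cp p) (V p (-1) d)).
Proof.
have p1 : 1 < p by rewrite hp ltr_pdivlMr ?ltr0n// mul1r ltr_nat.
have p0 : 0 < p by exact: lt_trans p1.
(* The hypothesis on [d], multiplied by [p], is the integrability condition of the kernel at
   [tip]. *)
have hd' : -1 < (d - 1) * p + r.
  move: hd; rewrite -(ltr_pM2r p0) mulrBl divfK ?lt0r_neq0// mul1r mulrBl mul1r; lra.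
have VE x : x \in `]0, cp p[ -> V p r d x = ((dens p r x)%:C)%C.
  exact: (V_dens p1 hl hlk hp hd').
have VI x : x \in `]0, cp p[ -> complex.Im (V p r d x) = 0 by move=> /VE ->.
have VR x : x \in `]0, cp p[ -> complex.Re (V p r d x) = dens p r x by move=> /VE ->.
have mV : measurable_fun (`]0, cp p[ : set R) (fun x => complex.Re (V p r d x)).
  apply: (eq_measurable_fun (dens p r)); first by move=> x; rewrite inE => /VR ->.
  exact: oo_continuous_measurable (@continuous_dens _ _ p1 r).
have nuE (A : set R) : measurable A ->
    (nu A = (atom_mass p r)%:E * \d_(0%R : R) A +
      \int[lebesgue_measure]_(x in A `&` `]0%R, cp p[) (complex.Re (V p r d x))%:E)%E.
  move=> mA; rewrite (is_nu_dens p1 hl hlk hp hr hnu mA); congr (_ + _)%E.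
  by apply: eq_integral => x; rewrite inE => -[_ xI]; rewrite VR.
split=> [r1|r1].
  have m0 : atom_mass p r = 0 by rewrite /atom_mass gt_eqF.
  have nuE0 (A : set R) : measurable A -> (nu A =
      \int[lebesgue_measure]_(x in A `&` `]0%R, cp p[) (complex.Re (V p r d x))%:E)%E.
    by move=> mA; rewrite nuE// m0 mul0e add0e.
  split; last by split.
  apply/null_content_dominatesP => A mA A0; rewrite nuE0//.
  apply: null_set_integral => //; first exact: measurableI.
    by apply/measurable_EFinP; apply: measurable_funS mV.
  apply/eqP; rewrite eq_le measure_ge0 andbT -A0.
  by apply: le_measure; rewrite ?inE//; exact: measurableI.
have mE : atom_mass p r = p^-1 by rewrite /atom_mass r1 eqxx.
by rewrite -[in V p _ d]r1 -mE; split.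
Qed.
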